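(* For generic values of $c,\lambda$, the vertex superalgebra $\mathcal{W}^{\mathcal{N}=2}_\infty$ has a primary diamond structure.
   Context: $\mathcal{W}^{\mathcal{N}=2}_\infty$ is the universal $2$-parameter vertex superalgebra over $R=\mathbb{C}[c,\lambda]$ localized at $c,c-1,c+3$, freely generated by $H,G^\pm,L$ (weights $1,\frac32,\frac32,2$) and $W^{N,\bot},W^{N,\pm},W^{N,\top}$, $N\ge2$ (weights $N,N+\frac12,N+\frac12,N+1$; fields with $\pm$ odd), with: $H,G^\pm,L$ generating the $\mathcal{N}=2$ superconformal algebra $\mathrm{Vir}^c_{\mathcal{N}=2}$ ($H(z)H(w)\sim\frac{c/3}{(z-w)^2}$, $H(z)G^\pm(w)\sim\frac{\pm G^\pm(w)}{z-w}$, $G^+(z)G^-(w)\sim\frac{c/3}{(z-w)^3}+\frac{H(w)}{(z-w)^2}+\frac{(L+\frac12\partial H)(w)}{z-w}$, $L$ conformal); $H_{(0)}W^{N,\bot}=0$, $W^{N,\pm}=\mp G^\pm_{(0)}W^{N,\bot}$, $W^{N,\top}=\pm G^\pm_{(0)}G^\mp_{(0)}W^{N,\bot}\mp\frac12\partial W^{N,\bot}$; $W^{2,\bot}$ primary for $\mathrm{Vir}^c_{\mathcal{N}=2}$; $W^{2,\top}_{(1)}W^{N,\bot}=W^{N+1,\bot}$; an order-two automorphism $H\mapsto-H$, $G^\pm\mapsto G^\mp$, $L\mapsto L$, $W^{N,\bot}\mapsto(-1)^NW^{N,\bot}$, $W^{N,\pm}\mapsto(-1)^{N+1}W^{N,\mp}$,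 $W^{N,\top}\mapsto(-1)^{N+1}W^{N,\top}$; and $W^{2,\bot}(z)W^{2,\bot}(w)\sim\frac{\omega}{(z-w)^4}+\frac{(\frac{4\omega}{c-1}L-\frac{6\omega}{c(c-1)}:HH:+\lambda W^{2,\bot})(w)}{(z-w)^2}+\cdots$ ($\omega$ a scaling parameter). Primary diamond structure (here): there are even vectors $v_1,v_2,v_3,\dots$ such that $v_1=H$; for each $d\ge2$, $v_d$ is $\mathrm{Vir}^c_{\mathcal{N}=2}$-primary of conformal weight $d$ and $H_{(0)}$-weight $0$, i.e. $L_{(1)}v_d=d\,v_d$, $H_{(0)}v_d=0$ and $L_{(m+1)}v_d=H_{(m)}v_d=G^\pm_{(m)}v_d=0$ for all $m\ge1$; and the set $\{v_d,\ G^+_{(0)}v_d,\ G^-_{(0)}v_d,\ G^+_{(0)}G^-_{(0)}v_d\mid d\ge1\}$ is a minimal strong generating set. *)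

(* Defs.v *)
From HB Require Import structures.
From mathcomp Require Import all_boot all_order all_algebra.
From mathcomp Require Import boolp reals.
From mathcomp Require Export complex.

Set Implicit Arguments.
Unset Strict Implicit.
Unset Printing Implicit Defensive.

Import Order.TTheory GRing.Theory Num.Theory.

Local Open Scope ring_scope.

(* C[c, lambda] is {poly {poly C}}: the inner variable is c and the outer one *)
(* is lambda.                                                                 *)
Section BaseRing.
Variable K : realType.
Local Notation C := K[i].
Local Notation P2 := {poly {poly C}}.
Local Notation Frac := {fraction P2}.

Definition ev2 (p : P2) (c0 l0 : C) : C := p.[l0%:P].[c0].

Definition locden : P2 := ('X * ('X - 1) * ('X + 3%:R))%:P.

Definition locpred : {pred Frac} :=
  fun x => `[< exists p n, x = tofrac p / tofrac locden ^+ n >].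

Lemma locden_neq0 : locden != 0.
Proof.
rewrite polyC_eq0 !mulf_neq0 ?polyX_eq0 //.
  by rewrite -polyC1 polyXsubC_eq0.
by rewrite -[3%:R]opprK -polyC_natr -polyCN polyXsubC_eq0.
Qed.

Lemma tofrac_locden_neq0 n : tofrac locden ^+ n != 0.
Proof. by rewrite expf_neq0 // tofrac_eq0 locden_neq0. Qed.

Lemma locpred_subring : subring_closed locpred.
Proof.
split.
- by apply/asboolP; exists 1, 0%N; rewrite expr0 divr1 rmorph1.
- move=> x y /asboolP[p [m ->]] /asboolP[q [n ->]]; apply/asboolP.
  exists (p * locden ^+ n - q * locden ^+ m), (m + n)%N.
  rewrite -mulNr addf_div ?tofrac_locden_neq0 // exprD.
  by rewrite rmorphB !rmorphM !rmorphXn mulNr.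
- move=> x y /asboolP[p [m ->]] /asboolP[q [n ->]]; apply/asboolP.
  by exists (p * q), (m + n)%N; rewrite mulf_div rmorphM exprD.
Qed.

HB.instance Definition _ := GRing.isSubringClosed.Build Frac locpred
  locpred_subring.

Record coefR := CoefR { coefR_val : Frac; _ : coefR_val \in locpred }.

HB.instance Definition _ := [isSub for coefR_val].
HB.instance Definition _ := [Choice of coefR by <:].
HB.instance Definition _ := [SubChoice_isSubComNzRing of coefR by <:].

Definition coefR_unit : {pred coefR} :=
  fun x => (val x != 0) && ((val x)^-1 \in locpred).
Definition coefR_inv (x : coefR) : coefR := insubd x (val x)^-1.

Lemma coefR_mulVx : {in coefR_unit, left_inverse 1 coefR_inv *%R}.
Proof.
move=> x /andP[x0 xV]; apply: val_inj.
by rewrite rmorphM rmorph1 /= val_insubd xV mulVf.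
Qed.

Lemma coefR_unitPl (x y : coefR) : y * x = 1 -> x \in coefR_unit.
Proof.
move=> /(congr1 val); rewrite rmorphM rmorph1; change (val y * val x = 1 -> x \in coefR_unit) => yx1.
have x0 : val x != 0.
  by apply/eqP => x0; move/eqP: yx1; rewrite x0 mulr0 eq_sym oner_eq0.
apply/andP; split=> //.
suff -> : (val x)^-1 = val y by exact: valP.
by apply: (mulIf x0); rewrite mulVf.
Qed.

Lemma coefR_inv_out : {in [predC coefR_unit], coefR_inv =1 id}.
Proof.
move=> x; rewrite inE => xNU; apply: val_inj; rewrite val_insubd.
case: ifP => // xV; move: xNU; rewrite unfold_in xV andbT negbK => /eqP ->.
by rewrite invr0.
Qed.

HB.instance Definition _ := GRing.ComNzRing_hasMulInverse.Build coefR
  coefR_mulVx coefR_unitPl coefR_inv_out.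

Lemma tofrac_loc (p : P2) : tofrac p \in locpred.
Proof. by apply/asboolP; exists p, 0%N; rewrite expr0 divr1. Qed.

Definition of_poly2 (p : P2) : coefR := CoefR (tofrac_loc p).
Definition cst (z : C) : coefR := of_poly2 z%:P%:P.
Definition ccR : coefR := of_poly2 'X%:P.
Definition lamR : coefR := of_poly2 'X.

Lemma of_poly2_is_zmod_morphism : zmod_morphism of_poly2.
Proof. by move=> p q; apply: val_inj; rewrite rmorphB /= rmorphB. Qed.
Lemma of_poly2_is_monoid_morphism : monoid_morphism of_poly2.
Proof.
split=> [|p q]; apply: val_inj; first by rewrite rmorph1 /= rmorph1.
by rewrite rmorphM /= rmorphM.
Qed.
HB.instance Definition _ := GRing.isZmodMorphism.Build P2 coefR of_poly2
  of_poly2_is_zmod_morphism.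
HB.instance Definition _ := GRing.isMonoidMorphism.Build P2 coefR of_poly2
  of_poly2_is_monoid_morphism.

Lemma locden_unit : of_poly2 locden \is a GRing.unit.
Proof.
have hV : (tofrac locden)^-1 \in locpred.
  by apply/asboolP; exists 1, 1%N; rewrite rmorph1 expr1 div1r.
apply/unitrPr; exists (CoefR hV); apply: val_inj.
by rewrite rmorphM rmorph1 /= divff // tofrac_eq0 locden_neq0.
Qed.

Lemma locdenE :
  of_poly2 locden = ccR * (ccR - 1) * (ccR + 3%:R).
Proof.
rewrite /locden 2!rmorphM /= 2!rmorphM /=.
rewrite (rmorphB polyC) (rmorphB of_poly2) (rmorph1 polyC) (rmorph1 of_poly2).
by rewrite (rmorphD polyC) (rmorphD of_poly2) (rmorph_nat polyC) (rmorph_nat of_poly2).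
Qed.

Lemma ccR_units :
  [/\ ccR \is a GRing.unit, ccR - 1 \is a GRing.unit &
      ccR + 3%:R \is a GRing.unit].
Proof.
by have := locden_unit; rewrite locdenE !unitrM => /andP[/andP[-> ->] ->].
Qed.

Lemma natR_unit n : (n.+1%:R : coefR) \is a GRing.unit.
Proof.
apply/unitrPr; exists (cst (n.+1%:R^-1)).
rewrite -[n.+1%:R](rmorph_nat of_poly2) -rmorphM -(rmorph_nat polyC) -rmorphM.
by rewrite -(rmorph_nat polyC) -rmorphM mulfV ?pnatr_eq0 // !rmorph1.
Qed.

End BaseRing.

Arguments ccR {K}.
Arguments lamR {K}.
Arguments cst {K}.

(* The generalized binomial coefficient m (m - 1) ... (m - i + 1) / i!.       *)
Definition binz (m : int) (i : nat) : int :=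
  match m with
  | Posz k => 'C(k, i)%:Z
  | Negz k => (-1) ^+ i * 'C(k + i, i)%:Z
  end.

(* vparity b v means that v is homogeneous, odd if b and even otherwise.      *)
(* In the Borcherds identity all the sums are finite; any common truncation   *)
(* order N beyond which every term vanishes is allowed.                       *)
HB.mixin Record Lmodule_isVertexSuperalgebra (R : comNzRingType) V
    of GRing.Lmodule R V := {
  vparity : bool -> V -> Prop;
  vac : V;
  nprod : V -> int -> V -> V;
  vparity0 : forall p, vparity p 0;
  vparityD : forall p a b, vparity p a -> vparity p b -> vparity p (a + b);
  vparityZ : forall p (x : R) a, vparity p a -> vparity p (x *: a);
  vparity_ex : forall a,
    exists a0 a1, [/\ vparity false a0, vparity true a1 & a = a0 + a1];
  vparity_disj : forall a, vparity false a -> vparity true a -> a = 0;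
  vparity_vac : vparity false vac;
  vparity_nprod : forall p q a n b,
    vparity p a -> vparity q b -> vparity (p (+) q) (nprod a n b);
  nprodDl : forall n a a' b, nprod (a + a') n b = nprod a n b + nprod a' n b;
  nprodDr : forall n a b b', nprod a n (b + b') = nprod a n b + nprod a n b';
  nprodZl : forall n (x : R) a b, nprod (x *: a) n b = x *: nprod a n b;
  nprodZr : forall n (x : R) a b, nprod a n (x *: b) = x *: nprod a n b;
  nprod_field : forall a b,
    exists N : nat, forall n : nat, (N <= n)%N -> nprod a n%:Z b = 0;
  nprod_vacl : forall n a, nprod vac n a = if n == -1 then a else 0;
  nprod_vacrN1 : forall a, nprod a (-1) vac = a;
  nprod_vacr : forall (n : nat) a, nprod a n%:Z vac = 0;
  borcherds : forall (p q : bool) (a b d : V) (m n k : int) (N : nat),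
    vparity p a -> vparity q b ->
    (forall i : nat, (N <= i)%N ->
       [/\ nprod a (n + i%:Z) b = 0,
           nprod b (k + i%:Z) d = 0 &
           nprod a (m + i%:Z) d = 0]) ->
    \sum_(i < N) (nprod (nprod a (n + i%:Z) b) (m + k - i%:Z) d) *~ binz m i =
    \sum_(i < N) (nprod a (m + n - i%:Z) (nprod b (k + i%:Z) d)
                  - (-1) ^+ `|n|%N *:
                    ((-1) ^+ (p && q) *:
                     nprod b (n + k - i%:Z) (nprod a (m + i%:Z) d)))
                 *~ ((-1) ^+ i * binz n i)
}.

#[short(type="vertexSuperalgebraType")]
HB.structure Definition VertexSuperalgebra (R : comNzRingType) :=
  { V of GRing.Lmodule R V & Lmodule_isVertexSuperalgebra R V }.

Notation "a \o_( n ) b" := (nprod a n%Z b)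
  (at level 38, right associativity, format "a  \o_( n )  b") : ring_scope.

Section VertexTheory.
Variables (A : comUnitRingType) (V : vertexSuperalgebraType A).
Implicit Types a b v : V.

Definition vder a : V := a \o_(-2) vac.

(* The normally ordered monomial :d^k1 a1 ... d^kr ar:, nested to the right.  *)
Definition nomonomial (s : seq (nat * V)) : V :=
  foldr (fun ka acc => (iter ka.1 vder ka.2) \o_(-1) acc) vac s.

Definition strongly_generates (S : V -> Prop) : Prop :=
  forall v, exists (s : seq (A * seq (nat * V))),
    (forall t, t \in s -> forall ka, ka \in t.2 -> S ka.2) /\
    v = \sum_(t <- s) t.1 *: nomonomial t.2.

Definition minimal_strong_generating_set (S : V -> Prop) : Prop :=
  strongly_generates S /\
  forall S' : V -> Prop, (forall v, S' v -> S v) -> strongly_generates S' ->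
    forall v, S v -> S' v.

(* Free generation by the ordered family gen 0, gen 1, ...: a letter (i, k)   *)
(* stands for d^k (gen i).  Within one field the orders of derivation are     *)
(* nonincreasing, and strictly decreasing when the field is odd.              *)
Definition pbw_rel (oddgen : pred nat) (x y : nat * nat) : bool :=
  (x.1 < y.1)%N ||
  ((x.1 == y.1) && (if oddgen x.1 then y.2 < x.2 else y.2 <= x.2)%N).

Definition pbw_monomial (gen : nat -> V) (w : seq (nat * nat)) : V :=
  nomonomial [seq (x.2, gen x.1) | x <- w].

Definition freely_generated (oddgen : pred nat) (gen : nat -> V) : Prop :=
  [/\ forall i, vparity (oddgen i) (gen i),
      forall v, exists (ws : seq (seq (nat * nat))) (x : seq (nat * nat) -> A),
        all (sorted (pbw_rel oddgen)) ws /\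
        v = \sum_(w <- ws) x w *: pbw_monomial gen w &
      forall (ws : seq (seq (nat * nat))) (x : seq (nat * nat) -> A),
        uniq ws -> all (sorted (pbw_rel oddgen)) ws ->
        \sum_(w <- ws) x w *: pbw_monomial gen w = 0 ->
        forall w, w \in ws -> x w = 0].

Definition involutive_automorphism (f : {linear V -> V}) : Prop :=
  [/\ f vac = vac,
      forall p a, vparity p a -> vparity p (f a),
      forall a n b, f (a \o_(n) b) = f a \o_(n) f b &
      forall a, f (f a) = a].

(* Virasoro field of central charge c, with L_(0) the translation operator    *)
(* and L_(1) diagonalizable.                                                  *)
Definition conformal (c : A) (L : V) : Prop :=
  [/\ [/\ L \o_(0) L = vder L, L \o_(1) L = 2%:R *: L, L \o_(2) L = 0,
          L \o_(3) L = (c / 2%:R) *: vac &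
          forall n : nat, (4 <= n)%N -> L \o_(n) L = 0],
      forall a, L \o_(0) a = vder a &
      forall a, exists s : seq V, a = \sum_(b <- s) b /\
        (forall b, b \in s -> exists h : A, L \o_(1) b = h *: b)].

Definition Virasoro_primary (L : V) (h : A) (v : V) : Prop :=
  L \o_(1) v = h *: v /\ forall n : nat, (2 <= n)%N -> L \o_(n) v = 0.

Definition N2_superconformal (c : A) (H Gp Gm L : V) : Prop :=
  [/\ [/\ conformal c L, Virasoro_primary L 1 H,
          Virasoro_primary L (3%:R / 2%:R) Gp &
          Virasoro_primary L (3%:R / 2%:R) Gm],
      [/\ H \o_(0) H = 0, H \o_(1) H = (c / 3%:R) *: vac &
          forall n : nat, (2 <= n)%N -> H \o_(n) H = 0],
      [/\ H \o_(0) Gp = Gp, H \o_(0) Gm = - Gm &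
          forall n : nat, (1 <= n)%N -> H \o_(n) Gp = 0 /\ H \o_(n) Gm = 0],
      [/\ Gp \o_(0) Gm = L + 2%:R^-1 *: vder H, Gp \o_(1) Gm = H,
          Gp \o_(2) Gm = (c / 3%:R) *: vac &
          forall n : nat, (3 <= n)%N -> Gp \o_(n) Gm = 0] &
      forall n : nat, Gp \o_(n) Gp = 0 /\ Gm \o_(n) Gm = 0].

(* Primary of conformal weight h and H_(0)-weight q.                          *)
Definition N2_primary (H Gp Gm L : V) (h q : A) (v : V) : Prop :=
  [/\ L \o_(1) v = h *: v, H \o_(0) v = q *: v &
      forall m : nat, (1 <= m)%N ->
        [/\ L \o_(m.+1) v = 0, H \o_(m) v = 0,
            Gp \o_(m) v = 0 & Gm \o_(m) v = 0]].

Definition diamond_set (Gp Gm : V) (v : nat -> V) (x : V) : Prop :=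
  exists2 d : nat, (1 <= d)%N &
    [\/ x = v d, x = Gp \o_(0) v d, x = Gm \o_(0) v d |
        x = Gp \o_(0) (Gm \o_(0) v d)].

Definition primary_diamond_structure (H Gp Gm L : V) : Prop :=
  exists v : nat -> V,
    [/\ forall d : nat, (1 <= d)%N -> vparity false (v d),
        v 1%N = H,
        forall d : nat, (2 <= d)%N -> N2_primary H Gp Gm L d%:R 0 (v d) &
        minimal_strong_generating_set (diamond_set Gp Gm v)].

(* Wb, Wp, Wm, Wt are W^{N,bot}, W^{N,+}, W^{N,-}, W^{N,top}; only their      *)
(* values at N >= 2 matter.                                                   *)
Record Winfty_fields := WinftyFields {
  fH : V; fGp : V; fGm : V; fL : V;
  Wb : nat -> V; Wp : nat -> V; Wm : nat -> V; Wt : nat -> V }.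

(* The generators are listed diamond by diamond: H, G+, G-, L, then           *)
(* W^{2,bot}, W^{2,+}, W^{2,-}, W^{2,top}, then W^{3,bot}, ...                *)
Definition Winfty_gen (X : Winfty_fields) (i : nat) : V :=
  let N := (i %/ 4).+1 in
  match (i %% 4)%N with
  | 0 => if N == 1%N then fH X else Wb X N
  | 1 => if N == 1%N then fGp X else Wp X N
  | 2 => if N == 1%N then fGm X else Wm X N
  | _ => if N == 1%N then fL X else Wt X N
  end.

Definition Winfty_oddgen : pred nat := fun i => ((i %% 4)%N == 1%N) || ((i %% 4)%N == 2%N).

End VertexTheory.

Section Winfty.
Variable K : realType.
Local Notation C := K[i].

Definition is_Winfty (V : vertexSuperalgebraType (coefR K)) (omega : coefR K)
    (X : Winfty_fields V) : Prop :=
  let: WinftyFields H Gp Gm L wb wp wm wt := X in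
  let c : coefR K := ccR in
  [/\ freely_generated Winfty_oddgen (Winfty_gen X),
      N2_superconformal c H Gp Gm L /\ N2_primary H Gp Gm L 2%:R 0 (wb 2%N),
      forall N : nat, (2 <= N)%N ->
        [/\ [/\ L \o_(1) wb N = N%:R *: wb N,
                L \o_(1) wp N = (N%:R + 2%:R^-1) *: wp N,
                L \o_(1) wm N = (N%:R + 2%:R^-1) *: wm N &
                L \o_(1) wt N = (N%:R + 1) *: wt N],
            H \o_(0) wb N = 0,
            wp N = - (Gp \o_(0) wb N) /\ wm N = Gm \o_(0) wb N,
            wt N = Gp \o_(0) (Gm \o_(0) wb N) - 2%:R^-1 *: vder (wb N) /\
            wt N = - (Gm \o_(0) (Gp \o_(0) wb N)) + 2%:R^-1 *: vder (wb N) &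
            wt 2%N \o_(1) wb N = wb N.+1],
      exists2 f : {linear V -> V}, involutive_automorphism f &
        [/\ f H = - H, f Gp = Gm, f Gm = Gp, f L = L &
            forall N : nat, (2 <= N)%N ->
              [/\ f (wb N) = (-1) ^+ N *: wb N,
                  f (wp N) = (-1) ^+ N.+1 *: wm N,
                  f (wm N) = (-1) ^+ N.+1 *: wp N &
                  f (wt N) = (-1) ^+ N.+1 *: wt N]] &
      [/\ wb 2%N \o_(3) wb 2%N = omega *: vac,
          wb 2%N \o_(2) wb 2%N = 0,
          wb 2%N \o_(1) wb 2%N =
            (4%:R * omega / (c - 1)) *: L
            - (6%:R * omega / (c * (c - 1))) *: (H \o_(-1) H)
            + lamR *: wb 2%N &
          forall n : nat, (4 <= n)%N -> wb 2%N \o_(n) wb 2%N = 0]].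

(* S is V / ((c - c0) V + (lambda - l0) V), presented by the quotient map pi. *)
Definition is_specialization (V : vertexSuperalgebraType (coefR K))
    (S : vertexSuperalgebraType C) (c0 l0 : C) (pi : V -> S) : Prop :=
  [/\ [/\ forall a b, pi (a + b) = pi a + pi b,
          forall (z : C) a, pi (cst z *: a) = z *: pi a,
          pi vac = vac,
          forall a n b, pi (a \o_(n) b) = pi a \o_(n) pi b &
          forall p a, vparity p a -> vparity p (pi a)],
      forall y : S, exists a, pi a = y &
      forall a, pi a = 0 <->
        exists a1 a2, a = (ccR - cst c0) *: a1 + (lamR - cst l0) *: a2].

(* Generic means outside a countable union of plane algebraic curves (and of  *)
(* the lines c = 0, 1, -3, where the base ring has no specialization).        *)
Definition for_generic (Q : C -> C -> Prop) : Prop :=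
  exists P : nat -> {poly {poly C}}, (forall i, P i != 0) /\
    forall c0 l0 : C, c0 != 0 -> c0 != 1 -> c0 != - 3%:R ->
      (forall i, ev2 (P i) c0 l0 != 0) -> Q c0 l0.

End Winfty.

(* Main.v *)
From HB Require Import structures.
Require Import Defs.
From mathcomp Require Import all_boot all_order all_algebra.
From mathcomp Require Import boolp reals.
From mathcomp Require Import ring lra zify.

Set Implicit Arguments.
Unset Strict Implicit.
Unset Printing Implicit Defensive.

Import Order.TTheory GRing.Theory Num.Theory.
Local Open Scope ring_scope.

(** The argument runs over the base ring and is specialized only at the end. Call a vector
    decomposable ([C1]) if it is a combination of derivatives and of normally ordered products of
    two vectors of positive weight. Free generation makes the generators a basis of the positive
    weights modulo [C1] ([gen_span], [gcoord_C1]). Hence a homogeneous family is a minimal strong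
    generating set as soon as it is related to the generators, modulo [C1], by a triangular matrix
    with invertible diagonal.

    Correction of the bottom vectors. Let [W] be the bottom vector of a diamond other than the
    first. By [primary_exists] there are a nonzero polynomial [f] and a combination [y] of
    descendants such that [f(1/c) W - y] is primary. Modulo [C1] the vector [y] is a multiple, say
    by [-r], of the top vector of the preceding diamond ([creation_top_or_C1]), and the zero modes
    of G^+ and G^- send that top vector into [C1] ([zero_mode_dgen]). So each corner of the new
    diamond is, modulo [C1], plus or minus [f(1/c)] times the old corner, except that the bottom one
    also contains [r] times the preceding top ([diamond_exists]). The polynomials [numer f], one for
    each diamond, define the exceptional set.

    Existence of the primary vector. Creation words [Bop] in the modes of the superconformal algebra
    are paired with annihilation words [test], level by level from the top. If all tests of level
    above [l] kill [v], then positive modes kill the values on [v] of the tests of level [l], so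
    these values are primary ([test_prim]). Cramer's rule finds descendants of primary vectors that
    have the same values, up to a determinant ([solve_pairings]), and subtracting them lowers [l]
    ([stage]). At level 0 the empty test is the vector itself.

    The determinant is nonzero because of its behaviour as [c] tends to infinity. The annihilation
    modes among H_(0), G_(0), G_(1), L_(0), L_(1), L_(2), which together span a copy of sl(2|1),
    never meet the central charge; every other one is divided by [c]. In the limit, and up to words
    with fewer big letters, such a mode acts as a superderivation that removes its dual creation
    mode, so the matrix of pairings becomes triangular ([hat_word], [entry]). What remains is the
    pairing on a Verma module of sl(2|1) ([Sop_Bop_diag]), which is nondegenerate because a weight
    is at least 3/2 times the absolute value of the charge. Weight zero, the vacuum, is treated
    apart ([test_vacuum]). *)

Section Span.
Variables (A : pzRingType) (V : lmodType A).
Implicit Types (P Q : V -> Prop) (a b v : V).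

(** * Linear spans, as an inductive predicate *)

Inductive lspan P : V -> Prop :=
| lspan_nil : lspan P 0
| lspan_cons x a b : P a -> lspan P b -> lspan P (x *: a + b).

Lemma lspan_mem P a : P a -> lspan P a.
Proof. by move=> Pa; rewrite -[a]addr0 -[a]scale1r; apply/lspan_cons/lspan_nil. Qed.

Lemma lspanD P a b : lspan P a -> lspan P b -> lspan P (a + b).
Proof.
by elim=> [|x c d Pc _ IH] Pb; rewrite ?add0r // -addrA; apply/lspan_cons/IH.
Qed.

Lemma lspanZ P x a : lspan P a -> lspan P (x *: a).
Proof.
elim=> [|y c d Pc _ IH]; first by rewrite scaler0; apply: lspan_nil.
by rewrite scalerDr scalerA; apply: lspan_cons.
Qed.

Lemma lspanN P a : lspan P a -> lspan P (- a).
Proof. by rewrite -scaleN1r; apply: lspanZ. Qed.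

Lemma lspanMz P a (z : int) : lspan P a -> lspan P (a *~ z).
Proof. by rewrite -scaler_int; apply: lspanZ. Qed.

Lemma lspan_sum P (I : Type) (r : seq I) (Q : pred I) F :
  (forall i, Q i -> lspan P (F i)) -> lspan P (\sum_(i <- r | Q i) F i).
Proof.
by move=> PF; elim/big_rec: _ => [|i a Qi]; [apply: lspan_nil | apply/lspanD/PF].
Qed.

Lemma lspan_bind P Q (f : V -> V) :
    (forall x a b, f (x *: a + b) = x *: f a + f b) ->
    (forall a, P a -> lspan Q (f a)) -> forall a, lspan P a -> lspan Q (f a).
Proof.
move=> fL PQ a; elim=> [|x b d Pb _ IH].
  have := fL 1 0 0; rewrite !scale1r !addr0 => /eqP.
  by rewrite addrC -subr_eq subrr => /eqP <-; apply: lspan_nil.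
by rewrite fL; apply/lspanD/IH/lspanZ/PQ.
Qed.

Lemma lspan_sub P Q : (forall a, P a -> lspan Q a) -> forall a, lspan P a -> lspan Q a.
Proof. exact: (@lspan_bind P Q id). Qed.

Lemma lspan_mono P Q : (forall a, P a -> Q a) -> forall a, lspan P a -> lspan Q a.
Proof. by move=> PQ; apply: lspan_sub => a /PQ; apply: lspan_mem. Qed.

End Span.

Lemma sum_truncate (V : nmodType) (N M : nat) (F : nat -> V) :
  (N <= M)%N -> (forall i, (N <= i)%N -> F i = 0) ->
  \sum_(i < M) F i = \sum_(i < N) F i.
Proof.
move=> NM F0; rewrite -(big_mkord xpredT F) (@big_cat_nat _ _ _ N) //= big_mkord.
by rewrite [X in _ + X]big_nat [X in _ + X]big1 ?addr0 // => i /andP[/F0].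
Qed.

Lemma sum_first (V : nmodType) (N : nat) (F : nat -> V) :
  (forall i, (0 < i)%N -> F i = 0) -> \sum_(i < N.+1) F i = F 0%N.
Proof. by move=> F0; rewrite big_ord_recl big1 ?addr0 // => i _; apply: F0. Qed.

(** * Commutator, normal ordering and derivative formulas from the Borcherds identity *)

Section ModeCalculus.
Variables (A : comUnitRingType) (V : vertexSuperalgebraType A).
Implicit Types a b d v : V.

Lemma nprodl0 n b : (0 : V) \o_(n) b = 0.
Proof. by rewrite -(scale0r (0 : V)) nprodZl !scale0r. Qed.

Lemma nprodr0 n a : a \o_(n) (0 : V) = 0.
Proof. by rewrite -(scale0r (0 : V)) nprodZr !scale0r. Qed.

Lemma nprodNr n a b : a \o_(n) (- b) = - (a \o_(n) b).
Proof. by rewrite -scaleN1r nprodZr scaleN1r. Qed.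

Lemma nprodBr n a b d : a \o_(n) (b - d) = a \o_(n) b - a \o_(n) d.
Proof. by rewrite nprodDr nprodNr. Qed.

Lemma nprod_linr n a x b d : a \o_(n) (x *: b + d) = x *: (a \o_(n) b) + a \o_(n) d.
Proof. by rewrite nprodDr nprodZr. Qed.

Lemma nprod_linl n d x a b : (x *: a + b) \o_(n) d = x *: (a \o_(n) d) + b \o_(n) d.
Proof. by rewrite nprodDl nprodZl. Qed.

Lemma nprod_eventually a b (k : int) :
  exists N : nat, forall i : nat, (N <= i)%N -> a \o_(k + i%:Z) b = 0.
Proof.
have [N HN] := nprod_field a b; exists (N + absz k)%N => i Hi.
have -> : k + i%:Z = (absz (k + i%:Z))%:Z by lia.
by apply: HN; lia.
Qed.

(* Enlarging the common truncation order adds only zero terms, so any order   *)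
(* that truncates the sum of the [a_(i) b] can be used.                       *)
Lemma nprod_comm p q a b (m k : int) d (N : nat) :
    vparity p a -> vparity q b ->
    (forall i : nat, (N <= i)%N -> a \o_(i%:Z) b = 0) ->
  a \o_(m) b \o_(k) d =
    (-1) ^+ (p && q) *: (b \o_(k) a \o_(m) d) +
    \sum_(i < N) ((a \o_(i%:Z) b) \o_(m + k - i%:Z) d) *~ binz m i.
Proof.
move=> pa qb HN.
have [N1 H1] := nprod_eventually b d k; have [N2 H2] := nprod_eventually a d m.
pose N' := (N + N1 + N2).+1.
have trunc (i : nat) : (N' <= i)%N ->
    [/\ a \o_(0 + i%:Z) b = 0, b \o_(k + i%:Z) d = 0 & a \o_(m + i%:Z) d = 0].
  move=> Hi; split; [|apply: H1; lia|apply: H2; lia].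
  by rewrite add0r; apply: HN; lia.
have := borcherds _ _ _ _ _ _ _ _ _ pa qb trunc.
rewrite [X in _ = X](@sum_first V _ (fun i => (a \o_(m + 0 - i%:Z) b \o_(k + i%:Z) d
  - (-1) ^+ `|0%:Z|%N *: ((-1) ^+ (p && q) *: (b \o_(0 + k - i%:Z) a \o_(m + i%:Z) d)))
  *~ ((-1) ^+ i * binz 0 i))); last first.
  by case=> // i _; rewrite /binz /= bin0n /= mulr0 mulr0z.
rewrite /= bin0 expr0 mulr1 mulr1z !addr0 add0r scale1r.
move/eqP; rewrite eq_sym subr_eq => /eqP ->; rewrite [RHS]addrC; congr (_ + _).
pose F (i : nat) := ((a \o_(i%:Z) b) \o_(m + k - i%:Z) d) *~ binz m i.
have <- : \sum_(i < N') F i = \sum_(i < N) F i.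
  by apply: sum_truncate => [|i Hi]; rewrite ?/N' ?/F; [lia | rewrite HN // nprodl0 mul0rz].
by apply: eq_bigr => i _; rewrite add0r.
Qed.

(** This is the Borcherds identity with first index 0, which leaves one term on the left, and inner
    index -1, for which every signed binomial on the right is 1. *)
Lemma nprod_nop p q a b (m : int) d (N : nat) :
    vparity p a -> vparity q b ->
    (forall i : nat, (N <= i)%N -> b \o_(m + i%:Z) d = 0) ->
    (forall i : nat, (N <= i)%N -> a \o_(i%:Z) d = 0) ->
  (a \o_(-1) b) \o_(m) d =
    \sum_(i < N) (a \o_(- 1 - i%:Z) b \o_(m + i%:Z) d +
      (-1) ^+ (p && q) *: (b \o_(m - 1 - i%:Z) a \o_(i%:Z) d)).
Proof.
move=> pa qb Hb Ha.
have [N1 H1] := nprod_eventually a b (-1).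
pose N' := (N + N1).+1.
have trunc (i : nat) : (N' <= i)%N ->
    [/\ a \o_(-1 + i%:Z) b = 0, b \o_(m + i%:Z) d = 0 & a \o_(0 + i%:Z) d = 0].
  move=> Hi; split; [apply: H1; lia|apply: Hb; lia|rewrite add0r; apply: Ha; lia].
have := borcherds _ _ _ _ _ _ _ _ _ pa qb trunc.
rewrite [X in X = _ -> _](@sum_first V _ (fun i =>
  ((a \o_(-1 + i%:Z) b) \o_(0 + m - i%:Z) d) *~ binz 0 i)); last first.
  by case=> // i _; rewrite /binz /= bin0n /= mulr0z.
rewrite /= bin0 !addr0 mulr1z add0r => ->.
transitivity (\sum_(i < N') (a \o_(- 1 - i%:Z) b \o_(m + i%:Z) d +
      (-1) ^+ (p && q) *: (b \o_(m - 1 - i%:Z) a \o_(i%:Z) d))).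
  apply: eq_bigr => i _.
  have -> : (-1) ^+ i * binz (-1) i = 1.
    by rewrite /binz /= binn mulr1 -exprMn mulrNN mulr1 expr1n.
  rewrite mulr1z !add0r expr1 scaleN1r opprK.
  by congr (nprod _ _ _ + _ *: nprod _ _ _); lia.
pose F (i : nat) := a \o_(- 1 - i%:Z) b \o_(m + i%:Z) d +
      (-1) ^+ (p && q) *: (b \o_(m - 1 - i%:Z) a \o_(i%:Z) d).
apply: (@sum_truncate V N N' F) => [|i Hi]; rewrite ?/N' ?/F; first lia.
by rewrite Hb // Ha // !nprodr0 scaler0 addr0.
Qed.

(** The Borcherds identity is applied to a_(-2) vac. The modes of the vacuum are zero but for one,
    so at most one summand survives; the sign of [m] decides in which half of the sum it lies. *)
Lemma vder_nprod a (m : int) d : (vder a) \o_(m) d = - (a \o_(m - 1) d) *~ m.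
Proof.
have [a0 [a1 [p0 p1 ->]]] := vparity_ex a.
suff H p a' : vparity p a' -> (vder a') \o_(m) d = - (a' \o_(m - 1) d) *~ m.
  have -> : vder (a0 + a1) = vder a0 + vder a1 by rewrite /vder nprodDl.
  by rewrite !nprodDl (H _ _ p0) (H _ _ p1) opprD mulrzDl.
move=> pa {a a0 a1 p0 p1}; rename a' into a.
have [N1 H1] := nprod_eventually a d 0; have [N2 H2] := nprod_eventually a (vac : V) (-2).
pose N' := (absz m + N1 + N2).+2.
have trunc (i : nat) : (N' <= i)%N -> [/\ a \o_(-2 + i%:Z) vac = 0,
    (vac : V) \o_(m + i%:Z) d = 0 & a \o_(0 + i%:Z) d = 0].
  move=> Hi; split; [apply: H2; lia| |apply: H1; lia].
  by rewrite nprod_vacl; case: eqP => //; lia.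
have := borcherds _ _ _ _ _ _ _ _ _ pa (@vparity_vac _ V) trunc.
rewrite [X in X = _ -> _](@sum_first V _ (fun i =>
  ((a \o_(-2 + i%:Z) vac) \o_(0 + m - i%:Z) d) *~ binz 0 i)); last first.
  by case=> // i _; rewrite /binz /= bin0n /= mulr0z.
rewrite /= bin0 !addr0 mulr1z add0r => ->.
under eq_bigr => i _.
  rewrite !nprod_vacl andbF expr0 scale1r.
  have -> : (-1) ^+ i * binz (-2) i = i.+1%:Z.
    by rewrite /binz /= mulrA -exprMn mulrNN mulr1 expr1n mul1r add1n binSn.
  rewrite /= sqrrN expr1n scale1r.
  over.
case: (ltrgtP m 0) => m0.
- have lt : ((absz m).-1 < N')%N by rewrite /N'; lia.
  rewrite (bigD1 (Ordinal lt)) //= big1 ?addr0 => [|i /eqP ne].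
    have -> : (m + ((absz m).-1)%:Z == -1) = true by lia.
    have -> : (-2 + m - ((absz m).-1)%:Z == -1) = false by lia.
    rewrite subr0; have -> : -2 - ((absz m).-1)%:Z = m - 1 by lia.
    have -> : ((absz m).-1.+1)%:Z = - m by lia.
    by rewrite mulrNz mulNrz.
  have -> : (m + i%:Z == -1) = false.
    by apply/eqP => e; apply: ne; apply: val_inj => /=; lia.
  have -> : (-2 + m - i%:Z == -1) = false by lia.
  by rewrite nprodr0 subr0 mul0rz.
- have lt : ((absz m).-1 < N')%N by rewrite /N'; lia.
  rewrite (bigD1 (Ordinal lt)) //= big1 ?addr0 => [|i /eqP ne].
    have -> : (m + ((absz m).-1)%:Z == -1) = false by lia.
    have -> : (-2 + m - ((absz m).-1)%:Z == -1) = true by lia.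
    rewrite nprodr0 sub0r; have -> : ((absz m).-1)%:Z = m - 1 by lia.
    by rewrite add0r; congr (_ *~ _); lia.
  have -> : (-2 + m - i%:Z == -1) = false.
    by apply/eqP => e; apply: ne; apply: val_inj => /=; lia.
  have -> : (m + i%:Z == -1) = false by lia.
  by rewrite nprodr0 subr0 mul0rz.
- rewrite m0 mulr0z big1 // => i _.
  have -> : (0 + i%:Z == -1) = false by lia.
  have -> : (-2 + 0 - i%:Z == -1) = false by lia.
  by rewrite nprodr0 subr0 mul0rz.
Qed.

Lemma vder_nprodN a (k : nat) d :
  (vder a) \o_(Negz k) d = k.+1%:R *: (a \o_(Negz k.+1) d).
Proof.
rewrite vder_nprod NegzE mulrNz mulNrz opprK -scaler_int.
by congr (_ *: nprod _ _ _); lia.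
Qed.

Lemma iter_vder_nprodN a (k : nat) d :
  (iter k (@vder A V) a) \o_(-1) d = (k`!)%:R *: (a \o_(Negz k) d).
Proof.
suff H j : (iter k (@vder A V) a) \o_(Negz j) d = ((k + j) ^_ k)%:R *: (a \o_(Negz (k + j)) d).
  by have := H 0%N; rewrite addn0 ffactnn.
elim: k j => [|k IH] j; first by rewrite add0n ffactn0 scale1r.
rewrite iterS vder_nprodN IH scalerA addnS addSn ffactnSr.
rewrite -natrM mulnC; congr ((_ * _)%:R *: _); lia.
Qed.

(** A letter (k, a) is the mode a_(-k-1) instead of the (-1)-mode of the k-th derivative of a; this
    keeps factorials out of the calculations. *)
Definition word_vec (s : seq (nat * V)) : V :=
  foldr (fun x acc => x.2 \o_(Negz x.1) acc) vac s.

Lemma nomonomialE s :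
  nomonomial s = (\prod_(x <- s) (x.1)`!)%:R *: word_vec s.
Proof.
elim: s => [|x s IH]; first by rewrite big_nil scale1r.
by rewrite /= IH iter_vder_nprodN nprodZr scalerA big_cons natrM.
Qed.

End ModeCalculus.

(** * Words in homogeneous letters, their filtration, and reduction to generators *)

Section Grading.
Variables (A : comUnitRingType) (V : vertexSuperalgebraType A).
Implicit Types (a b d v : V) (w : nat).

(* [hom w a] reads: a is homogeneous of conformal weight w / 2.  Doubling the *)
(* weights makes them integral, and the parity of a vector that of w.         *)
Record grading (hom : nat -> V -> Prop) : Prop := Grading {
  hom_zero : forall w, hom w 0;
  hom_lin : forall w x a b, hom w a -> hom w b -> hom w (x *: a + b);
  hom_parity : forall w a, hom w a -> vparity (odd w) a;
  hom_nprod : forall w w' a b (n : int) (W : nat), hom w a -> hom w' b ->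
    W%:Z = w%:Z + w'%:Z - 2 * n - 2 -> hom W (a \o_(n) b);
  hom_nprod_neg : forall w w' a b (n : int), hom w a -> hom w' b ->
    w%:Z + w'%:Z - 2 * n - 2 < 0 -> a \o_(n) b = 0;
  hom_vac : hom 0%N vac;
  hom0_vac : forall a, hom 0%N a -> exists x, a = x *: vac }.

Definition letter := (nat * (nat * V))%type.
Implicit Types (s t : seq letter) (Q : nat -> V -> Prop).

(** Derivatives do not count here, in contrast with the conformal weight [cweight]. This gives the
    increasing filtration for which letters supercommute up to lower order. *)
Definition gweight s : nat := sumn [seq x.2.1 | x <- s].
Definition cweight s : nat := sumn [seq x.2.1 + x.1.*2 | x <- s]%N.
Definition wvec s : V := word_vec [seq (x.1, x.2.2) | x <- s].
Fixpoint letters_in Q s : Prop :=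
  if s is x :: s' then [/\ (0 < x.2.1)%N, Q x.2.1 x.2.2 & letters_in Q s'] else True.
Definition decomposable s : bool := if s is [:: x] then (0 < x.1)%N else s != [::].

Lemma letters_in_mono Q Q' s : (forall w a, Q w a -> Q' w a) ->
  letters_in Q s -> letters_in Q' s.
Proof. by move=> QQ'; elim: s => //= x s IH [? /QQ' ? /IH]. Qed.

Definition word_span Q (p W : nat) : V -> Prop :=
  lspan (fun v => exists s, [/\ letters_in Q s, (gweight s < p)%N, cweight s = W & v = wvec s]).
Definition dec_span Q (p W : nat) : V -> Prop :=
  lspan (fun v => exists s, [/\ letters_in Q s, decomposable s,
    (gweight s < p)%N, cweight s = W & v = wvec s]).

Lemma word_span_mono Q p p' W a :
  (p <= p')%N -> word_span Q p W a -> word_span Q p' W a.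
Proof.
move=> pp'; apply: lspan_mono => v [s [? ? ? ->]]; exists s; split=> //.
exact: leq_trans pp'.
Qed.

Lemma dec_span_mono Q p p' W a :
  (p <= p')%N -> dec_span Q p W a -> dec_span Q p' W a.
Proof.
move=> pp'; apply: lspan_mono => v [s [? ? ? ? ->]]; exists s; split=> //.
exact: leq_trans pp'.
Qed.

Lemma word_span_cons Q p W w a k v : (0 < w)%N -> Q w a ->
  word_span Q p W v -> word_span Q (w + p) (w + k.*2 + W) (a \o_(Negz k) v).
Proof.
move=> w0 Qa; apply: lspan_bind => [x b d|b [s [Qs gs cs ->]]]; first exact: nprod_linr.
apply: lspan_mem; exists ((k, (w, a)) :: s); split=> //=.
- by rewrite /gweight /= ltn_add2l.
- by rewrite /cweight /= -cs.
Qed.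

Section Filtration.
Variable hom : nat -> V -> Prop.
Hypothesis gr : grading hom.

Lemma wvec_hom s : letters_in hom s -> hom (cweight s) (wvec s).
Proof.
elim: s => [|[k [w a]] s IH] /=; first by move=> _; apply: (hom_vac gr).
move=> [_ ha /IH hs]; apply: (hom_nprod gr ha hs); rewrite /cweight /=; lia.
Qed.

Lemma cweight_gt0 Q s : letters_in Q s -> s != [::] -> (0 < cweight s)%N.
Proof. by case: s => //= x s [x0 _ _] _; rewrite /cweight /=; lia. Qed.

(* Nonnegative modes strictly lower the total weight of the letters.          *)
Lemma nprod_word_span w a s (n : int) (W : nat) :
    hom w a -> letters_in hom s -> W%:Z = w%:Z + (cweight s)%:Z - 2 * n - 2 ->
  word_span hom (w + gweight s + (n < 0)%R) W (a \o_(n) wvec s).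
Proof.
elim: s w a n W => [|[k [w' b]] s IH] w a n W ha /=.
  move=> _ WE; case: n WE => k WE; first by rewrite nprod_vacr; apply: lspan_nil.
  case: w ha WE => [|w] ha WE.
    have [x ->] := hom0_vac gr ha.
    rewrite nprodZl nprod_vacl; case: eqP => [ke|_]; last by rewrite scaler0; apply: lspan_nil.
    apply/lspanZ/lspan_mem; exists [::]; split=> //.
    by rewrite /cweight /= in WE *; lia.
  apply: lspan_mem; exists [:: (k, (w.+1, a))]; split=> //=.
    by rewrite /gweight /=; lia.
  by rewrite /cweight /= in WE *; lia.
move=> [w'0 hb hs] WE; rewrite /wvec /= -/(wvec s).
have [N HN] := nprod_field a b.
rewrite (nprod_comm _ _ _ (hom_parity gr ha) (hom_parity gr hb) HN).
have cE : cweight ((k, (w', b)) :: s) = (w' + k.*2 + cweight s)%N by [].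
have gE : gweight ((k, (w', b)) :: s) = (w' + gweight s)%N by [].
rewrite cE in WE; rewrite gE.
apply: lspanD.
  apply: lspanZ; have [neg|] := ltP (w%:Z + (cweight s)%:Z - 2 * n - 2) 0.
    by rewrite (hom_nprod_neg gr ha (wvec_hom hs) neg) nprodr0; apply: lspan_nil.
  case WE' : (w%:Z + (cweight s)%:Z - 2 * n - 2) => [W'|] // _.
  have := @word_span_cons _ _ _ _ _ k _ w'0 hb (IH _ _ _ _ ha hs (esym WE')).
  have -> : (w' + k.*2 + W')%N = W by lia.
  by apply: word_span_mono; lia.
apply: lspan_sum => i _; apply: lspanMz.
have [neg|] := ltP (w%:Z + w'%:Z - 2 * (i : nat)%:Z - 2) 0.
  by rewrite (hom_nprod_neg gr ha hb neg) nprodl0; apply: lspan_nil.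
case WE' : (w%:Z + w'%:Z - 2 * (i : nat)%:Z - 2) => [W'|] // _.
have hi := hom_nprod gr ha hb (esym WE').
have WEi : W%:Z = W'%:Z + (cweight s)%:Z - 2 * (n + Negz k - (i : nat)%:Z) - 2 by lia.
by have := IH _ _ _ _ hi hs WEi; apply: word_span_mono; lia.
Qed.

(** The part of doubled weight [w] of the space usually called C_1(V); strong generators are what
    survives modulo it. *)
Definition C1 w : V -> Prop := lspan (fun a =>
  (exists w' b, [/\ hom w' b, w = w'.+2 & a = vder b]) \/
  (exists w1 w2 b d, [/\ (0 < w1)%N /\ hom w1 b, (0 < w2)%N /\ hom w2 d,
     w = (w1 + w2)%N & a = b \o_(-1) d])).

Section Generation.
Variable T : nat -> V -> Prop.
Hypothesis T_hom : forall w a, T w a -> hom w a.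
Hypothesis T_gen : forall w a, (0 < w)%N -> hom w a ->
  exists b d, [/\ lspan (T w) b, C1 w d & a = b + d].

Lemma dec_word_span Q p W a : dec_span Q p W a -> word_span Q p W a.
Proof. by apply: lspan_mono => v [s [? _ ? ? ?]]; exists s. Qed.

Lemma dec_span_cons Q p W w a k v : (0 < w)%N -> Q w a -> (0 < k + W)%N ->
  word_span Q p W v -> dec_span Q (w + p) (w + k.*2 + W) (a \o_(Negz k) v).
Proof.
move=> w0 Qa kW; apply: lspan_bind => [x b d|b [s [Qs gs cs ->]]]; first exact: nprod_linr.
apply: lspan_mem; exists ((k, (w, a)) :: s); split=> //=.
- by case: s gs cs Qs => //= _ cs _; rewrite /cweight /= in cs; lia.
- by rewrite /gweight /= ltn_add2l.
- by rewrite /cweight /= -cs.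
Qed.

Let reducible s := word_span T (gweight s).+1 (cweight s) (wvec s) /\
  (decomposable s -> dec_span T (gweight s).+1 (cweight s) (wvec s)).

Lemma decomposable_cons k x s : decomposable ((k, x) :: s) = (0 < k)%N || (s != [::]).
Proof. by case: s => /= *; rewrite ?orbT ?orbF. Qed.

Lemma word_span_bind Q f p W (P : V -> Prop) :
    (forall x a b, f (x *: a + b) = x *: f a + f b) ->
    (forall s, letters_in Q s -> (gweight s < p)%N -> cweight s = W -> lspan P (f (wvec s))) ->
  forall a, word_span Q p W a -> lspan P (f a).
Proof. by move=> fL H; apply: lspan_bind => // a [s [Qs gs cs ->]]; apply: H. Qed.

(** Induction on the weight of the first letter. A derivative is traded for a larger mode index on a
    lighter letter. A product b_(-1) c is expanded by [nprod_nop]: its terms either have two lighter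
    letters in front, or contain a nonnegative mode, which lowers [gweight] so that the outer
    induction applies. *)
Lemma reduce_letter n :
    (forall s, letters_in hom s -> (gweight s < n)%N -> reducible s) ->
  forall w a, (0 < w)%N -> hom w a -> forall k s, letters_in T s -> (w + gweight s <= n)%N ->
    reducible ((k, (w, a)) :: s).
Proof.
move=> IHn; elim/ltn_ind => w IHw a w0 ha k s Ts le_n.
have hs : letters_in hom s := letters_in_mono T_hom Ts.
have [b [d [Tb C1d ->]]] := T_gen w0 ha.
have gE x : gweight ((k, x) :: s) = (x.1 + gweight s)%N by [].
have cE x : cweight ((k, x) :: s) = (x.1 + k.*2 + cweight s)%N by [].
have kW : (0 < k)%N || (s != [::]) -> (0 < k + cweight s)%N.
  by case/orP => [|/(cweight_gt0 Ts)]; lia.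
rewrite /reducible decomposable_cons gE cE /= {gE cE}.
have scons v : wvec ((k, (w, v)) :: s) = v \o_(Negz k) wvec s by [].
rewrite scons nprodDl {scons}.
have Ts1 : word_span T (gweight s).+1 (cweight s) (wvec s).
  by apply: lspan_mem; exists s; split.
have linl v x b' d' : (x *: b' + d' : V) \o_(Negz k) v = x *: (b' \o_(Negz k) v) + d' \o_(Negz k) v.
  exact: nprod_linl.
suff H : dec_span T (w + gweight s).+1 (w + k.*2 + cweight s) (d \o_(Negz k) wvec s).
  split=> [|/kW sk]; apply: lspanD; [|exact: dec_word_span| |exact: H].
    apply: (lspan_bind (f := fun v => v \o_(Negz k) wvec s)) Tb => [x v v'|v Tv] //.
    by rewrite -addnS; apply: word_span_cons.
  apply: (lspan_bind (f := fun v => v \o_(Negz k) wvec s)) Tb => [x v v'|v Tv] //.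
  by rewrite -addnS; apply: dec_span_cons.
move: C1d; apply: (lspan_bind (f := fun v => v \o_(Negz k) wvec s)) => // {b Tb ha}.
move=> v [[w' [b [hb we ->]]]|[w1 [w2 [b [c [[w10 hb] [w20 hc] we ->]]]]]].
  rewrite vder_nprodN; apply: lspanZ; case: w' => [|w'] in hb we.
    have [x ->] := hom0_vac gr hb.
    by rewrite nprodZl nprod_vacl scaler0; apply: lspan_nil.
  have lt : (w'.+1 < w)%N by lia.
  have le : (w'.+1 + gweight s <= n)%N by lia.
  have [_] := IHw w'.+1 lt b isT hb k.+1 s Ts le.
  rewrite decomposable_cons => /(_ isT).
  have -> : cweight ((k.+1, (w'.+1, b)) :: s) = (w + k.*2 + cweight s)%N.
    by rewrite /cweight /=; lia.
  by apply: dec_span_mono; rewrite /gweight /=; lia.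
have [N1 H1] := nprod_eventually c (wvec s) (Negz k).
have [N2 H2] := nprod_eventually b (wvec s) 0.
have bnd (i : nat) : (N1 + N2 <= i)%N -> c \o_(Negz k + i%:Z) wvec s = 0 by move=> ?; apply: H1; lia.
have bnd' (i : nat) : (N1 + N2 <= i)%N -> b \o_(i%:Z) wvec s = 0.
  by move=> ?; rewrite -[i%:Z]add0r; apply: H2; lia.
rewrite (nprod_nop (hom_parity gr hb) (hom_parity gr hc) bnd bnd').
apply: lspan_sum => i _; apply: lspanD.
  have -> : -1 - (i : nat)%:Z = Negz i by lia.
  have [ik|ki] := leqP i k.
    have -> : Negz k + i%:Z = Negz (k - i) by lia.
    have lt : (w2 < w)%N by lia.
    have le : (w2 + gweight s <= n)%N by lia.
    have [+ _] := IHw w2 lt c w20 hc (k - i)%N s Ts le.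
    apply: word_span_bind => [x b' d'|t Tt gt ct]; first exact: nprod_linr.
    have lt' : (w1 < w)%N by lia.
    have le' : (w1 + gweight t <= n)%N by rewrite /gweight /= in gt le_n *; lia.
    have [_] := IHw w1 lt' b w10 hb i t Tt le'.
    rewrite decomposable_cons.
    have -> : t != [::] by case: t ct {Tt gt le'} => //=; rewrite /cweight /=; lia.
    rewrite orbT => /(_ isT).
    have -> : cweight ((i : nat, (w1, b)) :: t) = (w + k.*2 + cweight s)%N.
      by rewrite /cweight /= in ct *; lia.
    by apply: dec_span_mono; rewrite /gweight /= in gt *; lia.
  have -> : Negz k + i%:Z = (i - k.+1)%N%:Z by lia.
  have [neg|] := ltP (w2%:Z + (cweight s)%:Z - 2 * (i - k.+1)%N%:Z - 2) 0.
    by rewrite (hom_nprod_neg gr hc (wvec_hom hs) neg) nprodr0; apply: lspan_nil.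
  case WE : (w2%:Z + (cweight s)%:Z - 2 * (i - k.+1)%N%:Z - 2) => [W|] // _.
  have := nprod_word_span hc hs (esym WE); rewrite addn0.
  apply: word_span_bind => [x b' d'|t Tt gt ct]; first exact: nprod_linr.
  have lt : (gweight ((i : nat, (w1, b)) :: t) < n)%N.
    by rewrite /gweight /= in gt le_n *; lia.
  have [_] := IHn ((i : nat, (w1, b)) :: t) (And3 w10 hb Tt) lt.
  rewrite decomposable_cons; have -> : (0 < i)%N by lia.
  move=> /(_ isT).
  have -> : cweight ((i : nat, (w1, b)) :: t) = (w + k.*2 + cweight s)%N.
    by rewrite /cweight /= in ct WE *; lia.
  by apply: dec_span_mono; rewrite /gweight /= in gt *; lia.
apply: lspanZ; have -> : Negz k - 1 - (i : nat)%:Z = Negz (k.+1 + i) by lia.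
have [neg|] := ltP (w1%:Z + (cweight s)%:Z - 2 * (i : nat)%:Z - 2) 0.
  by rewrite (hom_nprod_neg gr hb (wvec_hom hs) neg) nprodr0; apply: lspan_nil.
case WE : (w1%:Z + (cweight s)%:Z - 2 * (i : nat)%:Z - 2) => [W|] // _.
have := nprod_word_span hb hs (esym WE); rewrite addn0.
apply: word_span_bind => [x b' d'|t Tt gt ct]; first exact: nprod_linr.
have lt : (gweight (((k.+1 + i)%N, (w2, c)) :: t) < n)%N.
  by rewrite /gweight /= in gt le_n *; lia.
have [_] := IHn (((k.+1 + i)%N, (w2, c)) :: t) (And3 w20 hc Tt) lt.
rewrite decomposable_cons addSn => /(_ isT).
have -> : cweight (((k + i).+1, (w2, c)) :: t) = (w + k.*2 + cweight s)%N.
  by rewrite /cweight /= in ct WE *; lia.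
by apply: dec_span_mono; rewrite /gweight /= in gt *; lia.
Qed.

(** Induction on [gweight]: the tail is rewritten in letters of [T], then [reduce_letter] treats the
    head. *)
Lemma reduce_word s : letters_in hom s -> reducible s.
Proof.
have [n] := ubnP (gweight s); elim: n s => // n IHn s; rewrite ltnS.
case: s => [|[k [w a]] s] sn; first by move=> _; split=> //; apply: lspan_mem; exists [::]; split.
move=> [/= w0 ha hs].
have lt : (gweight s < n)%N by rewrite /gweight /= in sn *; lia.
have [Es _] := IHn s lt hs.
have H P : (forall t, letters_in T t -> (gweight t < (gweight s).+1)%N ->
    cweight t = cweight s -> lspan P (a \o_(Negz k) wvec t)) ->
    lspan P (wvec ((k, (w, a)) :: s)).
  move=> HP; apply: (word_span_bind (f := fun v => a \o_(Negz k) v)) HP _ Es.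
  by move=> x b d; apply: nprod_linr.
have red t : letters_in T t -> (gweight t < (gweight s).+1)%N -> cweight t = cweight s ->
    reducible ((k, (w, a)) :: t).
  move=> Tt gt ct; apply: (@reduce_letter n) => //; first by move=> u hu gu; apply: IHn.
  by rewrite /gweight /= in gt sn *; lia.
have cE t : cweight t = cweight s -> cweight ((k, (w, a)) :: t) = cweight ((k, (w, a)) :: s).
  by rewrite /cweight /= => ->.
split=> [|ds]; apply: H => t Tt gt ct; have [R1 R2] := red t Tt gt ct.
  rewrite -(cE t ct); apply: word_span_mono R1; rewrite /gweight /= in gt *; lia.
rewrite -(cE t ct); apply: dec_span_mono (R2 _); first by rewrite /gweight /= in gt *; lia.
rewrite !decomposable_cons in ds *; case: (posnP k) ds => // _ /=.
(* If the head is not a derivative, the old tail is nonempty, so it has positive conformal weight;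
   the new tail has the same weight and cannot be empty. *)
by case: t ct {Tt gt R1 R2} => // /esym ct; apply: contraNN => _; case: s hs ct {sn Es red cE lt} => //= x s [x0 _ _]; rewrite /cweight /=; lia.
Qed.

Lemma dec_span_gen s : letters_in hom s -> decomposable s ->
  dec_span T (gweight s).+1 (cweight s) (wvec s).
Proof. by move=> /reduce_word[_]; apply. Qed.

Lemma word_span_gen w a : hom w a -> word_span T w.+1 w a.
Proof.
case: w => [|w] ha.
  have [x ->] := hom0_vac gr ha; apply/lspanZ/lspan_mem.
  by exists [::]; split.
have [+ _] := @reduce_word [:: (0%N, (w.+1, a))] (And3 isT ha I).
by rewrite /wvec /= nprod_vacrN1 /gweight /cweight /= !addn0.
Qed.

End Generation.
End Filtration.
End Grading.

(** * Sorting words modulo a span, when neighbours supercommute modulo that span *)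

Section Sorting.
Variables (A : pzRingType) (V : lmodType A) (T : eqType) (le : rel T) (oddT : pred T).
Variables (ev : seq T -> V) (P : V -> Prop) (cls : seq T -> Prop).
Hypothesis le_total : total le.
Hypothesis le_trans : transitive le.
Hypothesis cls_perm : forall s t, perm_eq s t -> cls s -> cls t.
Hypothesis ev_swap : forall s x y t, cls (s ++ x :: y :: t) ->
  exists e : A, lspan P (ev (s ++ x :: y :: t) - e *: ev (s ++ y :: x :: t)).
Hypothesis ev_odd : forall s x t, oddT x -> cls (s ++ x :: x :: t) ->
  lspan P (ev (s ++ x :: x :: t)).

Definition strict_rel : rel T := fun x y => le x y && ~~ (oddT x && (x == y)).

Hypothesis ev_sorted : forall s, cls s -> sorted strict_rel s -> lspan P (ev s).

Let congr_ev s t := exists e : A, lspan P (ev s - e *: ev t).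

Let congr_ev_trans s t u : congr_ev s t -> congr_ev t u -> congr_ev s u.
Proof.
move=> [e Pe] [f Pf]; exists (e * f).
have := lspanD Pe (lspanZ e Pf).
by rewrite scalerBr scalerA addrA subrK.
Qed.

Let congr_ev_refl s : congr_ev s s.
Proof. by exists 1; rewrite scale1r subrr; apply: lspan_nil. Qed.

Let insert_sorted p x s : sorted le s -> cls (p ++ x :: s) ->
  exists t, [/\ sorted le t, perm_eq (x :: s) t & congr_ev (p ++ x :: s) (p ++ t)].
Proof.
elim: s p => [|y s IH] p ss cs; first by exists [:: x]; split.
case xy: (le x y); first by exists [:: x, y & s]; split=> //=; rewrite xy.
have yx : le y x by have := le_total x y; rewrite xy.
have pm : perm_eq [:: x, y & s] [:: y, x & s].
  by rewrite -[x :: _]/([:: x] ++ _) -[y :: s]/([:: y] ++ s) perm_catCA.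
have cs' : cls (rcons p y ++ x :: s).
  by rewrite cat_rcons; apply: cls_perm cs; rewrite perm_cat2l.
have [t [st pt ct]] := IH (rcons p y) (path_sorted ss) cs'.
exists (y :: t); split.
- rewrite /= (path_min_sorted _) //; apply/allP => z; rewrite -(perm_mem pt) inE.
  case/predU1P => [->//|zs].
  by have /allP/(_ z zs) := order_path_min le_trans ss.
- by apply: perm_trans pm _; rewrite perm_cons.
- rewrite !cat_rcons in ct; apply: congr_ev_trans ct.
  exact: ev_swap.
Qed.

Let sort_congr p s : cls (p ++ s) ->
  exists t, [/\ sorted le t, perm_eq s t & congr_ev (p ++ s) (p ++ t)].
Proof.
elim: s p => [|x s IH] p cs; first by exists [::]; split.
have cs' : cls (rcons p x ++ s) by rewrite cat_rcons.
have [t [st pt ct]] := IH _ cs'.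
have ct' : cls (p ++ x :: t) by apply: cls_perm cs; rewrite perm_cat2l perm_cons.
have [u [su pu cu]] := insert_sorted st ct'.
exists u; split=> //; first by apply: perm_trans pu; rewrite perm_cons.
by rewrite !cat_rcons in ct; apply: congr_ev_trans cu.
Qed.

Let nonstrict_repeat s : sorted le s -> ~~ sorted strict_rel s ->
  exists p x t, oddT x /\ s = p ++ x :: x :: t.
Proof.
elim: s => //= x [|y s] IH //= /andP[xy ss]; rewrite negb_and => /orP[|ns].
  by rewrite /strict_rel xy /= negbK => /andP[ox /eqP <-]; exists [::], x, s.
by have [p [z [t [oz ->]]]] := IH ss ns; exists (x :: p), z, t.
Qed.

(** Insertion sort, each exchange costing only an element of the span. The sorted word is either
    strictly sorted at its odd letters or repeats an odd letter in adjacent places, where [ev_odd]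
    applies. *)
Lemma lspan_sorted s : cls s -> lspan P (ev s).
Proof.
move=> cs; have [t [st pt [e Pe]]] := @sort_congr [::] s cs.
suff Pt : lspan P (ev t) by rewrite -(subrK (e *: ev t) (ev s)); apply/lspanD/lspanZ.
have ct := cls_perm pt cs.
have [|/(nonstrict_repeat st)[p [x [u [ox tE]]]]] := boolP (sorted strict_rel t).
  exact: ev_sorted.
by rewrite tE in ct *; apply: ev_odd.
Qed.

End Sorting.

(** * Decomposable vectors are spanned by the nonlinear PBW monomials *)

Section PBW.
Variables (A : comUnitRingType) (V : vertexSuperalgebraType A).
Variable hom : nat -> V -> Prop.
Hypothesis gr : grading hom.
Hypothesis two_unit : (2%:R : A) \is a GRing.unit.

Lemma wvec_cat_linear (s : seq (letter V)) x a b :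
  let f v := foldr (fun y acc => y.2.2 \o_(Negz y.1) acc) v s in
  f (x *: a + b) = x *: f a + f b.
Proof. by elim: s => //= y s ->; rewrite nprod_linr. Qed.

Lemma wvec_cat (s t : seq (letter V)) : wvec (s ++ t) = foldr (fun y acc => y.2.2 \o_(Negz y.1) acc) (wvec t) s.
Proof. by elim: s => //= y s <-. Qed.

Lemma letters_in_cat Q (s t : seq (letter V)) : letters_in Q (s ++ t) <-> letters_in Q s /\ letters_in Q t.
Proof. by elim: s => /= [|x s [IH1 IH2]]; [tauto | split; [move=> [? ? /IH1[]] | move=> [[? ? ?] ?]; split=> //; apply: IH2]]. Qed.

Lemma gweight_cat (s t : seq (letter V)) : gweight (s ++ t) = (gweight s + gweight t)%N.
Proof. by rewrite /gweight map_cat sumn_cat. Qed.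

Lemma cweight_cat (s t : seq (letter V)) : cweight (s ++ t) = (cweight s + cweight t)%N.
Proof. by rewrite /cweight map_cat sumn_cat. Qed.

Lemma decomposable_catr (s t : seq (letter V)) : decomposable t -> decomposable (s ++ t).
Proof. by case: s => //= x [|y s] //=; case: t. Qed.

(** The supercommutator is a sum of modes (a_(i) b)_(-k-k'-i-2) with i nonnegative. Such a letter
    carries at least one derivative, hence is decomposable by itself, and its weight is at most that
    of a and b together minus 2. *)
Lemma nprod_commutator_dec k w a k' w' b (s : seq (letter V)) : hom w a -> hom w' b -> letters_in hom s ->
  dec_span hom (w + w' + gweight s) (w + k.*2 + (w' + k'.*2) + cweight s)
    (a \o_(Negz k) b \o_(Negz k') wvec s -
     (-1) ^+ (odd w && odd w') *: (b \o_(Negz k') a \o_(Negz k) wvec s)).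
Proof.
move=> ha hb hs; have [N HN] := nprod_field a b.
rewrite (nprod_comm _ _ _ (hom_parity gr ha) (hom_parity gr hb) HN).
rewrite addrC addKr; apply: lspan_sum => i _; apply: lspanMz.
have [neg|] := ltP (w%:Z + w'%:Z - 2 * (i : nat)%:Z - 2) 0.
  by rewrite (hom_nprod_neg gr ha hb neg) nprodl0; apply: lspan_nil.
case WE : (w%:Z + w'%:Z - 2 * (i : nat)%:Z - 2) => [W|] // _.
have hi := hom_nprod gr ha hb (esym WE).
have -> : Negz k + Negz k' - (i : nat)%:Z = Negz (k + k' + i).+1 by lia.
case: W WE hi => [|W] WE hi.
  have [x ->] := hom0_vac gr hi.
  by rewrite nprodZl nprod_vacl scaler0; apply: lspan_nil.
apply: lspan_mem; exists (((k + k' + i).+1, (W.+1, (a \o_(i%:Z) b))) :: s); split=> //.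
- by case: (s).
- by rewrite /gweight /=; lia.
- by rewrite /cweight /=; lia.
Qed.

Lemma dec_span_cat (s : seq (letter V)) p W v : letters_in hom s -> dec_span hom p W v ->
  dec_span hom (gweight s + p) (cweight s + W)
    (foldr (fun y acc => y.2.2 \o_(Negz y.1) acc) v s).
Proof.
move=> hs.
apply: (lspan_bind (f := fun v => foldr (fun y acc => y.2.2 \o_(Negz y.1) acc) v s)).
  by move=> x a b; apply: wvec_cat_linear.
move=> _ [t [ht dt gt ct ->]]; apply: lspan_mem; exists (s ++ t); split.
- by apply/letters_in_cat; split.
- exact: decomposable_catr.
- by rewrite gweight_cat ltn_add2l.
- by rewrite cweight_cat ct.
- by rewrite wvec_cat.
Qed.

Lemma wvec_swap (s t : seq (letter V)) x y : letters_in hom (s ++ x :: y :: t) ->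
  dec_span hom (gweight (s ++ x :: y :: t)) (cweight (s ++ x :: y :: t))
    (wvec (s ++ x :: y :: t) -
     (-1) ^+ (odd x.2.1 && odd y.2.1) *: wvec (s ++ y :: x :: t)).
Proof.
move=> /letters_in_cat[hs [x0 hx [y0 hy ht]]].
have := dec_span_cat hs (nprod_commutator_dec x.1 y.1 hx hy ht).
rewrite gweight_cat cweight_cat !wvec_cat /gweight /cweight /= !addnA.
congr (dec_span _ _ _ _); rewrite -scaleNr addrC wvec_cat_linear addrC scaleNr.
by [].
Qed.

Variables (gen : nat -> V) (gwt : nat -> nat).
Hypothesis gwt_gt0 : forall i, (0 < gwt i)%N.
Hypothesis gen_hom : forall i, hom (gwt i) (gen i).

Definition isgen w a := exists2 i, w = gwt i & a = gen i.
Definition gletter (x : nat * nat) : letter V := (x.2, (gwt x.1, gen x.1)).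
Notation gword u := [seq gletter x | x <- u].

Lemma isgen_hom w a : isgen w a -> hom w a.
Proof. by move=> [i -> ->]. Qed.

Lemma letters_in_isgen (s : seq (letter V)) : letters_in isgen s -> exists u, s = gword u.
Proof.
elim: s => [|[k [w a]] s IH] /=; first by exists [::].
by move=> [_ [i -> ->] /IH[u ->]]; exists ((i, k) :: u).
Qed.

Lemma letters_in_gword u : letters_in hom (gword u).
Proof. by elim: u => //= x u IH; split. Qed.

Definition odd_gen : pred nat := fun i => odd (gwt i).
Definition nonlinear (w : seq (nat * nat)) := if w is [:: x] then (0 < x.2)%N else w != [::].
Definition nonlinear_pbw v := exists w,
  [/\ sorted (pbw_rel odd_gen) w, nonlinear w & v = wvec (gword w)].

Hypothesis gen_span : forall w a, (0 < w)%N -> hom w a ->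
  exists b d, [/\ lspan (isgen w) b, C1 hom w d & a = b + d].

(** PBW straightening by induction on [gweight]: the corrections of an exchange are decomposable of
    lower filtration, and they are rewritten in the generators before the induction hypothesis is
    applied. *)
Lemma dec_gword_pbw u : nonlinear u -> lspan nonlinear_pbw (wvec (gword u)).
Proof.
have [n] := ubnP (gweight (gword u)); elim: n u => // n IHn u un nu.
have low v p W : (p <= gweight (gword u))%N -> dec_span hom p W v -> lspan nonlinear_pbw v.
  move=> pn; apply: lspan_sub => _ [s [hs ds gs _ ->]].
  apply: lspan_sub (dec_span_gen gr isgen_hom gen_span hs ds) => _ [t [Tt dt gt _ ->]].
  have [u' tE] := letters_in_isgen Tt; rewrite tE in dt gt *; apply: IHn; first by lia.
  by case: u' dt {gt tE} => [|? []].
pose le (x y : nat * nat) := (x.1 < y.1)%N || ((x.1 == y.1) && (y.2 <= x.2)%N).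
pose cls t := perm_eq u t.
apply: (@lspan_sorted _ _ _ le (fun x => odd_gen x.1) (fun t => wvec (gword t)) _ cls).
- by move=> [i k] [j l]; rewrite /le /=; lia.
- by move=> [i k] [j l] [m o]; rewrite /le /=; lia.
- by move=> s t st us; apply: perm_trans st.
- move=> s x y t us; exists ((-1) ^+ (odd_gen x.1 && odd_gen y.1)).
  rewrite !map_cat /=; apply: low (wvec_swap (x := gletter x) (y := gletter y) _).
    rewrite -[gletter x :: _]/(gword [:: x, y & t]) -map_cat.
    by rewrite /gweight (perm_sumn (perm_map _ (perm_map _ us))).
  by rewrite -[gletter x :: _]/(gword [:: x, y & t]) -map_cat; apply: letters_in_gword.
- move=> s x t ox us; rewrite map_cat /=.
  have := @low _ _ _ _ (@wvec_swap (gword s) (gword t) (gletter x) (gletter x) _).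
  rewrite -[gletter x :: _]/(gword [:: x, x & t]) -map_cat /= -/(odd_gen x.1) ox.
  (* Exchanging two equal odd letters changes the sign, so twice the word has lower filtration, and
     2 is invertible. *)
  rewrite expr1 scaleN1r opprK -mulr2n -scaler_nat => H.
  rewrite -[X in lspan _ X]scale1r -(mulVr two_unit) -scalerA.
  apply/lspanZ/H; last exact: letters_in_gword.
  by rewrite /gweight (perm_sumn (perm_map _ (perm_map _ us))).
- move=> s us ss; apply: lspan_mem; exists s; split=> //.
    apply: sub_sorted ss => -[i k] [j l].
    rewrite /strict_rel /le /pbw_rel /= xpair_eqE; case: odd_gen => /=; lia.
  by case: s us {ss} => [|x [|//]] us; move: nu; rewrite (perm_small_eq _ us).
- exact: perm_refl.
Qed.

(** Combined with freeness, this makes the coordinate along any single generator vanish on [C1]. *)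
Lemma C1_nonlinear w a : C1 hom w a -> lspan nonlinear_pbw a.
Proof.
have low s : letters_in hom s -> decomposable s -> lspan nonlinear_pbw (wvec s).
  move=> hs ds.
  apply: lspan_sub (dec_span_gen gr isgen_hom gen_span hs ds) => _ [t [Tt dt _ _ ->]].
  have [u tE] := letters_in_isgen Tt; rewrite tE in dt *; apply: dec_gword_pbw.
  by case: u dt {tE} => [|? []].
apply: lspan_sub => _ [[[|w'] [b [hb _ ->]]]|[w1 [w2 [b [d [[w10 hb] [w20 hd] _ ->]]]]]].
- have [x ->] := hom0_vac gr hb.
  by rewrite /vder nprodZl nprod_vacl scaler0; apply: lspan_nil.
- by apply: (low [:: (1%N, (w'.+1, b))]).
- have := low [:: (0%N, (w1, b)); (0%N, (w2, d))].
  by rewrite /wvec /= nprod_vacrN1; apply.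
Qed.

End PBW.

(** * Structure constants of the N = 2 superconformal algebra *)

Inductive kind := KH | KP | KM | KL.

Definition kind_code (k : kind) : nat := match k with KH => 0 | KP => 1 | KM => 2 | KL => 3 end.
Definition kind_decode (n : nat) : option kind :=
  match n with 0 => Some KH | 1 => Some KP | 2 => Some KM | 3 => Some KL | _ => None end.
Lemma kind_codeK : pcancel kind_code kind_decode. Proof. by case. Qed.
HB.instance Definition _ := Countable.copy kind (pcan_type kind_codeK).

Definition kodd k := match k with KP | KM => true | _ => false end.
Definition kweight k : nat := match k with KH => 2 | KL => 4 | _ => 3 end.
Definition kcharge k : int := match k with KP => 1 | KM => -1 | _ => 0 end.
Definition kdual k := match k with KP => KM | KM => KP | _ => k end.

Section Bracket.
Variable F : numFieldType.

(* The modes in the supercommutator of [k_(m)] and [k'_(n)], with their       *)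
(* coefficients, and the coefficient of the central charge in it.             *)
Definition br (k : kind) (m : int) (k' : kind) (n : int) : seq (F * (kind * int)) :=
  match k, k' with
  | KL, KL => [:: ((m - n)%:~R, (KL, m + n - 1))]
  | KL, KH => [:: (- n%:~R, (KH, m + n - 1))]
  | KL, _ => [:: (m%:~R / 2%:R - n%:~R, (k', m + n - 1))]
  | KH, KL => [:: (m%:~R, (KH, m + n - 1))]
  | KH, KH => [::]
  | KH, KP => [:: (1, (KP, m + n))]
  | KH, KM => [:: (- 1, (KM, m + n))]
  | KP, KH => [:: (- 1, (KP, m + n))]
  | KM, KH => [:: (1, (KM, m + n))]
  | _, KL => [:: (m%:~R - n%:~R / 2%:R, (k, m + n - 1))]
  | KP, KM => [:: (1, (KL, m + n)); ((m - n)%:~R / 2%:R, (KH, m + n - 1))]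
  | KM, KP => [:: (1, (KL, m + n)); ((n - m)%:~R / 2%:R, (KH, m + n - 1))]
  | _, _ => [::]
  end.

Definition cen (k : kind) (m : int) (k' : kind) (n : int) : F :=
  match k, k' with
  | KL, KL => if m + n == 2 then (binz m 3)%:~R / 2%:R else 0
  | KH, KH => if m + n == 0 then m%:~R / 3%:R else 0
  | KP, KM => if m + n == 1 then (binz m 2)%:~R / 3%:R else 0
  | KM, KP => if m + n == 1 then (binz n 2)%:~R / 3%:R else 0
  | _, _ => 0
  end.

End Bracket.

Lemma binz0 m : binz m 0 = 1.
Proof. by case: m => k /=; rewrite ?addn0 bin0 ?expr0. Qed.
Lemma binz1 m : binz m 1 = m.
Proof. by case: m => k; rewrite /= bin1 // expr1 addn1 NegzE mulN1r. Qed.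

(** * Levels and charges of modes; wedge modes, big letters and the central cocycle *)

Section Levels.
Variable F : numFieldType.

(** Twice the amount by which the mode k_(n) raises the conformal weight. *)
Definition lvl k (n : int) : int := (kweight k)%:Z - 2 * n - 2.

(* The letter (k, i) stands for the creation mode [k_(-i)]; it raises the     *)
(* level in a module generated by a primary vector.  Those with [0 < i] are   *)
(* called big: their commutator with some mode involves the central charge.   *)
Definition nletter := (kind * nat)%type.
Definition nvalid (x : nletter) := ~~ ((x.1 == KH) && (x.2 == 0%N)).
Definition lev (w : seq nletter) : int := \sum_(x <- w) lvl x.1 (- x.2%:Z).
Definition chg (w : seq nletter) : int := \sum_(x <- w) kcharge x.1.
Definition bigs (w : seq nletter) : nat := count (fun x => 0 < x.2)%N w.

(* The modes of [sl_2] and its superextension: the annihilation modes that    *)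
(* never produce the central charge.                                          *)
Definition wedge k (n : nat) := (n + 2 <= kweight k)%N.

Lemma lev_cons x w : lev (x :: w) = lvl x.1 (- x.2%:Z) + lev w.
Proof. exact: big_cons. Qed.

Lemma chg_cons x w : chg (x :: w) = kcharge x.1 + chg w.
Proof. exact: big_cons. Qed.

Lemma lev_nil : lev [::] = 0. Proof. exact: big_nil. Qed.
Lemma chg_nil : chg [::] = 0. Proof. exact: big_nil. Qed.

Lemma lvl_gt0 x : nvalid x -> 0 < lvl x.1 (- x.2%:Z).
Proof. by case: x => -[] [|i] //= _; rewrite /lvl /=; lia. Qed.

Lemma lev_ge0 w : all nvalid w -> 0 <= lev w.
Proof.
elim: w => [|x w IH] /=; first by rewrite lev_nil.
by case/andP=> /lvl_gt0 x0 /IH w0; rewrite lev_cons; lia.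
Qed.

Lemma lev_eq0 w : all nvalid w -> lev w = 0 -> w = [::].
Proof.
case: w => //= x w /andP[/lvl_gt0 x0 /lev_ge0 w0]; rewrite lev_cons; lia.
Qed.

Lemma br_lvl k m k' n t : t \in br F k m k' n ->
  lvl t.2.1 t.2.2 = lvl k m + lvl k' n /\ kcharge t.2.1 = kcharge k + kcharge k'.
Proof.
case: k; case: k'; rewrite /= ?inE //; do ?[move=> /eqP -> | case/orP => /eqP ->];
  rewrite /lvl /=; split => //; lia.
Qed.

Lemma cen_lvl k m k' n : cen F k m k' n != 0 ->
  lvl k m + lvl k' n = 0 /\ kcharge k + kcharge k' = 0.
Proof.
case: k; case: k'; rewrite /= ?eqxx //; case: ifP => mn; rewrite ?eqxx // => _;
  rewrite /lvl /=; split => //; lia.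
Qed.

(** A wedge mode can neither create a big letter out of a small one nor leave the wedge. The
    alternative [t.1 = 0] covers formal terms with zero coefficient, such as the one for L_(0)
    against L_(0). *)
Lemma br_wedge k (n : nat) k' (i : nat) t : nvalid (k', i) -> wedge k n ->
  t \in br F k n%:Z k' (- i%:Z) ->
  t.1 = 0 \/ (t.2.2 < 0 -> (0 < i)%N) /\ (forall j : nat, t.2.2 = j%:Z -> wedge t.2.1 j).
Proof.
rewrite /nvalid /wedge /=.
have [-> v|i0 v wn tb] := posnP i; last first.
  right; split=> // j; move: tb.
  case: k wn; case: k' v => //= _ wn; rewrite ?inE //; do ?[move=> /eqP -> | case/orP => /eqP ->] => /= jE; lia.
rewrite oppr0; have [n0|n0] := posnP n.
  rewrite n0; case: k; case: k' v => //= _ _; rewrite ?inE ?subrr ?mulr0z ?mul0r ?oppr0 ?addr0 //;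
  do ?[move=> /eqP -> | case/orP => /eqP ->] => /=; do ?[by left]; right; split=> [|j jE]; lia.
case: k; case: k' v => //= _ wn; rewrite ?inE //;
  do ?[move=> /eqP -> | case/orP => /eqP ->] => /=; right; split=> [|j jE]; lia.
Qed.

Lemma cen_wedge k (n : nat) k' (i : nat) : nvalid (k', i) -> wedge k n ->
  cen F k n%:Z k' (- i%:Z) = 0.
Proof.
rewrite /nvalid /wedge; case: k; case: k' => //= v wn; case: eqP => // ni.
- have n0 : n = 0%N by lia.
  by rewrite n0 mulr0z mul0r.
- by rewrite bin_small ?mulr0z ?mul0r //; lia.
- case: i v ni => [|i] v ni; last by lia.
  by rewrite mulr0z mul0r.
- by rewrite bin_small ?mulr0z ?mul0r //; lia.
Qed.

Lemma cen_big k (n : nat) k' (i : nat) : nvalid (k', i) -> ~~ wedge k n ->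
  cen F k n%:Z k' (- i%:Z) != 0 -> (0 < i)%N.
Proof.
rewrite /nvalid /wedge; case: i => //; case: k; case: k' => //= _ wn;
  rewrite ?eqxx //; case: ifP => ni; rewrite ?eqxx //; lia.
Qed.

(* The annihilation mode paired with the big creation mode (k, i).            *)
Definition dmode (x : nletter) : kind * nat :=
  (kdual x.1, match x.1 with KH => x.2 | KL => x.2 + 2 | _ => x.2 + 1 end)%N.

Lemma dmode_big x : (0 < x.2)%N -> ~~ wedge (dmode x).1 (dmode x).2.
Proof. by case: x => -[] i; rewrite /wedge /=; lia. Qed.

Lemma cen_dmode x : (0 < x.2)%N ->
  cen F (dmode x).1 (dmode x).2%:Z x.1 (- x.2%:Z) != 0.
Proof.
case: x => -[] [|i] //= _.
- have -> : i.+1%:Z + - i.+1%:Z == 0 by lia.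
  by rewrite mulf_neq0 ?invr_eq0 ?pnatr_eq0 ?intr_eq0.
- have -> : (i.+1 + 1)%N%:Z + - i.+1%:Z == 1 by lia.
  rewrite mulf_neq0 ?invr_eq0 ?pnatr_eq0 //.
  by rewrite !mul1n -lt0n bin_gt0; lia.
- have -> : (i.+1 + 1)%N%:Z + - i.+1%:Z == 1 by lia.
  by rewrite mulf_neq0 ?invr_eq0 ?pnatr_eq0 // -lt0n bin_gt0; lia.
- have -> : (i.+1 + 2)%N%:Z + - i.+1%:Z == 2 by lia.
  by rewrite mulf_neq0 ?invr_eq0 ?pnatr_eq0 // -lt0n bin_gt0; lia.
Qed.

Lemma cen_dmode_neq x y : (0 < x.2)%N -> x != y ->
  cen F (dmode x).1 (dmode x).2%:Z y.1 (- y.2%:Z) = 0.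
Proof.
case: x => k i; case: y => k' i'; rewrite xpair_eqE /= => i0.
by case: k; case: k' => //= ne; case: eqP => // e; lia.
Qed.

Lemma dmode_lvl x : lvl (dmode x).1 (dmode x).2%:Z = - lvl x.1 (- x.2%:Z) /\
  kcharge (dmode x).1 = - kcharge x.1.
Proof. by case: x => -[] i; rewrite /lvl /=; split=> //; lia. Qed.

End Levels.

(** * Words of big letters, the index set of the pairing matrix, and its order *)

Definition isbig (x : nletter) := (0 < x.2)%N.
Definition bcode (x : nletter) : nat := (x.2 * 4 + kind_code x.1)%N.

Lemma bcode_inj : injective bcode.
Proof. by move=> [k i] [k' i']; rewrite /bcode; case: k; case: k' => /= e; congr pair; lia. Qed.

(** The words sorted for this relation are the PBW words in the big modes: an odd letter occurs at
    most once. *)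
Definition brel : rel nletter :=
  strict_rel (fun x y => (bcode x <= bcode y)%N) (fun x => kodd x.1).

Lemma brel_le x y : brel x y -> (bcode x <= bcode y)%N.
Proof. by case/andP. Qed.

Lemma brel_neq x y : brel x y -> x != y -> (bcode x < bcode y)%N.
Proof. by case/andP; rewrite leq_eqVlt => /orP[/eqP/bcode_inj ->|//]; rewrite eqxx. Qed.

Lemma brel_trans : transitive brel.
Proof.
move=> y x z /[dup] /brel_le xy b1 /[dup] /brel_le yz b2.
rewrite /brel /strict_rel (leq_trans xy yz) /=; apply/negP => /andP[ox /eqP xz].
have yx : x = y by apply: bcode_inj; rewrite -xz in yz; lia.
by move: b1; rewrite /brel /strict_rel yx leqnn -yx ox eqxx.
Qed.

Lemma notin_path x b : path brel x b -> head x b != x -> x \notin b.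
Proof.
case: b => //= y b /andP[xy yb] yx.
have lt : (bcode x < bcode y)%N by apply: brel_neq => //; rewrite eq_sym.
rewrite inE negb_or eq_sym yx /=; apply/negP => xb.
have /allP/(_ x xb)/brel_le := order_path_min brel_trans yb; lia.
Qed.

Lemma odd_notin_path x b : kodd x.1 -> path brel x b -> x \notin b.
Proof.
move=> ox pb; apply/negP => xb.
have /allP/(_ x xb) := order_path_min brel_trans pb.
by rewrite /brel /strict_rel ox eqxx andbF.
Qed.

Lemma bigs_cat b s : bigs (b ++ s) = (bigs b + bigs s)%N.
Proof. exact: count_cat. Qed.
Lemma lev_cat b s : lev (b ++ s) = lev b + lev s.
Proof. exact: big_cat. Qed.
Lemma chg_cat b s : chg (b ++ s) = chg b + chg s.
Proof. exact: big_cat. Qed.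
Lemma bigs_all b : all isbig b -> bigs b = size b.
Proof. by rewrite all_count => /eqP. Qed.
Lemma nvalid_big x : isbig x -> nvalid x.
Proof. by case: x => k [|i] // _; rewrite /nvalid andbF. Qed.

Fixpoint lexlt (s t : seq nat) : bool :=
  if s is x :: s' then if t is y :: t' then (x < y)%N || ((x == y) && lexlt s' t') else false
  else false.

Lemma sub_cancel (U : zmodType) (r x y z : U) : r - (x + y) + (x - z) = r - (y + z).
Proof. by rewrite addrA opprD (addrC (- x)) !addrA subrK -addrA -opprD. Qed.

(** The small creation words: L_(0)^j times 1, G^+_(0), G^-_(0) or G^+_(0) G^-_(0), a basis of the
    Verma module of the wedge algebra sl(2|1). *)
Definition sword (j : nat) (k : kind) : seq nletter := nseq j (KL, 0%N) ++
  match k with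
  | KH => [::] | KP => [:: (KP, 0%N)] | KM => [:: (KM, 0%N)]
  | KL => [:: (KP, 0%N); (KM, 0%N)]
  end.

Lemma subr_subACA (U : zmodType) (x y z t : U) : (x - y) - (z - t) = (x - z) - (y - t).
Proof. by rewrite !opprB addrACA (addrC (- y)) addrACA. Qed.

Definition klev k : nat := match k with KH => 0 | KL => 2 | _ => 1 end.

Lemma lev_sword j k : lev (sword j k) = (j.*2 + klev k)%N%:Z.
Proof.
rewrite /sword lev_cat; have -> : lev (nseq j (KL, 0%N)) = (j.*2)%:Z.
  elim: j => [|j IH]; first by rewrite lev_nil.
  by rewrite /= lev_cons IH /lvl /=; lia.
by case: k; rewrite /= ?lev_cons lev_nil /lvl /=; lia.
Qed.

Lemma chg_sword j k : chg (sword j k) = kcharge k.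
Proof.
rewrite /sword chg_cat; have -> : chg (nseq j (KL, 0%N)) = 0.
  by elim: j => [|j IH]; rewrite ?chg_nil //= chg_cons IH.
by case: k; rewrite /= ?chg_cons chg_nil.
Qed.

Lemma sword_valid j k : all nvalid (sword j k).
Proof. by rewrite /sword all_cat all_nseq orbT; case: k. Qed.

Lemma sword_small j k : bigs (sword j k) = 0%N.
Proof. by rewrite /sword bigs_cat /bigs count_nseq /= mul0n; case: k. Qed.

Definition alev b j k : int := lev b + (j.*2 + klev k)%N%:Z.
Definition achg b k : int := chg b + kcharge k.
(** Pairs (test [x], creation word [y]) whose pairing tends to 0 as [c] grows: [x] has more big
    letters, or as many but lexicographically smaller ones, or the same ones and a power of L_(2)
    too high for the quasi-primary vector in [y]. *)
Definition before (x y : seq nletter * (nat * kind)) : bool :=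
  [|| (size y.1 < size x.1)%N,
      (size x.1 == size y.1) && lexlt (map bcode x.1) (map bcode y.1) |
      [&& x.1 == y.1, x.2 == (y.2.1.+1, KH) & y.2.2 == KL]].

Lemma dmode_surj k n : ~~ wedge k n -> exists2 x, isbig x & dmode x = (k, n).
Proof.
rewrite /wedge; case: k => /= nw.
- by exists (KH, n) => //; rewrite /isbig /=; lia.
- by exists (KM, n - 1)%N; rewrite /isbig /dmode /=; [lia | congr pair; lia].
- by exists (KP, n - 1)%N; rewrite /isbig /dmode /=; [lia | congr pair; lia].
- by exists (KL, n - 2)%N; rewrite /isbig /dmode /=; [lia | congr pair; lia].
Qed.

Definition posmode k (n : nat) := ((if k is KL then 1 else 0) < n)%N.

Lemma br_pos (F : numFieldType) k (n : nat) k' (n' : nat) t :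
    ~~ wedge k n -> posmode k' n' -> t \in br F k n%:Z k' n'%:Z ->
  exists2 m : nat, t.2.2 = m%:Z & ~~ wedge t.2.1 m.
Proof.
rewrite /wedge /posmode => nw p' tb.
suff [t0 nt] : 0 <= t.2.2 /\ ~~ (absz t.2.2 + 2 <= kweight t.2.1)%N.
  by exists (absz t.2.2); rewrite ?gez0_abs.
by case: k nw tb => /= nw; case: k' p' => //= p'; rewrite ?inE //;
  do ?[move=> /eqP -> | case/orP => /eqP ->]; split; rewrite /=; lia.
Qed.

Lemma cen_pos (F : numFieldType) k (n : nat) k' (n' : nat) :
  ~~ wedge k n -> posmode k' n' -> cen F k n%:Z k' n'%:Z = 0.
Proof.
rewrite /wedge /posmode => nw p'; case: k nw => /= nw; case: k' p' => //= p';
  case: ifP => // e; lia.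
Qed.

(** In a left kernel vector, look at the nonzero coordinate of largest rank: the corresponding
    column leaves a single nonzero term. *)
Lemma det_triangular_rank (F : fieldType) n (M : 'M[F]_n) (r : 'I_n -> nat) :
    injective r -> (forall i, M i i != 0) ->
    (forall i j, (r i < r j)%N -> M i j = 0) -> \det M != 0.
Proof.
move=> rI M1 M0; apply/negP => /det0P[v v0 vM].
have [i0 vi0] : exists i, v 0 i != 0.
  by apply/rV0Pn: v0.
pose P i := v 0 i != 0.
case: (@arg_maxnP _ i0 P r vi0) => j vj jmax.
have /rowP/(_ j) := vM; rewrite !mxE (bigD1 j) //= big1 ?addr0 => [|i ij].
  by apply/eqP; rewrite mulf_neq0.
have [->|vi] := eqVneq (v 0 i) 0; first by rewrite mul0r.
have le : (r i <= r j)%N := jmax i vi.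
rewrite M0 ?mulr0 // ltn_neqAle le andbT.
by apply: contraNneq ij => /rI ->.
Qed.

(** Reading a word in base [B] turns the lexicographic order of words of equal length into the order
    of natural numbers. *)
Fixpoint numeral (B : nat) (s : seq nat) : nat :=
  if s is x :: s' then (x * B ^ size s' + numeral B s')%N else 0%N.

Lemma numeral_lt B s : all (fun x => x < B)%N s -> (numeral B s < B ^ size s)%N.
Proof.
elim: s => //= x s IH /andP[xB /IH sB]; rewrite expnS.
have : (x.+1 * B ^ size s <= B * B ^ size s)%N by rewrite leq_mul2r xB orbT.
by rewrite mulSn; lia.
Qed.

Lemma numeral_lex B s t : all (fun x => x < B)%N s -> all (fun x => x < B)%N t ->
  size s = size t -> (numeral B s < numeral B t)%N -> lexlt s t.
Proof.
elim: s t => [|x s IH] [|y t] //= /andP[_ sB] /andP[_ tB] [st] lt.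
have [//|yx|xy] /= := ltngtP x y; last first.
  by apply: IH => //; rewrite xy st in lt; lia.
have : (y.+1 * B ^ size t <= x * B ^ size t)%N by rewrite leq_mul2r yx orbT.
by have := numeral_lt tB; rewrite st in lt; rewrite mulSn; lia.
Qed.

Lemma numeral_inj B s t : all (fun x => x < B)%N s -> all (fun x => x < B)%N t ->
  size s = size t -> numeral B s = numeral B t -> s = t.
Proof.
elim: s t => [|x s IH] [|y t] //= /andP[_ sB] /andP[_ tB] [st] eq.
have sl := numeral_lt sB; have tl := numeral_lt tB; rewrite st in sl eq.
have xy : x = y.
  have [yx|yx|//] := ltngtP x y.
    have : (x.+1 * B ^ size t <= y * B ^ size t)%N by rewrite leq_mul2r yx orbT.
    by rewrite mulSn; lia.
  have : (y.+1 * B ^ size t <= x * B ^ size t)%N by rewrite leq_mul2r yx orbT.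
  by rewrite mulSn; lia.
by rewrite xy (IH t) //; rewrite xy in eq; lia.
Qed.

Definition pbwidx := (seq nletter * (nat * kind))%type.
Definition ivalid (x : pbwidx) := all isbig x.1 && sorted brel x.1.
Definition ilev (x : pbwidx) := alev x.1 x.2.1 x.2.2.
Definition ichg (x : pbwidx) := achg x.1 x.2.2.

(** The rank compares the number of big letters in descending order, then the words as numerals,
    then puts [KL] last. At fixed level and charge, two distinct indices with the same big word are
    (j+1, [KH]) and (j, [KL]), so the last digit suffices to separate them. *)
Lemma index_rank (I : seq pbwidx) :
    (forall x, x \in I -> ivalid x) ->
    (forall x y, x \in I -> y \in I -> ilev x = ilev y /\ ichg x = ichg y) ->
  exists r : pbwidx -> nat, {in I &, injective r} /\
    {in I &, forall x y, (r x < r y)%N -> before x y}.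
Proof.
move=> Iv Ieq.
pose B := (\sum_(x <- I) \sum_(y <- x.1) bcode y).+1.
pose N := \sum_(x <- I) size x.1.
have code_lt x : x \in I -> all (fun c => c < B)%N (map bcode x.1).
  move=> xI; apply/allP => _ /mapP[y yx ->]; rewrite ltnS.
  by rewrite (big_rem x) //= (big_rem y) //= -addnA leq_addr.
have sz x : x \in I -> (size x.1 <= N)%N by move=> xI; rewrite /N (big_rem x) //= leq_addr.
pose num (x : pbwidx) := numeral B (map bcode x.1).
have num_lt x : x \in I -> (num x < B ^ N)%N.
  move=> xI; apply: leq_trans (numeral_lt (code_lt x xI)) _.
  by rewrite leq_pexp2l // size_map sz.
pose r (x : pbwidx) := ((N - size x.1) * (B ^ N * 2) + (num x * 2 + (x.2.2 == KL)))%N.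
have r_size x y : x \in I -> y \in I -> (size x.1 < size y.1)%N -> (r y < r x)%N.
  move=> xI yI xy; have := num_lt x xI; have := num_lt y yI; have := sz y yI.
  rewrite /r; set b := (B ^ N)%N => yN ny nx.
  have : ((N - size y.1).+1 * (b * 2) <= (N - size x.1) * (b * 2))%N.
    by rewrite leq_mul2r; apply/orP; right; lia.
  rewrite mulSn; move: ((N - size y.1) * _)%N ((N - size x.1) * _)%N => t1 t2.
  by case: (y.2.2 == KL); case: (x.2.2 == KL) => /=; lia.
have same x y : x \in I -> y \in I -> size x.1 = size y.1 -> num x = num y -> x.1 = y.1.
  move=> xI yI xy n; apply: (inj_map bcode_inj).
  by apply: (numeral_inj (code_lt x xI) (code_lt y yI)); rewrite ?size_map.
exists r; split=> x y xI yI; have [le ce] := Ieq x y xI yI.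
- move=> rr; have xy : size x.1 = size y.1.
    by have [/(r_size _ _ xI yI)|/(r_size _ _ yI xI)|//] := ltngtP (size x.1) (size y.1); lia.
  move: rr; rewrite /r xy => /addnI rr.
  have [n kk] : num x = num y /\ (x.2.2 == KL) = (y.2.2 == KL).
    by move: rr; case: (y.2.2 == KL); case: (x.2.2 == KL) => /=; lia.
  have e1 := same x y xI yI xy n; clear rr n.
  case: x y e1 le ce kk {xI yI xy} => a [j k] [b [j' k']] /= -> .
  rewrite /ilev /ichg /alev /achg /=; case: k; case: k' => //= le ce _;
  congr (_, (_, _)); lia.
- move=> rr; have xy : (size y.1 <= size x.1)%N.
    by rewrite leqNgt; apply/negP => /(r_size _ _ xI yI); lia.
  rewrite /before; have [//|nlt] := boolP (size y.1 < size x.1)%N.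
  have {}xy : size x.1 = size y.1 by lia.
  rewrite xy eqxx /=; move: rr; rewrite /r xy ltn_add2l => rr.
  have [lt|eqn] : (num x < num y)%N \/ num x = num y /\ (x.2.2 != KL /\ y.2.2 = KL).
    move: rr; have [ky|ky] := eqVneq y.2.2 KL; have [kx|kx] := eqVneq x.2.2 KL => /= rr.
    - by left; lia.
    - have [lt|lt|lt] := ltngtP (num x) (num y); [by left | lia | by right].
    - by left; lia.
    - by left; lia.
  + by rewrite (numeral_lex (code_lt x xI) (code_lt y yI)) ?size_map.
  + have [n [k1 k2]] := eqn.
    have e1 := same x y xI yI xy n; rewrite e1 eqxx orbC /=.
    case: x y e1 le ce k1 k2 {nlt xI yI xy rr n eqn} => a [j k] [b [j' k']] /= -> + + + k2.
    rewrite k2 /ilev /ichg /alev /achg /= eqxx andbT.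
    case: k => //= le ce _; try lia.
    have -> : j = j'.+1 by lia.
    by rewrite eqxx ?orbT.
Qed.

Definition letters_upto (n : nat) : seq nletter :=
  [seq (k, i) | k <- [:: KH; KP; KM; KL], i <- iota 1 n].

Fixpoint words_upto (n m : nat) : seq (seq nletter) :=
  if m is m'.+1 then [::] :: [seq x :: w | x <- letters_upto n, w <- words_upto n m'] else [:: [::]].

Lemma mem_words_upto n m w : all isbig w -> all (fun x => x.2 <= n)%N w -> (size w <= m)%N ->
  w \in words_upto n m.
Proof.
elim: m w => [|m IH] [|x w] //= /andP[bx bw] /andP[nx nw] sw.
rewrite inE; apply/orP; right; apply/allpairsP; exists (x, w); split; [|exact: IH|by []].
case: x bx nx => k i; rewrite /isbig /= => bx nx.
apply/allpairsP; exists (k, i); split; [by case: k| |by []].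
by rewrite mem_iota /=; lia.
Qed.

Lemma lev_big_bound w : all isbig w -> (size w)%:Z <= lev w /\ all (fun x => x.2%:Z <= lev w) w.
Proof.
elim: w => [|x w IH] /=; first by rewrite lev_nil.
move=> /andP[bx /IH[sw lw]]; rewrite lev_cons.
have x1 : x.2%:Z <= lvl x.1 (- x.2%:Z) by rewrite /lvl; move: bx; rewrite /isbig; case: (x.1) => /=; lia.
have x2 : 1 <= lvl x.1 (- x.2%:Z) by move: bx; rewrite /isbig; lia.
split; first by lia.
apply/andP; split; first by lia.
by apply: sub_all lw => y /=; lia.
Qed.

(** At a given level there are finitely many indices: the level bounds the number of big letters,
    each of their mode indices, and the power of L_(0). *)
Lemma pbwidx_enum l e (P : pred pbwidx) : exists I : seq pbwidx, uniq I /\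
  forall x, x \in I = [&& ivalid x, ilev x == l, ichg x == e & P x].
Proof.
pose n := absz l.
pose J := [seq (j, k) | j <- iota 0 n.+1, k <- [:: KH; KP; KM; KL]].
pose all_idx : seq pbwidx := [seq (a, jk) | a <- words_upto n n, jk <- J].
pose Q x := [&& ivalid x, ilev x == l, ichg x == e & P x].
exists (undup [seq x <- all_idx | Q x]); split=> [|x]; first exact: undup_uniq.
rewrite mem_undup mem_filter -/(Q x); case Qx: (Q x) => //=.
case: x Qx => a [j k] /and4P[/andP[/= bx _] /eqP lx _ _]; move: lx; rewrite /ilev /alev /=.
have [s1 s2] := lev_big_bound bx => lx.
have n0 : n%:Z = l by rewrite /n; lia.
apply/allpairsP; exists (a, (j, k)); split; [| |by []].
  apply: mem_words_upto => //; first by apply: sub_all s2 => -[k' i] /=; lia.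
  by move: s1 => /=; lia.
apply/allpairsP; exists (j, k); split; [|by case: (k)|by []].
by rewrite mem_iota /=; lia.
Qed.

(** * Commutation relations of the modes on a module over the base ring *)

Section Superconformal.
Variables (F : numFieldType) (A : comUnitRingType) (phi : {rmorphism F -> A}).
Variables (V : vertexSuperalgebraType A) (c : A) (H Gp Gm L : V).
Hypothesis c_unit : c \is a GRing.unit.
Hypothesis N2 : N2_superconformal c H Gp Gm L.
Hypothesis Hpar : vparity false H.
Hypothesis Gppar : vparity true Gp.
Hypothesis Gmpar : vparity true Gm.
Hypothesis Lpar : vparity false L.

Definition fld k := match k with KH => H | KP => Gp | KM => Gm | KL => L end.
Definition mode k (n : int) (v : V) := fld k \o_(n) v.

Lemma fld_parity k : vparity (kodd k) (fld k).
Proof. by case: k. Qed.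

Lemma mode_linear k n x a b : mode k n (x *: a + b) = x *: mode k n a + mode k n b.
Proof. exact: nprod_linr. Qed.

Definition brv k m k' n v := \sum_(t <- br F k m k' n) phi t.1 *: mode t.2.1 t.2.2 v +
  (phi (cen F k m k' n) * c) *: v.

Let phiV n : phi (n.+1%:R^-1) = (n.+1%:R)^-1.
Proof. by rewrite rmorphV ?rmorph_nat // unitfE pnatr_eq0. Qed.

Let commE k m k' n v N :
    (forall i : nat, (N <= i)%N -> fld k \o_(i%:Z) fld k' = 0) ->
  mode k m (mode k' n v) = (-1) ^+ (kodd k && kodd k') *: mode k' n (mode k m v) +
    \sum_(i < N) (binz m i)%:~R *: ((fld k \o_((i : nat)%:Z) fld k') \o_(m + n - (i : nat)%:Z) v).
Proof.
move=> HN; rewrite /mode (nprod_comm _ _ _ (fld_parity k) (fld_parity k') HN).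
by congr (_ + _); apply: eq_bigr => i _; rewrite scaler_int.
Qed.

Let skew k k' : (forall m n v, mode k m (mode k' n v) =
    (-1) ^+ (kodd k && kodd k') *: mode k' n (mode k m v) + brv k m k' n v) ->
  forall m n v, mode k' m (mode k n v) =
    (-1) ^+ (kodd k' && kodd k) *: mode k n (mode k' m v) -
    (-1) ^+ (kodd k' && kodd k) *: brv k n k' m v.
Proof.
move=> E m n v; rewrite E scalerDr scalerA andbC addrK.
by rewrite -exprMn mulrNN mulr1 expr1n scale1r.
Qed.

(** The commutator formula converts the given n-th products into brackets. It is evaluated for one
    order of each pair of fields; [flip] gives the other order by skew-symmetry of the structure
    constants. *)
Lemma mode_comm k m k' n v : mode k m (mode k' n v) =
  (-1) ^+ (kodd k && kodd k') *: mode k' n (mode k m v) + brv k m k' n v.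
Proof.
case: N2 => -[[[L0 L1 L2 L3 L4] Lder _] HP PP MP] [H0 H1 H2] [HP0 HM0 HG] [G0 G1 G2 G3] GG.
have Lprim k0 h : Virasoro_primary L (phi h) (fld k0) -> forall m n v,
    mode KL m (mode k0 n v) = (-1) ^+ (kodd KL && kodd k0) *: mode k0 n (mode KL m v) +
    phi (m%:~R * (h - 1) - n%:~R) *: mode k0 (m + n - 1) v.
  move=> [P1 P2] {}m {}n {}v; rewrite (@commE KL m k0 n v 2); last first.
    by case=> [|[|i]] // _; apply: P2.
  congr (_ + _); rewrite big_ord_recl big_ord1 /= Lder P1 binz0 binz1 nprodZl.
  rewrite vder_nprod subr0 mulNrz -scaler_int -scaleNr !scalerA -scalerDl.
  congr (_ *: _); rewrite rmorphB rmorphM rmorphB rmorph1 !rmorph_int.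
  by rewrite (rmorph1 phi) intrD; ring.
have vacE i2 u : (vac : V) \o_(i2) u = (if i2 == -1 then 1 else 0 : A) *: u.
  by rewrite nprod_vacl; case: eqP => _; rewrite ?scale1r ?scale0r.
have LH : Virasoro_primary L (phi 1) (fld KH) by rewrite rmorph1.
have LG : phi (3%:R / 2%:R) = 3%:R / 2%:R by rewrite rmorphM phiV rmorph_nat.
have LP : Virasoro_primary L (phi (3%:R / 2%:R)) (fld KP) by rewrite LG.
have LM : Virasoro_primary L (phi (3%:R / 2%:R)) (fld KM) by rewrite LG.
have ELH i1 i2 u : mode KL i1 (mode KH i2 u) =
    (-1) ^+ false *: mode KH i2 (mode KL i1 u) + brv KL i1 KH i2 u.
  rewrite (Lprim _ _ LH) /brv big_seq1 /= rmorph0 mul0r scale0r addr0 subrr mulr0 sub0r.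
  by [].
have ELG k0 i1 i2 u : Virasoro_primary L (phi (3%:R / 2%:R)) (fld k0) -> kodd k0 ->
    mode KL i1 (mode k0 i2 u) =
    (-1) ^+ false *: mode k0 i2 (mode KL i1 u) + brv KL i1 k0 i2 u.
  move=> LG0 k0o; rewrite (Lprim _ _ LG0) /brv; case: k0 k0o LG0 => // _ _;
  rewrite big_seq1 /= rmorph0 mul0r scale0r addr0; congr (_ + phi _ *: _); by field.
have ELL i1 i2 u : mode KL i1 (mode KL i2 u) =
    (-1) ^+ false *: mode KL i2 (mode KL i1 u) + brv KL i1 KL i2 u.
  rewrite (@commE KL i1 KL i2 u 4); last by move=> i i4; apply: L4.
  congr (_ + _); rewrite /brv big_seq1 /= !big_ord_recl big_ord0 /= /bump /=.
  rewrite L0 L1 L2 L3 binz0 binz1 nprodl0 scaler0 !nprodZl vacE vder_nprod subr0.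
  rewrite -scaler_int !addr0 add0r scalerN scale1r -scaleNr scalerA addrA -scalerDl !scalerA.
  congr (_ *: _ + _ *: _).
    by rewrite rmorph_int !intrD mulrNz; ring.
  have -> : (i1 + i2 - Posz 3 == -1) = (i1 + i2 == 2) by lia.
  case: ifP => _; last by rewrite !mulr0 rmorph0 mul0r.
  by rewrite mulr1 rmorphM rmorph_int phiV; ring.
have EHH i1 i2 u : mode KH i1 (mode KH i2 u) =
    (-1) ^+ false *: mode KH i2 (mode KH i1 u) + brv KH i1 KH i2 u.
  rewrite (@commE KH i1 KH i2 u 2); last by move=> i i4; apply: H2.
  congr (_ + _); rewrite /brv big_nil /= !big_ord_recl big_ord0 /= /bump /=.
  rewrite H0 H1 binz1 nprodl0 scaler0 nprodZl vacE !add0r addr0 !scalerA.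
  congr (_ *: _).
  have -> : (i1 + i2 - Posz 1 == -1) = (i1 + i2 == 0) by lia.
  case: ifP => _; last by rewrite !mulr0 rmorph0 mul0r.
  by rewrite mulr1 rmorphM rmorph_int phiV; ring.
have EHG k0 (e : F) i1 i2 u : fld KH \o_(0) fld k0 = phi e *: fld k0 ->
    (forall n : nat, (1 <= n)%N -> fld KH \o_(n%:Z) fld k0 = 0) ->
    br F KH i1 k0 i2 = [:: (e, (k0, i1 + i2))] -> cen F KH i1 k0 i2 = 0 ->
    mode KH i1 (mode k0 i2 u) =
    (-1) ^+ false *: mode k0 i2 (mode KH i1 u) + brv KH i1 k0 i2 u.
  move=> E0 E1 bE cE; rewrite (@commE KH i1 k0 i2 u 1) //.
  congr (_ + _); rewrite /brv bE cE big_seq1 big_ord1 /= E0 binz0 scale1r.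
  by rewrite nprodZl (rmorph0 phi) mul0r scale0r !addr0.
have EHP i1 i2 u : mode KH i1 (mode KP i2 u) =
    (-1) ^+ false *: mode KP i2 (mode KH i1 u) + brv KH i1 KP i2 u.
  apply: (EHG _ 1) => //=; first by rewrite rmorph1 scale1r.
  by move=> i /HG[].
have EHM i1 i2 u : mode KH i1 (mode KM i2 u) =
    (-1) ^+ false *: mode KM i2 (mode KH i1 u) + brv KH i1 KM i2 u.
  apply: (EHG _ (-1)) => //=; first by rewrite rmorphN1 scaleN1r.
  by move=> i /HG[].
have EPM i1 i2 u : mode KP i1 (mode KM i2 u) =
    (-1) ^+ true *: mode KM i2 (mode KP i1 u) + brv KP i1 KM i2 u.
  rewrite (@commE KP i1 KM i2 u 3) //.
  congr (_ + _); rewrite /brv /= big_cons big_seq1 /= !big_ord_recl big_ord0 /= /bump /=.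
  rewrite G0 G1 G2 binz0 binz1 !nprodDl !nprodZl vacE vder_nprod subr0 addr0.
  rewrite mulr1z (rmorph1 phi) !scale1r -scaler_int scalerN scalerA -scaleNr.
  rewrite -[LHS]addrA -[RHS]addrA; congr (_ + _).
  have -> : i1 + i2 - Posz (1 + 0) = i1 + i2 - 1 by lia.
  rewrite [LHS]addrA !scalerA -scalerDl; congr (_ *: _ + _ *: _).
    rewrite rmorphM rmorph_int phiV !intrD mulrNz.
    have e2 : (2%:R : A)^-1 * 2%:R = 1 by rewrite -phiV -(rmorph_nat phi) -rmorphM mulVf ?rmorph1 ?pnatr_eq0.
    transitivity (2%:R^-1 * - (i1%:~R + i2%:~R) + 2%:R^-1 * 2%:R * i1%:~R : A); last by ring.
    by rewrite e2 mul1r.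
  have -> : (i1 + i2 - Posz 2 == -1) = (i1 + i2 == 1) by lia.
  case: ifP => _; last by rewrite !mulr0 rmorph0 mul0r.
  by rewrite mulr1 rmorphM rmorph_int phiV; ring.
have E0 k0 i1 i2 u : (forall n : nat, fld k0 \o_(n%:Z) fld k0 = 0) -> kodd k0 ->
    mode k0 i1 (mode k0 i2 u) =
    (-1) ^+ true *: mode k0 i2 (mode k0 i1 u) + brv k0 i1 k0 i2 u.
  move=> E k0o; rewrite (@commE k0 i1 k0 i2 u 0) // k0o big_ord0 /brv.
  congr (_ + _); case: k0 k0o {E} => // _;
  by rewrite big_nil /= (rmorph0 phi) mul0r scale0r addr0.
have flip k1 k2 : (forall m n v, mode k1 m (mode k2 n v) =
    (-1) ^+ (kodd k1 && kodd k2) *: mode k2 n (mode k1 m v) + brv k1 m k2 n v) ->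
    (forall m n v, brv k2 m k1 n v = - ((-1) ^+ (kodd k2 && kodd k1) *: brv k1 n k2 m v)) ->
    forall m n v, mode k2 m (mode k1 n v) =
    (-1) ^+ (kodd k2 && kodd k1) *: mode k1 n (mode k2 m v) + brv k2 m k1 n v.
  by move=> E B i1 i2 u; rewrite (skew E) B.
have single k1 k2 i1 i2 (x y : F) t u : br F k1 i1 k2 i2 = [:: (x, t)] ->
    br F k2 i2 k1 i1 = [:: (y, t)] -> cen F k1 i1 k2 i2 = 0 -> cen F k2 i2 k1 i1 = 0 ->
    x = - y -> brv k1 i1 k2 i2 u = - brv k2 i2 k1 i1 u.
  move=> E1 E2 C1 C2 xy; rewrite /brv E1 E2 C1 C2 !big_seq1 (rmorph0 phi) mul0r scale0r !addr0.
  by rewrite /= xy rmorphN scaleNr.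
case: k; case: k'.
- exact: EHH.
- exact: EHP.
- exact: EHM.
- apply: (flip KL KH) => [i1 i2 u|i1 i2 u]; first exact: ELH.
  rewrite expr0 scale1r; apply: (single _ _ _ _ i1%:~R (- i1%:~R) (KH, i1 + i2 - 1)) => //=.
    by rewrite (addrC i2).
  by rewrite opprK.
- apply: (flip KH KP) => [i1 i2 u|i1 i2 u]; first exact: EHP.
  rewrite expr0 scale1r; apply: (single _ _ _ _ (-1) 1 (KP, i1 + i2)) => //=.
  by rewrite (addrC i2).
- by apply: E0 => // i; have [] := GG i.
- exact: EPM.
- apply: (flip KL KP) => [i1 i2 u|i1 i2 u]; first exact: ELG.
  rewrite expr0 scale1r.
  apply: (single _ _ _ _ (i1%:~R - i2%:~R / 2%:R) (i2%:~R / 2%:R - i1%:~R) (KP, i1 + i2 - 1)) => //=.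
    by rewrite (addrC i2).
  by rewrite opprB.
- apply: (flip KH KM) => [i1 i2 u|i1 i2 u]; first exact: EHM.
  rewrite expr0 scale1r; apply: (single _ _ _ _ 1 (-1) (KM, i1 + i2)) => //=.
    by rewrite (addrC i2).
  by rewrite opprK.
- apply: (flip KP KM) => [i1 i2 u|i1 i2 u]; first exact: EPM.
  by rewrite expr1 scaleN1r opprK /brv /= (addrC i2 i1).
- by apply: E0 => // i; have [] := GG i.
- apply: (flip KL KM) => [i1 i2 u|i1 i2 u]; first exact: ELG.
  rewrite expr0 scale1r.
  apply: (single _ _ _ _ (i1%:~R - i2%:~R / 2%:R) (i2%:~R / 2%:R - i1%:~R) (KM, i1 + i2 - 1)) => //=.
    by rewrite (addrC i2).
  by rewrite opprB.
- exact: ELH.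
- exact: ELG.
- exact: ELG.
- exact: ELL.
Qed.

Let modeZ k n x a : mode k n (x *: a) = x *: mode k n a.
Proof. exact: nprodZr. Qed.
Let modeD k n a b : mode k n (a + b) = mode k n a + mode k n b.
Proof. exact: nprodDr. Qed.
Let mode0 k n : mode k n 0 = 0.
Proof. exact: nprodr0. Qed.
Let modeBZ k n a x b : mode k n (a - x *: b) = mode k n a - x *: mode k n b.
Proof. by rewrite /mode nprodBr nprodZr. Qed.

Let phi_half : phi (1 / 2%:R) = phi 2%:R^-1.
Proof. by rewrite mul1r. Qed.

Lemma L2L0 v : mode KL 2 (mode KL 0 v) = mode KL 0 (mode KL 2 v) + phi 2%:R *: mode KL 1 v.
Proof.
rewrite mode_comm expr0 scale1r /brv big_seq1; congr (_ + _).
by rewrite /= mul0r rmorph0 mul0r scale0r addr0.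
Qed.

Lemma L1L0 v : mode KL 1 (mode KL 0 v) = mode KL 0 (mode KL 1 v) + mode KL 0 v.
Proof.
rewrite mode_comm expr0 scale1r /brv big_seq1; congr (_ + _).
by rewrite /= rmorph0 mul0r scale0r addr0 rmorph1 scale1r.
Qed.

Lemma L2G0 k v : kodd k -> mode KL 2 (mode k 0 v) = mode k 0 (mode KL 2 v) + mode k 1 v.
Proof.
move=> ok; rewrite mode_comm andFb expr0 scale1r /brv; congr (_ + _).
by case: k ok => // _; rewrite big_seq1 /= (rmorph0 phi) mul0r scale0r addr0 subr0 mulfV ?pnatr_eq0 // rmorph1 scale1r.
Qed.

Lemma L1G0 k v : kodd k ->
  mode KL 1 (mode k 0 v) = mode k 0 (mode KL 1 v) + phi 2%:R^-1 *: mode k 0 v.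
Proof.
move=> ok; rewrite mode_comm andFb expr0 scale1r /brv; congr (_ + _).
by case: k ok => // _; rewrite big_seq1 /= (rmorph0 phi) mul0r scale0r addr0 subr0 mul1r.
Qed.

Lemma G1L0 k v : kodd k -> mode k 1 (mode KL 0 v) = mode KL 0 (mode k 1 v) + mode k 0 v.
Proof.
move=> ok; rewrite mode_comm andbF expr0 scale1r /brv; congr (_ + _).
by case: k ok => // _; rewrite big_seq1 /= (rmorph0 phi) !mul0r scale0r addr0 subr0 rmorph1 scale1r.
Qed.

Lemma H0G0 k v : kodd k ->
  mode KH 0 (mode k 0 v) = mode k 0 (mode KH 0 v) + phi (kcharge k)%:~R *: mode k 0 v.
Proof.
move=> ok; rewrite mode_comm andFb expr0 scale1r /brv; congr (_ + _).
by case: k ok => // _; rewrite big_seq1 /= (rmorph0 phi) mul0r scale0r addr0.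
Qed.

Lemma G1G0_same k v : kodd k -> mode k 1 (mode k 0 v) = - mode k 0 (mode k 1 v).
Proof.
move=> ok; rewrite mode_comm andbb ok expr1 scaleN1r /brv.
by case: k ok => // _; rewrite big_nil /= (rmorph0 phi) mul0r scale0r !addr0.
Qed.

Lemma G1G0_dual k v : kodd k -> mode (kdual k) 1 (mode k 0 v) =
  - mode k 0 (mode (kdual k) 1 v) + (mode KL 1 v - phi ((kcharge k)%:~R / 2%:R) *: mode KH 0 v).
Proof.
move=> ok; rewrite mode_comm.
have -> : kodd (kdual k) && kodd k by case: k ok.
rewrite expr1 scaleN1r /brv; congr (_ + _).
by case: k ok => // _; rewrite big_cons big_seq1 /= mulr0z mul0r (rmorph0 phi) mul0r scale0r addr0 rmorph1 scale1r -scaleNr -rmorphN; congr (_ + phi _ *: _); rewrite -mulNr -mulrNz.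
Qed.

Lemma iter_modeZ k n j x v : iter j (mode k n) (x *: v) = x *: iter j (mode k n) v.
Proof. by elim: j => //= j ->; rewrite modeZ. Qed.

Lemma iter_mode_lin k n j x v v' : iter j (mode k n) (x *: v + v') =
  x *: iter j (mode k n) v + iter j (mode k n) v'.
Proof. by elim: j => //= j ->; rewrite mode_linear. Qed.

(** * The action of sl_2, spanned by L_(0), L_(1), L_(2), on a quasi-primary vector *)

Section QuasiPrimary.
Variables (a : F) (x : V).
Hypothesis L1x : mode KL 1 x = phi a *: x.
Hypothesis L2x : mode KL 2 x = 0.

Let L0n n := iter n (mode KL 0) x.

Lemma L1_iter n : mode KL 1 (L0n n) = phi (a + n%:R) *: L0n n.
Proof.
elim: n => [|n IH]; first by rewrite addr0.
by rewrite /L0n iterS L1L0 IH modeZ -[X in _ + X]scale1r -(rmorph1 phi) -scalerDl -rmorphD -addrA -mulrSr.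
Qed.

(** The standard sl_2 string: the factor is the sum of the increments 2(a + i) for i from 0 to n. *)
Lemma L2_iter n : mode KL 2 (L0n n.+1) = phi (n.+1%:R * (2%:R * a + n%:R)) *: L0n n.
Proof.
elim: n => [|n IH].
  by rewrite /L0n /= L2L0 L2x mode0 add0r L1x scalerA -rmorphM addr0 mul1r.
rewrite {1}/L0n iterS -/(L0n n.+1) L2L0 IH modeZ L1_iter -[mode KL 0 (L0n n)]/(L0n n.+1).
rewrite scalerA -scalerDl -rmorphM -rmorphD.
congr (phi _ *: _); rewrite !mulrSr; ring.
Qed.

Lemma L2_iter_diag j : iter j (mode KL 2) (L0n j) =
  phi (\prod_(i < j) (i.+1%:R * (2%:R * a + i%:R))) *: x.
Proof.
elim: j => [|j IH]; first by rewrite big_ord0 rmorph1 scale1r.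
by rewrite iterSr L2_iter iter_modeZ IH scalerA -rmorphM big_ord_recr mulrC.
Qed.

Lemma L2_iter_vanish j : iter j.+1 (mode KL 2) (L0n j) = 0.
Proof. by rewrite iterS L2_iter_diag modeZ L2x scaler0. Qed.

End QuasiPrimary.

(** * Asymptotics in [c] of operators on primary vectors *)

Section HighestWeight.
Variables h q : F.

(* The coefficients that remain bounded when c goes to infinity are the       *)
(* polynomials in 1/c; [f.[0]] is the limit.                                  *)
Definition fe (f : {poly F}) : A := (map_poly phi f).[c^-1].

Lemma feD f g : fe (f + g) = fe f + fe g.
Proof. by rewrite /fe rmorphD hornerD. Qed.
Lemma feM f g : fe (f * g) = fe f * fe g.
Proof. by rewrite /fe rmorphM hornerM. Qed.
Lemma feC z : fe z%:P = phi z.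
Proof. by rewrite /fe map_polyC hornerC. Qed.
Lemma feX : fe 'X = c^-1.
Proof. by rewrite /fe map_polyX hornerX. Qed.

Lemma poly_root0 (f : {poly F}) : f.[0] = 0 -> exists g, f = 'X * g.
Proof.
move=> /eqP f0; have /factor_theorem[g ->] : root f 0 by [].
by exists g; rewrite subr0 mulrC.
Qed.

Definition prim p := N2_primary H Gp Gm L (phi h) (phi q) p.

Definition wop (w : seq nletter) (p : V) : V :=
  foldr (fun x v => mode x.1 (- x.2%:Z) v) p w.

(** On primary vectors [g] is a combination of creation words, bounded in [c], in which only words
    with fewer than [b] big letters survive as [c] tends to infinity. With [b = 0] the limit is
    zero. The same list [Phi] serves every primary vector of weight [h] and charge [q]. *)
Definition fam (b : nat) (l ch : int) (g : V -> V) : Prop :=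
  exists Phi : seq ({poly F} * seq nletter),
    (forall x, x \in Phi -> [/\ all nvalid x.2, lev x.2 = l, chg x.2 = ch &
       (bigs x.2 < b)%N \/ x.1.[0] = 0]) /\
    forall p, prim p -> g p = \sum_(x <- Phi) fe x.1 *: wop x.2 p.

Implicit Types (g : V -> V) (w : seq nletter).

Lemma fam_ext b l ch g g' : (forall p, prim p -> g p = g' p) -> fam b l ch g -> fam b l ch g'.
Proof. by move=> E [Phi [P1 P2]]; exists Phi; split=> // p pp; rewrite -E // P2. Qed.

Lemma fam_zero b l ch : fam b l ch (fun _ => 0).
Proof. by exists [::]; split=> // p _; rewrite big_nil. Qed.

Lemma fam_add b l ch g g' : fam b l ch g -> fam b l ch g' -> fam b l ch (fun p => g p + g' p).
Proof.
move=> [P [P1 P2]] [Q [Q1 Q2]]; exists (P ++ Q); split=> [x|p pp].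
  by rewrite mem_cat => /orP[/P1|/Q1].
by rewrite big_cat P2 // Q2.
Qed.

Lemma fam_scale b l ch f g : fam b l ch g -> fam b l ch (fun p => fe f *: g p).
Proof.
move=> [P [P1 P2]]; exists [seq (f * x.1, x.2) | x <- P]; split=> [x|p pp].
  move=> /mapP[y /P1[? ? ? b0] ->]; split=> //=.
  by case: b0 => [|y0]; [left | right; rewrite hornerM y0 mulr0].
by rewrite big_map P2 // scaler_sumr; apply: eq_bigr => x _; rewrite scalerA feM.
Qed.

Lemma fam_phi b l ch z g : fam b l ch g -> fam b l ch (fun p => phi z *: g p).
Proof. by rewrite -feC; apply: fam_scale. Qed.

Lemma fam_eps b b' l ch g : fam b l ch g -> fam b' l ch (fun p => c^-1 *: g p).
Proof.
move=> [P [P1 P2]]; exists [seq ('X * x.1, x.2) | x <- P]; split=> [x|p pp].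
  move=> /mapP[y /P1[? ? ? b0] ->]; split=> //=.
  by right; rewrite hornerM hornerX mul0r.
by rewrite big_map P2 // scaler_sumr; apply: eq_bigr => x _; rewrite scalerA feM feX.
Qed.

Lemma fam_mono b b' l ch g : (b <= b')%N -> fam b l ch g -> fam b' l ch g.
Proof.
move=> bb' [P [P1 P2]]; exists P; split=> // x /P1[? ? ? b0]; split=> //.
by case: b0 => [b0|]; [left; apply: leq_trans bb' | right].
Qed.

Lemma fam_word b w : all nvalid w -> (bigs w < b)%N -> fam b (lev w) (chg w) (wop w).
Proof.
move=> vw bw; exists [:: (1, w)]; split=> [x|p pp].
  by rewrite inE => /eqP ->; split=> //; left.
by rewrite big_seq1 -polyC1 feC rmorph1 scale1r.
Qed.

Lemma fam_sum b l ch (I : eqType) (r : seq I) (G : I -> V -> V) :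
  (forall i, i \in r -> fam b l ch (G i)) -> fam b l ch (fun p => \sum_(i <- r) G i p).
Proof.
elim: r => [|i r IH] Gf.
  by apply: fam_ext (fam_zero _ _ _) => p _; rewrite big_nil.
apply: (@fam_ext _ _ _ (fun p => G i p + \sum_(j <- r) G j p)) => [p _|].
  by rewrite big_cons.
apply: fam_add; first by apply: Gf; rewrite inE eqxx.
by apply: IH => j jr; apply: Gf; rewrite inE jr orbT.
Qed.

(** A coefficient whose limit is zero is divisible by the variable, and so supplies a factor 1/c. On
    words with too many big letters it is thus enough to control [T] divided by [c]. *)
Lemma fam_bind b l ch b' l' ch' g (T : V -> V) :
    (forall x a a', T (x *: a + a') = x *: T a + T a') ->
    (forall w, all nvalid w -> lev w = l -> chg w = ch ->
       ((bigs w < b)%N -> fam b' l' ch' (fun p => T (wop w p))) /\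
       fam b' l' ch' (fun p => c^-1 *: T (wop w p))) ->
  fam b l ch g -> fam b' l' ch' (fun p => T (g p)).
Proof.
move=> Tlin Tw [Phi [P1 P2]].
have T0 : T 0 = 0 by have := Tlin (-1) 0 0; rewrite scaler0 addr0 scaleN1r addNr.
apply: (@fam_ext _ _ _ (fun p => \sum_(x <- Phi) T (fe x.1 *: wop x.2 p))).
  move=> p pp; rewrite P2 //; elim: (Phi) => [|x s IH]; first by rewrite !big_nil T0.
  by rewrite !big_cons Tlin -IH; have := Tlin (fe x.1) (wop x.2 p) 0; rewrite T0 !addr0 => ->.
apply: fam_sum => x /P1[vw lw cw b0]; have [T1 T2] := Tw _ vw lw cw.
apply: (@fam_ext _ _ _ (fun p => fe x.1 *: T (wop x.2 p))).
  by move=> p _; have := Tlin (fe x.1) (wop x.2 p) 0; rewrite T0 !addr0 => ->.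
case: b0 => [b0|/poly_root0[f ->]]; first exact/fam_scale/T1.
apply: (@fam_ext _ _ _ (fun p => fe f *: (c^-1 *: T (wop x.2 p)))).
  by move=> p _; rewrite scalerA feM feX mulrC.
exact: fam_scale.
Qed.

Lemma fam_cons b l ch x g : nvalid x -> fam b l ch g ->
  fam (if b == 0 then 0 else b + (0 < x.2))%N (lvl x.1 (- x.2%:Z) + l) (kcharge x.1 + ch)
    (fun p => mode x.1 (- x.2%:Z) (g p)).
Proof.
move=> vx; apply: fam_bind => [y a a'|w vw <- <-]; first exact: mode_linear.
have vxw : all nvalid (x :: w) by rewrite /= vx.
rewrite -lev_cons -chg_cons; split=> [bw|].
  apply: (@fam_ext _ _ _ (wop (x :: w))) => //; apply: fam_word => //.
  by case: b bw => // b bw /=; lia.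
by apply: (fam_eps _ (g := wop (x :: w))); apply: (fam_word (b := (bigs (x :: w)).+1)).
Qed.

(** Outside the wedge, a commutator can produce a factor [c]; this rescaling compensates for it. *)
Definition hat k n : A := if wedge k n then 1 else c^-1.

Lemma prim_nonneg k (n : nat) : fam (wedge k n) (lvl k n%:Z) (kcharge k) (mode k n%:Z).
Proof.
have zero : (forall p, prim p -> mode k n%:Z p = 0) ->
    fam (wedge k n) (lvl k n%:Z) (kcharge k) (mode k n%:Z).
  by move=> E; apply: fam_ext (fam_zero _ _ _) => p /E.
have [posn|] := boolP ((if k is KL then 1 else 0) < n)%N.
  apply: zero => p [_ _ P]; case: n posn => // n; case: k => /= np.
  - by have [_ E _ _] := P n.+1 isT; apply: E.
  - by have [_ _ E _] := P n.+1 isT; apply: E.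
  - by have [_ _ _ E] := P n.+1 isT; apply: E.
  - by case: n np => // n _; have [E _ _ _] := P n.+1 isT; apply: E.
rewrite -leqNgt => np.
have [[kH n0]|[[kL n1]|[n0 kH]]] : (k = KH /\ n = 0%N) \/ (k = KL /\ n = 1%N) \/
    (n = 0%N /\ k != KH).
  by case: k np {zero} => /= np; [left | right; right | right; right |
    case: n np => [|[|//]] np; [right; right | right; left]]; split=> //; lia.
- rewrite kH n0 /=; apply: (@fam_ext _ _ _ (fun p => phi q *: wop [::] p)).
    by move=> p [_ E _]; rewrite /= -E.
  apply: fam_phi; have := @fam_word 1 [::] isT isT.
  by rewrite lev_nil chg_nil.
- rewrite kL n1 /=; apply: (@fam_ext _ _ _ (fun p => phi h *: wop [::] p)).
    by move=> p [E _ _]; rewrite /= -E.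
  apply: fam_phi; have := @fam_word 1 [::] isT isT.
  by rewrite lev_nil chg_nil.
- have v : all nvalid [:: (k, 0%N)] by rewrite /= /nvalid (negPf kH).
  have := @fam_word 1 [:: (k, 0%N)] v isT.
  rewrite lev_cons chg_cons lev_nil chg_nil !addr0 /= oppr0 n0.
  by have -> : wedge k 0 by case: (k).
Qed.

(* The commutator with the first letter, up to its central term: in the limit *)
(* it only produces words with fewer big letters.                             *)
Lemma bracket_noncentral k (n : nat) x w : nvalid x -> all nvalid w ->
    (forall k' n', fam (bigs w + wedge k' n') (lev w + lvl k' n'%:Z) (chg w + kcharge k')
       (fun p => hat k' n' *: mode k' n'%:Z (wop w p))) ->
  fam (if wedge k n then (bigs (x :: w)).+1 else bigs w) (lev (x :: w) + lvl k n%:Z)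
    (chg (x :: w) + kcharge k)
    (fun p => hat k n *: \sum_(t <- br F k n%:Z x.1 (- x.2%:Z))
       phi t.1 *: mode t.2.1 t.2.2 (wop w p)).
Proof.
move=> vx vw IH.
apply: (@fam_ext _ _ _ (fun p => \sum_(t <- br F k n%:Z x.1 (- x.2%:Z))
   phi t.1 *: (hat k n *: mode t.2.1 t.2.2 (wop w p)))).
  move=> p _; rewrite scaler_sumr; apply: eq_bigr => t _.
  by rewrite !scalerA mulrC.
apply: fam_sum => t tb; have [lt ct] := br_lvl tb.
have [t0|tn0] := eqVneq t.1 0.
  by apply: fam_ext (fam_zero _ _ _) => p _; rewrite t0 rmorph0 scale0r.
apply: fam_phi.
have -> : lev (x :: w) + lvl k n%:Z = lev w + lvl t.2.1 t.2.2.
  by rewrite lev_cons lt; ring.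
have -> : chg (x :: w) + kcharge k = chg w + kcharge t.2.1.
  by rewrite chg_cons ct; ring.
have tw : wedge k n -> (t.2.2 < 0 -> (0 < x.2)%N) /\ (forall j : nat, t.2.2 = j%:Z -> wedge t.2.1 j).
  move=> wn; case: x vx tb {lt ct} => k' i vx tb.
  by have [t0|//] := br_wedge vx wn tb; rewrite t0 eqxx in tn0.
case: t => z [k' [j|j]] /= in tb lt ct tn0 tw *.
  have IHj := IH k' j; rewrite /hat in IHj *.
  have [wn|nwn] := boolP (wedge k n).
    have [_ /(_ j erefl) wj] := tw wn; rewrite wj in IHj.
    by apply: fam_mono IHj; rewrite /=; lia.
  have [wj|nwj] := boolP (wedge k' j).
    rewrite wj in IHj; apply: fam_ext (fam_eps _ IHj) => p _.
    by rewrite scale1r.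
  by rewrite (negPf nwj) addn0 in IHj.
have vj : all nvalid ((k', j.+1) :: w) by rewrite /= vw /nvalid andbF.
have := fam_word vj (ltnSn _).
rewrite lev_cons chg_cons /= [_ + lev w]addrC [_ + chg w]addrC => fj.
rewrite /hat; have [wn|nwn] := boolP (wedge k n).
  have [/(_ isT) x0 _] := tw wn.
  by apply: fam_ext (fam_mono _ fj) => [p _|]; [rewrite scale1r | rewrite /= x0].
exact: fam_eps fj.
Qed.

(** The mode is moved through the word. A wedge mode meets no central term and does not increase the
    number of big letters. Any other mode carries 1/c, which kills the noncentral terms in the limit
    and cancels the [c] of the central term; in the latter one big letter has been removed. Either
    way, a rescaled mode outside the wedge lowers the count. *)
Lemma hat_word k (n : nat) w : all nvalid w ->
  fam (bigs w + wedge k n) (lev w + lvl k n%:Z) (chg w + kcharge k)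
    (fun p => hat k n *: mode k n%:Z (wop w p)).
Proof.
elim: w k n => [|x w IH] k n.
  move=> _; rewrite lev_nil chg_nil !add0r; have := prim_nonneg k n.
  rewrite /hat; case: wedge => f; first by apply: fam_ext f => p _; rewrite scale1r.
  exact: fam_eps f.
move=> /= /andP[vx vw]; have {}IH k' n' := IH k' n' vw.
apply: (@fam_ext _ _ _ (fun p =>
  (-1) ^+ (kodd k && kodd x.1) *: mode x.1 (- x.2%:Z) (hat k n *: mode k n%:Z (wop w p)) +
  (hat k n *: (\sum_(t <- br F k n%:Z x.1 (- x.2%:Z)) phi t.1 *: mode t.2.1 t.2.2 (wop w p)) +
  (hat k n * c * phi (cen F k n%:Z x.1 (- x.2%:Z))) *: wop w p))).
  move=> p _; rewrite /= [in RHS]mode_comm [in LHS]modeZ /brv !scalerDr !scalerA.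
  by congr (_ *: _ + (_ + _ *: _)); ring.
apply: fam_add; last apply: fam_add.
- have -> : (-1) ^+ (kodd k && kodd x.1) = phi ((-1) ^+ (kodd k && kodd x.1)).
    by rewrite rmorphXn rmorphN1.
  apply: fam_phi; have := fam_cons vx (IH k n).
  rewrite lev_cons chg_cons !addrA; apply: fam_mono.
  by rewrite /=; case: eqP; lia.
- apply: fam_mono (bracket_noncentral k n vx vw IH).
  by rewrite /=; case: wedge; lia.
- have [c0|cn0] := eqVneq (cen F k n%:Z x.1 (- x.2%:Z)) 0.
    by apply: fam_ext (fam_zero _ _ _) => p _; rewrite c0 rmorph0 mulr0 scale0r.
  case: x vx {IH} cn0 => k' i vx cn0; rewrite /hat.
  have [wn|nwn] := boolP (wedge k n); first by rewrite cen_wedge // eqxx in cn0.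
  (* The central term: 1/c times [c] is 1, and the big letter that was met has disappeared. *)
  rewrite mulVr // mul1r; apply: fam_phi.
  have [l0 c0] := cen_lvl cn0; rewrite lev_cons chg_cons /=.
  have i0 := cen_big vx nwn cn0.
  have -> : lvl k' (- i%:Z) + lev w + lvl k n%:Z = lev w by rewrite -[RHS]addr0 -l0; ring.
  have -> : kcharge k' + chg w + kcharge k = chg w by rewrite -[RHS]addr0 -c0; ring.
  by apply: fam_word => //; rewrite i0; lia.
Qed.

Lemma hat_fam k (n : nat) b l ch g : fam b l ch g ->
  fam (b - ~~ wedge k n) (l + lvl k n%:Z) (ch + kcharge k)
    (fun p => hat k n *: mode k n%:Z (g p)).
Proof.
apply: (fam_bind (T := fun v => hat k n *: mode k n%:Z v)) => [x a a'|w vw <- <-].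
  by rewrite mode_linear scalerDr !scalerA mulrC.
have fw := hat_word k n vw; split=> [bw|]; last exact: fam_eps fw.
by apply: fam_mono fw; case: wedge; lia.
Qed.

Lemma fam_eq b l ch l' ch' g : l = l' -> ch = ch' -> fam b l ch g -> fam b l' ch' g.
Proof. by move=> -> ->. Qed.

Definition dop x v := mode (dmode x).1 (dmode x).2%:Z v.

Lemma dopZ x a v : dop x (a *: v) = a *: dop x v. Proof. exact: modeZ. Qed.
Lemma dopD x v v' : dop x (v + v') = dop x v + dop x v'. Proof. exact: modeD. Qed.

Lemma hat_dmode x : isbig x -> hat (dmode x).1 (dmode x).2 = c^-1.
Proof. by move=> /dmode_big; rewrite /hat => /negPf ->. Qed.

Lemma dop_fam x b l ch g : isbig x -> fam b l ch g ->
  fam b.-1 (l - lvl x.1 (- x.2%:Z)) (ch - kcharge x.1) (fun p => c^-1 *: dop x (g p)).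
Proof.
move=> bx /(hat_fam (dmode x).1 (dmode x).2); rewrite (hat_dmode bx) (dmode_big bx) subn1.
by have [-> ->] := dmode_lvl x.
Qed.

Definition ccen (x y : nletter) : F := cen F (dmode x).1 (dmode x).2%:Z y.1 (- y.2%:Z).
Definition csgn (x y : nletter) : F := (-1) ^+ (kodd x.1 && kodd y.1).

(** A Leibniz rule: modulo terms with fewer big letters in the limit, the rescaled dual mode of [x]
    acts on words as a superderivation whose value on the letter [y] is the constant [ccen x y]. *)
Lemma dop_cons x y w : isbig x -> nvalid y -> all nvalid w ->
  fam (bigs w) (lev (y :: w) - lvl x.1 (- x.2%:Z)) (chg (y :: w) - kcharge x.1)
    (fun p => c^-1 *: dop x (wop (y :: w) p) -
      (phi (csgn x y) *: mode y.1 (- y.2%:Z) (c^-1 *: dop x (wop w p)) +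
       phi (ccen x y) *: wop w p)).
Proof.
move=> bx vy vw; have [dl dc] := dmode_lvl x.
have := bracket_noncentral (dmode x).1 (dmode x).2 vy vw (fun k n => hat_word k n vw).
rewrite (negPf (dmode_big bx)) dl dc; apply: fam_ext => p _.
rewrite (hat_dmode bx) /dop /= mode_comm /brv !scalerDr !scalerA modeZ.
have -> : kodd (dmode x).1 = kodd x.1 by rewrite /dmode /=; case: (x.1).
have -> : phi (csgn x y) = (-1) ^+ (kodd x.1 && kodd y.1) by rewrite /csgn rmorphXn rmorphN1.
have -> : c^-1 * (phi (cen F (dmode x).1 (dmode x).2 y.1 (- y.2%:Z)) * c) = phi (ccen x y).
  by rewrite mulrCA mulVr // mulr1.
by rewrite [in RHS]scalerA [(-1) ^+ _ * c^-1]mulrC [_ *: _ + (_ + _)]addrCA addrK.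
Qed.

(** * Leading terms: dual modes act as derivatives with respect to big letters *)

Section Leading.
Variable s : seq nletter.
Hypothesis vs : all nvalid s.
Hypothesis small : bigs s = 0%N.

Let vbs b : all isbig b -> all nvalid (b ++ s).
Proof. by move=> bb; rewrite all_cat vs andbT; apply: sub_all bb => x; apply: nvalid_big. Qed.

Let bbs b : all isbig b -> bigs (b ++ s) = size b.
Proof. by move=> /bigs_all; rewrite bigs_cat small addn0. Qed.

Lemma dop_notin x b : isbig x -> all isbig b -> x \notin b ->
  fam (size b).-1 (lev (b ++ s) - lvl x.1 (- x.2%:Z)) (chg (b ++ s) - kcharge x.1)
    (fun p => c^-1 *: dop x (wop (b ++ s) p)).
Proof.
move=> bx; elim: b => [|y b IH] /=.
  move=> _ _; apply: (@dop_fam x 1); first by [].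
  by apply: fam_word => //; rewrite small.
move=> /andP[yb bb]; rewrite inE negb_or => /andP[xy xb].
apply: (fam_ext (g := fun p =>
  (c^-1 *: dop x (wop (y :: b ++ s) p) -
      (phi (csgn x y) *: mode y.1 (- y.2%:Z) (c^-1 *: dop x (wop (b ++ s) p)) +
       phi (ccen x y) *: wop (b ++ s) p)) +
  phi (csgn x y) *: mode y.1 (- y.2%:Z) (c^-1 *: dop x (wop (b ++ s) p)))).
  move=> p _; rewrite /ccen (cen_dmode_neq _ _ xy) // rmorph0 scale0r addr0.
  by rewrite subrK.
apply: fam_add; first by have := dop_cons bx (nvalid_big yb) (vbs bb); rewrite bbs.
apply: fam_phi.
have := fam_cons (nvalid_big yb) (IH bb xb).
rewrite lev_cons chg_cons !addrA => fc; apply: fam_mono fc.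
by case: eqP; rewrite /isbig in yb; lia.
Qed.

(** In a sorted word bounded below by [x], the copies of [x] form an initial block. The derivative
    with respect to [x] therefore removes the head, with the length of the block as a factor. *)
Lemma dop_even x b : isbig x -> all isbig b -> ~~ kodd x.1 -> path brel x b ->
  fam (size b).-1 (lev (b ++ s) - lvl x.1 (- x.2%:Z)) (chg (b ++ s) - kcharge x.1)
    (fun p => c^-1 *: dop x (wop (b ++ s) p) -
      phi (ccen x x * (count_mem x b)%:R) *: wop (behead b ++ s) p).
Proof.
move=> bx + ex; elim: b => [|y b IH] bb pb.
  apply: (fam_ext _ (dop_notin bx bb _)) => // p _.
  by rewrite mulr0 rmorph0 scale0r subr0.
have [yx|yx] := eqVneq y x; last first.
  have xb : x \notin y :: b by apply: notin_path pb _.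
  apply: (fam_ext _ (dop_notin bx bb xb)) => p _.
  by rewrite (count_memPn xb) mulr0 rmorph0 scale0r subr0.
move: bb pb; rewrite yx /= eqxx => /andP[_ bb] /andP[_ pb].
apply: (fam_ext (g := fun p =>
  (c^-1 *: dop x (wop (x :: b ++ s) p) -
      (phi (csgn x x) *: mode x.1 (- x.2%:Z) (c^-1 *: dop x (wop (b ++ s) p)) +
       phi (ccen x x) *: wop (b ++ s) p)) +
  mode x.1 (- x.2%:Z) (c^-1 *: dop x (wop (b ++ s) p) -
     phi (ccen x x * (count_mem x b)%:R) *: wop (behead b ++ s) p))).
  move=> p _; rewrite /csgn (negPf ex) /= rmorph1 scale1r.
  have -> : phi (ccen x x * (1 + count_mem x b)%:R) *: wop (b ++ s) p =
     phi (ccen x x) *: wop (b ++ s) p + mode x.1 (- x.2%:Z)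
       (phi (ccen x x * (count_mem x b)%:R) *: wop (behead b ++ s) p).
    rewrite natrD mulrDr mulr1 rmorphD scalerDl modeZ; congr (_ + _).
    have [->|b0] := posnP (count_mem x b); first by rewrite mulr0 rmorph0 !scale0r.
    congr (_ *: _); case: b pb b0 {IH bb} => //= z b /andP[xz zb].
    have [-> //|zx] := eqVneq z x.
    have /negP : x \notin z :: b by apply: notin_path; rewrite //= xz.
    by rewrite -has_pred1 has_count /= (negPf zx) add0n.
  by rewrite /mode nprodBr sub_cancel.
apply: fam_add; first by have := dop_cons bx (nvalid_big bx) (vbs bb); rewrite bbs.
have := fam_cons (nvalid_big bx) (IH bb pb).
rewrite lev_cons chg_cons !addrA => fc; apply: fam_mono fc.
by case: eqP; rewrite /isbig in bx; lia.
Qed.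

Lemma dop_head x b : isbig x -> all isbig b -> path brel x b ->
  fam (size b) (lev (b ++ s)) (chg (b ++ s))
    (fun p => c^-1 *: dop x (wop (x :: b ++ s) p) -
      phi (ccen x x * (count_mem x (x :: b))%:R) *: wop (b ++ s) p).
Proof.
move=> bx bb pb; have le : lev (b ++ s) = lev (x :: b ++ s) - lvl x.1 (- x.2%:Z).
  by rewrite lev_cons; ring.
have ce : chg (b ++ s) = chg (x :: b ++ s) - kcharge x.1 by rewrite chg_cons; ring.
have bxb : all isbig (x :: b) by rewrite /= bx.
rewrite le ce; have [ox|ex] := boolP (kodd x.1); last first.
  by have /= := dop_even bx bxb ex _; apply; rewrite pb /brel /strict_rel leqnn (negPf ex).
have xb := odd_notin_path ox pb.
apply: (fam_ext (g := fun p =>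
  (c^-1 *: dop x (wop (x :: b ++ s) p) -
      (phi (csgn x x) *: mode x.1 (- x.2%:Z) (c^-1 *: dop x (wop (b ++ s) p)) +
       phi (ccen x x) *: wop (b ++ s) p)) +
  phi (csgn x x) *: mode x.1 (- x.2%:Z) (c^-1 *: dop x (wop (b ++ s) p)))).
  move=> p _; rewrite /= eqxx (count_memPn xb) mulr1.
  by rewrite -[X in _ + X = _]subr0 sub_cancel addr0.
apply: fam_add; first by have := dop_cons bx (nvalid_big bx) (vbs bb); rewrite bbs.
apply: fam_phi.
have := fam_cons (nvalid_big bx) (dop_notin bx bb xb).
rewrite lev_cons chg_cons !addrA => fc; apply: fam_mono fc.
by case: eqP; rewrite /isbig in bx; lia.
Qed.

Fixpoint Xop (a : seq nletter) v : V := if a is x :: a' then Xop a' (dop x v) else v.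

Lemma XopZ a z v : Xop a (z *: v) = z *: Xop a v.
Proof. by elim: a v => //= x a IH v; rewrite dopZ IH. Qed.
Lemma XopD a v v' : Xop a (v + v') = Xop a v + Xop a v'.
Proof. by elim: a v v' => //= x a IH v v'; rewrite dopD IH. Qed.

Definition sXop (a : seq nletter) v : V := c^-1 ^+ size a *: Xop a v.

Lemma sXopZ a z v : sXop a (z *: v) = z *: sXop a v.
Proof. by rewrite /sXop XopZ !scalerA mulrC. Qed.
Lemma sXopD a v v' : sXop a (v + v') = sXop a v + sXop a v'.
Proof. by rewrite /sXop XopD scalerDr. Qed.
Lemma sXopBZ a v z v' : sXop a (v - z *: v') = sXop a v - z *: sXop a v'.
Proof. by rewrite -scaleNr sXopD sXopZ scaleNr. Qed.
Lemma sXop_cons x a v : sXop (x :: a) v = sXop a (c^-1 *: dop x v).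
Proof. by rewrite /sXop /= XopZ scalerA exprSr. Qed.

Lemma sXop_fam a b l ch g : all isbig a -> fam b l ch g ->
  fam (b - size a) (l - lev a) (ch - chg a) (fun p => sXop a (g p)).
Proof.
elim: a b l ch g => [|x a IH] b l ch g /=.
  rewrite lev_nil chg_nil !subr0 subn0 => _; apply: fam_ext => p _.
  by rewrite /sXop expr0 scale1r.
move=> /andP[bx ba] /(dop_fam bx)/(IH _ _ _ _ ba) f.
apply: (fam_ext (g := fun p => sXop a (c^-1 *: dop x (g p)))) => [p _|].
  by rewrite sXop_cons.
have le : l - lev (x :: a) = l - lvl x.1 (- x.2%:Z) - lev a by rewrite lev_cons; ring.
have ce : ch - chg (x :: a) = ch - kcharge x.1 - chg a by rewrite chg_cons; ring.
rewrite le ce; apply: fam_mono f; lia.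
Qed.

(** The limit of the norm of a sorted word: a product of cocycle values and of the factorials of the
    multiplicities of its letters. *)
Fixpoint multiplicity (a : seq nletter) : F :=
  if a is x :: a' then ccen x x * (count_mem x a)%:R * multiplicity a' else 1.

Lemma multiplicity_neq0 a : all isbig a -> multiplicity a != 0.
Proof.
elim: a => [|x a IH] /=; first by rewrite oner_eq0.
move=> /andP[bx /IH ma]; rewrite !mulf_neq0 ?pnatr_eq0 ?cen_dmode //.
by rewrite eqxx.
Qed.

Lemma sXop_diag a : all isbig a -> sorted brel a ->
  fam 0 (lev s) (chg s) (fun p => sXop a (wop (a ++ s) p) - phi (multiplicity a) *: wop s p).
Proof.
elim: a => [|x a IH] /=.
  move=> _ _; apply: (fam_ext _ (fam_zero _ _ _)) => p _.
  by rewrite /sXop expr0 rmorph1 !scale1r subrr.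
move=> /andP[bx ba] pa; have {}IH := IH ba (path_sorted pa).
have := sXop_fam ba (dop_head bx ba pa); rewrite subnn lev_cat chg_cat.
rewrite -[lev a + _ - _]addrAC -[chg a + _ - _]addrAC !subrr !add0r => f.
apply: (fam_ext (g := fun p =>
  sXop a (c^-1 *: dop x (wop (x :: a ++ s) p) -
    phi (ccen x x * (count_mem x (x :: a))%:R) *: wop (a ++ s) p) +
  phi (ccen x x * (count_mem x (x :: a))%:R) *:
    (sXop a (wop (a ++ s) p) - phi (multiplicity a) *: wop s p))) => [p _|].
  rewrite sXop_cons sXopBZ scalerBr addrA subrK.
  by rewrite (rmorphM phi _ (multiplicity a)) -[in RHS]scalerA.
by apply: fam_add f _; apply: fam_phi.
Qed.

Lemma sXop_small a b : all isbig a -> all isbig b -> (size b < size a)%N ->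
  fam 0 (lev (b ++ s) - lev a) (chg (b ++ s) - chg a) (fun p => sXop a (wop (b ++ s) p)).
Proof.
move=> ba bb ab; have f : fam (size b).+1 (lev (b ++ s)) (chg (b ++ s)) (wop (b ++ s)).
  by apply: fam_word; [apply: vbs | rewrite bbs].
by apply: fam_mono (sXop_fam ba f); rewrite leqn0 subn_eq0.
Qed.

(** Common leading letters are removed by [dop_head]. At the first difference, the letter of [a] is
    smaller than all remaining letters of [b], hence absent from them, and [dop_notin] gives a zero
    limit. *)
Lemma sXop_lex a b : all isbig a -> all isbig b -> sorted brel a -> sorted brel b ->
    size a = size b -> lexlt (map bcode a) (map bcode b) ->
  fam 0 (lev (b ++ s) - lev a) (chg (b ++ s) - chg a) (fun p => sXop a (wop (b ++ s) p)).
Proof.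
elim: a b => [|x a IH] [|y b] //= /andP[bx ba] /andP[yb bb] pa pb [ab].
case/orP => [xy|/andP[/eqP/bcode_inj yx lt]].
  have xb : x \notin y :: b.
    rewrite inE negb_or; apply/andP; split; first by apply: contraTneq xy => ->; rewrite ltnn.
    apply/negP => xb; have /allP/(_ x xb)/brel_le := order_path_min brel_trans pb; lia.
  have ybb : all isbig (y :: b) by rewrite /= yb.
  have := sXop_fam ba (dop_notin bx ybb xb); rewrite /= ab subnn => f.
  apply: (fam_ext (g := fun p => sXop a (c^-1 *: dop x (wop (y :: b ++ s) p)))) => [p _|].
    by rewrite sXop_cons.
  apply: fam_eq f; first by rewrite [lev (x :: a)]lev_cons /=; ring.
  by rewrite [chg (x :: a)]chg_cons /=; ring.
rewrite -yx in pb *.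
have {}IH := IH b ba bb (path_sorted pa) (path_sorted pb) ab lt.
have := sXop_fam ba (dop_head bx bb pb); rewrite ab subnn => f.
apply: (fam_ext (g := fun p =>
  sXop a (c^-1 *: dop x (wop (x :: b ++ s) p) -
    phi (ccen x x * (count_mem x (x :: b))%:R) *: wop (b ++ s) p) +
  phi (ccen x x * (count_mem x (x :: b))%:R) *: sXop a (wop (b ++ s) p))) => [p _|].
  by rewrite sXop_cons sXopBZ subrK.
apply: fam_eq (fam_add f (fam_phi _ IH)).
  by rewrite !lev_cons; ring.
by rewrite !chg_cons; ring.
Qed.

End Leading.

(** * The pairing on the Verma module of the wedge algebra, and the limit matrix *)

Definition kappa : F := (h + q / 2%:R) / (2%:R * h).

(* The vectors paired with the annihilation modes below: [G^+_(0) G^-_(0) p]  *)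
(* is corrected by [kappa] so as to be annihilated by [L_(2)].                *)
Definition svec k p : V := match k with
  | KH => p | KP => mode KP 0 p | KM => mode KM 0 p
  | KL => mode KP 0 (mode KM 0 p) - phi kappa *: mode KL 0 p
  end.

Definition Sop j k v : V := let u := iter j (mode KL 2) v in
  match k with
  | KH => u | KP => mode KM 1 u | KM => mode KP 1 u | KL => mode KP 1 (mode KM 1 u)
  end.

Lemma Sop_lin j k x v v' : Sop j k (x *: v + v') = x *: Sop j k v + Sop j k v'.
Proof. by rewrite /Sop iter_mode_lin; case: k; rewrite ?mode_linear. Qed.

(** These are the factors that occur in [pairing] and in the sl_2 strings of the vectors [svec]. *)
Definition nondeg := [/\ h + q / 2%:R != 0, h - q / 2%:R != 0 &
  forall n : nat, 2%:R * h + n%:R != 0].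

Lemma L1p p : prim p -> mode KL 1 p = phi h *: p. Proof. by case. Qed.
Lemma H0p p : prim p -> mode KH 0 p = phi q *: p. Proof. by case. Qed.
Lemma L2p p : prim p -> mode KL 2 p = 0. Proof. by case=> _ _ /(_ 1%N isT)[]. Qed.
Lemma P1p p : prim p -> mode KP 1 p = 0. Proof. by case=> _ _ /(_ 1%N isT)[]. Qed.
Lemma M1p p : prim p -> mode KM 1 p = 0. Proof. by case=> _ _ /(_ 1%N isT)[]. Qed.
Lemma G1p k p : kodd k -> prim p -> mode k 1 p = 0.
Proof. by case: k => // _; [apply: P1p | apply: M1p]. Qed.

Lemma L1_svec k p : prim p -> mode KL 1 (svec k p) = phi (h + (klev k)%:R / 2%:R) *: svec k p.
Proof.
move=> pp.
have L1G k0 : kodd k0 -> mode KL 1 (mode k0 0 p) = phi (h + 1 / 2%:R) *: mode k0 0 p.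
  by move=> ok; rewrite L1G0 // L1p // modeZ -scalerDl -rmorphD mul1r.
case: k; rewrite /svec /=.
- by rewrite mul0r addr0 L1p.
- exact: L1G.
- exact: L1G.
rewrite mulfV ?pnatr_eq0 // modeBZ L1G0 // L1G // L1L0 L1p // !modeZ.
rewrite scalerBr -!scalerDl -rmorphD; congr (_ - _).
  by congr (phi _ *: _); field.
rewrite -[X in _ *: (_ + X)]scale1r -(rmorph1 phi) -scalerDl -rmorphD.
by rewrite !scalerA mulrC.
Qed.

Lemma L2_svec k p : (k == KL -> h != 0) -> prim p -> mode KL 2 (svec k p) = 0.
Proof.
move=> hk pp; case: k hk => hk; rewrite /svec.
- exact: L2p.
- by rewrite L2G0 // L2p // P1p // mode0 addr0.
- by rewrite L2G0 // L2p // M1p // mode0 addr0.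
have {}hk := hk isT.
rewrite modeBZ L2G0 // L2G0 // L2p // M1p // !mode0 !addr0 mode0 add0r.
rewrite (G1G0_dual (k := KM)) // P1p // mode0 oppr0 add0r L1p // H0p //.
rewrite L2L0 L2p // mode0 add0r L1p // !scalerA -scalerBl -scalerBl.
apply/eqP; rewrite -!rmorphM -!rmorphB; apply/eqP.
(* L_(2) sends G^+_(0) G^-_(0) p to (h + q/2) p and L_(0) p to 2h p; [kappa] is the ratio of the two
   factors. *)
have -> : h - -1 / 2 * q - kappa * (2 * h) = 0.
  by rewrite /kappa; field.
by rewrite rmorph0 scale0r.
Qed.

Definition pairing k : F := match k with
  | KH => 1 | KP => h - q / 2%:R | KM => h + q / 2%:R
  | KL => (h - q / 2%:R + 1 - kappa) * (h + q / 2%:R)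
  end.

Lemma pairing_neq0 k : nondeg -> pairing k != 0.
Proof.
move=> [h1 h2 h3]; have h4 := h3 0%N; have h5 := h3 1%N; rewrite addr0 in h4.
have h0 : h != 0 by apply: contraNneq h4 => ->; rewrite mulr0.
case: k => //=; first by rewrite oner_eq0.
have -> : h - q / 2 + 1 - kappa = (h - q / 2) * (2 * h + 1) / (2 * h).
  by rewrite /kappa; field.
by rewrite !mulf_neq0 ?invr_eq0.
Qed.

Lemma svec_pairing k p : prim p -> Sop 0 k (svec k p) = phi (pairing k) *: p.
Proof.
move=> pp; have pair k0 : kodd k0 ->
    mode (kdual k0) 1 (mode k0 0 p) = phi (h - (kcharge k0)%:~R / 2%:R * q) *: p.
  move=> ok; have ok' : kodd (kdual k0) by case: (k0) ok.
  rewrite G1G0_dual // (G1p ok' pp) mode0 oppr0 add0r L1p // H0p // scalerA.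
  by rewrite -rmorphM -scalerBl -rmorphB.
case: k; rewrite /Sop /svec /=.
- by rewrite rmorph1 scale1r.
- by rewrite -[KM]/(kdual KP) pair //=; congr (phi _ *: _); field.
- by rewrite -[KP]/(kdual KM) pair //=; congr (phi _ *: _); field.
have E : mode KM 1 (mode KP 0 (mode KM 0 p)) =
    phi (h - q / 2%:R + 1) *: mode KM 0 p.
  rewrite (G1G0_dual (k := KP)) // G1G0_same // M1p // !mode0 oppr0 mode0 oppr0 add0r.
  rewrite L1G0 // H0G0 // L1p // H0p // !modeZ -!scalerDl -!rmorphD scalerA -rmorphM.
  by rewrite -scalerBl -rmorphB; congr (phi _ *: _) => /=; field.
rewrite modeBZ E G1L0 // M1p // mode0 add0r -scalerBl modeZ -[KP]/(kdual KM) pair //.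
rewrite scalerA -rmorphB -rmorphM; congr (phi (_ * _) *: _) => /=; by field.
Qed.

Definition Bop b j k p := wop b (iter j (mode KL 0) (svec k p)).
Definition kcoef k : A := if k is KL then phi kappa else 0.

Lemma wop_cat b s p : wop (b ++ s) p = wop b (wop s p).
Proof. exact: foldr_cat. Qed.

Lemma wop_lin b x v v' : wop b (x *: v + v') = x *: wop b v + wop b v'.
Proof. by elim: b => //= y b ->; rewrite mode_linear. Qed.

Lemma wop_nseq j p : wop (nseq j (KL, 0%N)) p = iter j (mode KL 0) p.
Proof. by elim: j => //= j ->. Qed.

Lemma Bop_words b j k p : Bop b j k p =
  wop (b ++ sword j k) p - kcoef k *: wop (b ++ sword j.+1 KH) p.
Proof.
rewrite /Bop /sword !wop_cat !wop_nseq /kcoef.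
case: k; rewrite /= ?scale0r ?subr0 //.
have -> : mode KP 0 (mode KM 0 p) - phi kappa *: mode KL 0 p =
  - phi kappa *: mode KL 0 p + mode KP 0 (mode KM 0 p) by rewrite addrC scaleNr.
by rewrite iter_mode_lin wop_lin -iterSr addrC scaleNr.
Qed.

Lemma fam_comb bb l ch k (g1 g2 : V -> V) :
    fam bb l ch g1 -> (k = KL -> fam bb l ch g2) ->
  fam bb l ch (fun p => g1 p - kcoef k *: g2 p).
Proof.
move=> f1 f2; case: k f2 => f2; rewrite /kcoef;
  try by apply: fam_ext f1 => p _; rewrite scale0r subr0.
have f := fam_add f1 (fam_phi (- kappa) (f2 erefl)).
by apply: fam_ext f => p _; rewrite rmorphN scaleNr.
Qed.

Lemma wedge_fam k (n : nat) b l ch g : wedge k n -> fam b l ch g ->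
  fam b (l + lvl k n%:Z) (ch + kcharge k) (fun p => mode k n%:Z (g p)).
Proof.
move=> wk /(hat_fam k n); rewrite /hat wk subn0; apply: fam_ext => p _.
by rewrite scale1r.
Qed.

Lemma Sop_fam j k b l ch g : fam b l ch g ->
  fam b (l - (j.*2 + klev k)%N%:Z) (ch - kcharge k) (fun p => Sop j k (g p)).
Proof.
move=> f; have {f}f : fam b (l - (j.*2)%:Z) ch (fun p => iter j (mode KL 2) (g p)).
  elim: j => [|j IH]; first by rewrite subr0.
  have f2 := wedge_fam (isT : wedge KL 2) IH.
  apply: fam_ext (fam_eq _ _ f2) => [p _||] //; rewrite /lvl /=; lia.
have fM := wedge_fam (isT : wedge KM 1) f; have fP := wedge_fam (isT : wedge KP 1) f.
have fPM := wedge_fam (isT : wedge KP 1) fM.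
case: k; [move: f | move: fM | move: fP | move: fPM] => {}f;
  apply: fam_ext (fam_eq _ _ f) => [p _||] //; rewrite /lvl /=; lia.
Qed.

Lemma Bop_fam b j k : all isbig b -> fam (size b).+1 (alev b j k) (achg b k) (Bop b j k).
Proof.
move=> bb; have f j' k' : fam (size b).+1 (alev b j' k') (achg b k') (wop (b ++ sword j' k')).
  rewrite /alev /achg -lev_sword -(chg_sword j') -lev_cat -chg_cat.
  apply: fam_word; last by rewrite bigs_cat sword_small addn0 bigs_all.
  by rewrite all_cat sword_valid andbT; apply: sub_all bb => x; apply: nvalid_big.
apply: fam_ext (fam_comb (f j k) (k := k) (g2 := wop (b ++ sword j.+1 KH)) _) => [p _|kE].
  by rewrite Bop_words.
by rewrite kE; apply: fam_eq (f j.+1 KH); rewrite /alev /achg /=; lia.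
Qed.

Definition test a j k v := Sop j k (sXop a v).

Lemma test_fam a j k b l ch g : all isbig a -> fam b l ch g ->
  fam (b - size a) (l - alev a j k) (ch - achg a k) (fun p => test a j k (g p)).
Proof.
move=> ba /(sXop_fam (s := [::]) isT erefl ba)/(Sop_fam j k).
apply: fam_eq; first by rewrite /alev; ring.
by rewrite /achg; ring.
Qed.

Lemma fam_lt0 b l ch g p : l < 0 -> fam b l ch g -> prim p -> g p = 0.
Proof.
move=> l0 [Phi [P1 P2]] pp; rewrite P2 // big_seq big1 // => x /P1[vx lx _ _].
by have := lev_ge0 vx; rewrite lx leNgt l0.
Qed.

Lemma fam_charge b ch g p : ch != 0 -> fam b 0 ch g -> prim p -> g p = 0.
Proof.
move=> c0 [Phi [P1 P2]] pp; rewrite P2 // big_seq big1 // => x /P1[vx lx cx _].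
by move: c0; rewrite -cx (lev_eq0 vx lx) chg_nil eqxx.
Qed.

(** Every valid letter has positive level, so only the empty word occurs at level 0, and the
    operator is multiplication by a polynomial in 1/c. *)
Lemma fam_scalar b g : fam b 0 0 g ->
  exists f : {poly F}, (b = 0%N -> f.[0] = 0) /\ forall p, prim p -> g p = fe f *: p.
Proof.
move=> [Phi [P1 P2]]; exists (\sum_(x <- Phi) x.1); split=> [b0|p pp].
  rewrite horner_sum big_seq big1 // => x /P1[_ _ _ [|//]].
  by rewrite b0.
rewrite P2 // /fe rmorph_sum horner_sum scaler_suml.
rewrite big_seq [RHS]big_seq; apply: eq_bigr => x /P1[vx lx _ _].
by rewrite (lev_eq0 vx lx).
Qed.

Lemma sXop_lin a x v v' : sXop a (x *: v + v') = x *: sXop a v + sXop a v'.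
Proof. by rewrite sXopD sXopZ. Qed.

Lemma sXop_Bop_low a b j k : all isbig a -> all isbig b -> sorted brel a -> sorted brel b ->
    (size b < size a)%N || (size a == size b) && lexlt (map bcode a) (map bcode b) ->
  fam 0 (alev b j k - lev a) (achg b k - chg a) (fun p => sXop a (Bop b j k p)).
Proof.
move=> ba bb sa sb low.
have f j' k' : fam 0 (alev b j' k' - lev a) (achg b k' - chg a)
    (fun p => sXop a (wop (b ++ sword j' k') p)).
  have vs := sword_valid j' k'; have ss := sword_small j' k'.
  rewrite /alev /achg -lev_sword -(chg_sword j') -lev_cat -chg_cat.
  case/orP: low => [lt|/andP[/eqP sz lx]].
    exact: (sXop_small vs ss ba bb lt).
  exact: (sXop_lex vs ss ba bb sa sb sz lx).
apply: fam_ext (fam_comb (f j k) (k := k)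
   (g2 := fun p => sXop a (wop (b ++ sword j.+1 KH) p)) _) => [p _|kE].
  by rewrite Bop_words sXopBZ.
by rewrite kE; apply: fam_eq (f j.+1 KH); rewrite /alev /achg /=; lia.
Qed.

Lemma sXop_Bop_diag a j k : all isbig a -> sorted brel a ->
  fam 0 (j.*2 + klev k)%N%:Z (kcharge k)
    (fun p => sXop a (Bop a j k p) - phi (multiplicity a) *: Bop [::] j k p).
Proof.
move=> ba sa; have f j' k' : fam 0 (j'.*2 + klev k')%N%:Z (kcharge k') (fun p =>
    sXop a (wop (a ++ sword j' k') p) - phi (multiplicity a) *: wop (sword j' k') p).
  rewrite -lev_sword -(chg_sword j').
  by apply: (sXop_diag); rewrite ?sword_valid ?sword_small.
apply: fam_ext (fam_comb (f j k) (k := k) (g2 := fun p =>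
    sXop a (wop (a ++ sword j.+1 KH) p) -
      phi (multiplicity a) *: wop (sword j.+1 KH) p) _) => [p _|kE].
  rewrite !Bop_words sXopBZ !scalerBr !scalerA subr_subACA.
  by rewrite [kcoef k * phi _]mulrC.
by rewrite kE; apply: fam_eq (f j.+1 KH) => /=; lia.
Qed.

Lemma Sop_Bop_diag j k : nondeg \/ (j, k) = (0%N, KH) ->
  exists2 m : F, m != 0 & forall p, prim p -> Sop j k (Bop [::] j k p) = phi m *: p.
Proof.
case=> [nd|[-> ->]]; last by exists 1; rewrite ?oner_eq0 // => p _; rewrite rmorph1 scale1r.
have [h1 h2 h3] := nd; have h0 : h != 0.
  by apply: contraNneq (h3 0%N) => ->; rewrite mulr0 addr0.
exists ((\prod_(i < j) (i.+1%:R * (2%:R * (h + (klev k)%:R / 2%:R) + i%:R))) * pairing k).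
  rewrite mulf_neq0 ?pairing_neq0 //; apply/prodf_neq0 => i _.
  rewrite mulf_neq0 ?pnatr_eq0 //.
  have -> : 2%:R * (h + (klev k)%:R / 2%:R) + i%:R = 2%:R * h + (klev k + i)%:R :> F.
    by rewrite natrD; field.
  exact: h3.
move=> p pp; rewrite rmorphM -scalerA -svec_pairing //.
have E := L2_iter_diag (L1_svec k pp) (L2_svec (fun _ => h0) pp) j.
rewrite /Sop /Bop /= E /Sop /=.
by case: k {E} => //=; rewrite ?modeZ.
Qed.

(* In the limit the matrix of the pairings between the annihilation words     *)
(* [test] and the creation words [Bop] is triangular.                         *)
Lemma entry (x y : seq nletter * (nat * kind)) :
    all isbig x.1 -> all isbig y.1 -> sorted brel x.1 -> sorted brel y.1 ->
    (nondeg \/ x.2 = (0%N, KH) /\ y.2 = (0%N, KH)) ->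
    alev x.1 x.2.1 x.2.2 = alev y.1 y.2.1 y.2.2 -> achg x.1 x.2.2 = achg y.1 y.2.2 ->
  exists f : {poly F}, [/\ forall p, prim p ->
      test x.1 x.2.1 x.2.2 (Bop y.1 y.2.1 y.2.2 p) = fe f *: p,
    x = y -> f.[0] != 0 & before x y -> f.[0] = 0].
Proof.
case: x => a [j k]; case: y => b [j' k'] /= ba bb sa sb nd le ce.
have [[ab jj kk]|ne] := eqVneq (a, (j, k)) (b, (j', k')).
  subst b j' k'; have [m m0 mE] : exists2 m : F, m != 0 &
      forall p, prim p -> Sop j k (Bop [::] j k p) = phi m *: p.
    by apply: Sop_Bop_diag; case: nd => [|[]]; [left | right].
  have /(Sop_fam j k) := sXop_Bop_diag j k ba sa.
  rewrite !subrr => /fam_scalar[f [f0 fE]].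
  exists (f + (multiplicity a * m)%:P); split=> [p pp|_|].
  - rewrite feD feC scalerDl -fE // rmorphM -scalerA -mE //.
    by rewrite /test -[in LHS](subrK (phi (multiplicity a) *: Bop [::] j k p) (sXop a _)) addrC Sop_lin addrC.
  - by rewrite hornerD hornerC f0 // add0r mulf_neq0 // multiplicity_neq0.
  - rewrite /before /= ltnn eqxx /=.
    have -> : lexlt (map bcode a) (map bcode a) = false.
      by elim: (a) => //= z a' ->; rewrite ltnn eqxx.
    by rewrite xpair_eqE; case: eqP => //; lia.
have [bf|nbf] := boolP (before (a, (j, k)) (b, (j', k'))); last first.
  have := test_fam j k ba (Bop_fam j' k' bb); rewrite le ce !subrr => /fam_scalar[f [_ fE]].
  by exists f; split=> // e; rewrite e eqxx in ne.
suff [f [f0 fE]] : exists f : {poly F}, (0%N = 0%N -> f.[0] = 0) /\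
    forall p, prim p -> test a j k (Bop b j' k' p) = fe f *: p.
  by exists f; split=> // [e|_]; [rewrite e eqxx in ne | apply: f0].
apply: fam_scalar; move: bf; rewrite /before /= orbA => /orP[low|].
  apply: fam_eq (Sop_fam j k (sXop_Bop_low j' k' ba bb sa sb low)).
    by move: le; rewrite /alev; lia.
  by move: ce; rewrite /achg; lia.
move=> /and3P[/eqP eab /eqP[jj kk] /eqP kL]; subst b j k k'.
have {nd}[h1 h2 h3] : nondeg by case: nd => // -[].
have h0 : h != 0 by apply: contraNneq (h3 0%N) => ->; rewrite mulr0 addr0.
(* Equal big words cancel in the limit, which leaves L_(2)^(j'+1) applied to L_(0)^j' of a
   quasi-primary vector, hence zero. *)
have /(Sop_fam j'.+1 KH) := sXop_Bop_diag j' KL ba sa.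
have -> : (j'.*2 + klev KL)%N%:Z - (j'.+1.*2 + klev KH)%N%:Z = 0 by rewrite /=; lia.
rewrite subrr; apply: fam_ext => p pp; rewrite /test.
rewrite -[in RHS](subrK (phi (multiplicity a) *: Bop [::] j' KL p) (sXop a _)) [in RHS]addrC [in RHS]Sop_lin.
have -> : Sop j'.+1 KH (Bop [::] j' KL p) = 0; last by rewrite scaler0 add0r.
exact: (L2_iter_vanish (L1_svec KL pp) (L2_svec (fun _ => h0) pp)).
Qed.

End HighestWeight.

Lemma Xop_cat a b v : Xop (a ++ b) v = Xop b (Xop a v).
Proof. by elim: a v => //= x a IH v. Qed.

Lemma Xop_lin a x v v' : Xop a (x *: v + v') = x *: Xop a v + Xop a v'.
Proof. by rewrite XopD XopZ. Qed.

Lemma XopBZ a u z u' : Xop a (u - z *: u') = Xop a u - z *: Xop a u'.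
Proof. by rewrite -scaleNr XopD XopZ scaleNr. Qed.

(* Moving a big annihilation mode to the right of an annihilation mode only   *)
(* creates big annihilation modes.                                            *)
Lemma dop_comm x k (n : nat) v : isbig x -> posmode k n ->
  exists2 e : A, (e = (-1) ^+ (kodd x.1 && kodd k)) &
  lspan (fun u => exists z, [/\ isbig z,
     lvl z.1 (- z.2%:Z) = lvl x.1 (- x.2%:Z) - lvl k n%:Z,
     kcharge z.1 = kcharge x.1 - kcharge k & u = dop z v])
   (dop x (mode k n%:Z v) - e *: mode k n%:Z (dop x v)).
Proof.
move=> bx pk; exists ((-1) ^+ (kodd x.1 && kodd k)) => //.
have nw := dmode_big bx; have [dl dc] := dmode_lvl x.
rewrite /dop mode_comm /brv cen_pos // (rmorph0 phi) mul0r scale0r addr0.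
have -> : kodd (dmode x).1 = kodd x.1 by rewrite /dmode /=; case: (x.1).
rewrite [_ *: _ + \sum_(_ <- _) _]addrC addrK big_seq; apply: lspan_sum => t tb; apply/lspanZ/lspan_mem.
have [m tm nm] := br_pos nw pk tb; have [z bz dz] := dmode_surj nm.
have [tl tc] := br_lvl tb; have [zl zc] := dmode_lvl z.
exists z; split=> //; last by rewrite dz -tm.
  by apply: oppr_inj; rewrite -zl dz /= -tm tl dl; ring.
by apply: oppr_inj; rewrite -zc dz /= tc dc; ring.
Qed.

(** * Normal ordering of annihilation words *)

Section Spanning.
Variable v : V.

Definition bigspan (l ch : int) : V -> Prop := lspan (fun u => exists a,
  [/\ all isbig a, sorted brel a, lev a = l, chg a = ch & u = Xop a v]).

(** The supercommutator of two big annihilation modes is a combination of single big annihilation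
    modes, so an exchange costs only shorter words: induction on the length. *)
Lemma Xop_sorted s : all isbig s -> bigspan (lev s) (chg s) (Xop s v).
Proof.
have [n] := ubnP (size s); elim: n s => // n IHn s sn bs.
pose cls t := perm_eq s t.
have inv t : cls t -> [/\ all isbig t, lev t = lev s, chg t = chg s & size t = size s].
  move=> st; split; [by rewrite -(perm_all _ st)| | |by rewrite (perm_size st)].
    by apply: perm_big; rewrite perm_sym.
  by apply: perm_big; rewrite perm_sym.
have swap p x y t : cls (p ++ x :: y :: t) ->
    exists2 e : A, e = (-1) ^+ (kodd y.1 && kodd x.1) &
    bigspan (lev s) (chg s) (Xop (p ++ x :: y :: t) v - e *: Xop (p ++ y :: x :: t) v).
  move=> st; have [ba le ce sz] := inv _ st; move: ba; rewrite all_cat => /and4P[bp bx yb bt].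
  have px : posmode (dmode x).1 (dmode x).2.
    by move: (dmode_big bx); rewrite /wedge /posmode; case: ((dmode x).1) => /=; lia.
  have [e ee span_e] := dop_comm (Xop p v) yb px; exists e.
    by rewrite ee; congr (_ ^+ (_ && _)); rewrite /dmode /=; case: (x.1).
  rewrite !Xop_cat /= -XopBZ.
  apply: (lspan_bind (f := Xop t)) span_e => [z u u'|_ [z [bz zl zc ->]]]; first exact: Xop_lin.
  have -> : Xop t (dop z (Xop p v)) = Xop (p ++ z :: t) v by rewrite Xop_cat.
  have bz' : all isbig (p ++ z :: t) by rewrite all_cat bp /= bz.
  have lt : (size (p ++ z :: t) < n)%N by move: sn; rewrite -sz !size_cat /=; lia.
  have := IHn _ lt bz'; rewrite -le -ce.
  have <- : lev (p ++ z :: t) = lev (p ++ x :: y :: t).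
    by rewrite !lev_cat !lev_cons zl; have [-> _] := dmode_lvl x; ring.
  have <- : chg (p ++ z :: t) = chg (p ++ x :: y :: t).
    by rewrite !chg_cat !chg_cons zc; have [_ ->] := dmode_lvl x; ring.
  by [].
have two : (2%:R : A) \is a GRing.unit.
  by rewrite -(rmorph_nat phi) rmorph_unit // unitfE pnatr_eq0.
apply: (@lspan_sorted _ _ _ (fun x y => (bcode x <= bcode y)%N) (fun x => kodd x.1)
  (fun t => Xop t v) _ cls).
- by move=> x y; apply: leq_total.
- by move=> y x z; apply: leq_trans.
- by move=> t u tu st; apply: perm_trans tu.
- by move=> p x y t /swap[e _ sp]; exists e.
- move=> p x t ox /[dup] st /swap[e ee].
  rewrite ee ox expr1 scaleN1r opprK -mulr2n -scaler_nat => sp.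
  by rewrite -[X in lspan _ X]scale1r -(mulVr two) -scalerA; apply/lspanZ/sp.
- move=> t st so; have [bt lt ct _] := inv _ st.
  by apply: lspan_mem; exists t.
- exact: perm_refl.
Qed.

Definition smallop k (u : V) := match k with
  | KH => u | KL => mode KL 2 u | _ => mode k 1 u end.
Definition smallword (s : seq kind) (u : V) := foldr smallop u s.

Definition testspan (l ch : int) : V -> Prop := lspan (fun u => exists a j k,
  [/\ all isbig a, sorted brel a, alev a j k = l, achg a k = ch & u = test a j k v]).

Let c_exp_unit n : c^-1 ^+ n \is a GRing.unit.
Proof. by rewrite unitrX // unitrV. Qed.

Lemma testspan_Sop j k l ch u : bigspan l ch u ->
  testspan (l + (j.*2 + klev k)%N%:Z) (ch + kcharge k) (Sop j k u).
Proof.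
apply: (lspan_bind (f := Sop j k)) => [x b b'|_ [a [ba sa <- <- ->]]]; first exact: Sop_lin.
have -> : Xop a v = (c^-1 ^+ size a)^-1 *: sXop a v.
  by rewrite /sXop scalerA mulVr // scale1r.
have -> : Sop j k ((c^-1 ^+ size a)^-1 *: sXop a v) = (c^-1 ^+ size a)^-1 *: test a j k v.
  have := Sop_lin j k (c^-1 ^+ size a)^-1 (sXop a v) 0.
  have -> : Sop j k 0 = 0.
    have := Sop_lin j k (-1) 0 0; rewrite scaler0 addr0 scaleN1r addrC.
    by rewrite subrr.
  by rewrite !addr0.
by apply/lspanZ/lspan_mem; exists a, j, k.
Qed.

Let brv0 k m k' n u : br F k m k' n = [::] -> cen F k m k' n = 0 ->
  brv k m k' n u = 0.
Proof. by move=> b0 c0; rewrite /brv b0 c0 big_nil (rmorph0 phi) mul0r scale0r addr0. Qed.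

Lemma L2G1 k u : kodd k -> mode KL 2 (mode k 1 u) = mode k 1 (mode KL 2 u).
Proof.
move=> ok; rewrite mode_comm andFb expr0 scale1r /brv.
case: k ok => // _; rewrite big_seq1 /= (rmorph0 phi) mul0r scale0r addr0 divff ?pnatr_eq0 //;
  by rewrite subrr rmorph0 scale0r addr0.
Qed.

Lemma G1G1_same k u : kodd k -> mode k 1 (mode k 1 u) = 0.
Proof.
move=> ok; have E : mode k 1 (mode k 1 u) = - mode k 1 (mode k 1 u).
  rewrite {1}mode_comm andbb ok expr1 scaleN1r brv0 ?addr0 //; by case: (k) ok.
have two : (2%:R : A) \is a GRing.unit.
  by rewrite -(rmorph_nat phi) rmorph_unit // unitfE pnatr_eq0.
have /eqP := E; rewrite -addr_eq0 -mulr2n -scaler_nat => /eqP E2.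
by rewrite -[LHS]scale1r -(mulVr two) -scalerA E2 scaler0.
Qed.

Lemma G1G1_dual u : mode KM 1 (mode KP 1 u) = - mode KP 1 (mode KM 1 u) + mode KL 2 u.
Proof.
rewrite mode_comm expr1 scaleN1r /brv big_cons big_seq1 /=.
by rewrite subrr mulr0z mul0r !rmorph0 mul0r !scale0r !addr0 rmorph1 scale1r.
Qed.

(** The small annihilation modes are closed under composition up to order: G^+_(1) and G^-_(1)
    square to zero, their anticommutator is L_(2), and L_(2) commutes with both. *)
Lemma testspan_small k l ch u : testspan l ch u ->
  testspan (l + (klev k)%:Z) (ch - kcharge k) (smallop k u).
Proof.
apply: lspan_bind => [z w w'|_ [a [j [k0 [ba sa <- <- ->]]]]].
  by case: k => //=; apply: mode_linear.
rewrite /test; set w := sXop a v.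
have mem j' k' l' ch' : alev a j' k' = l' -> achg a k' = ch' -> testspan l' ch' (Sop j' k' w).
  by move=> <- <-; apply: lspan_mem; exists a, j', k'.
have nil l' ch' : testspan l' ch' 0 by apply: lspan_nil.
case: k; rewrite /smallop.
- by apply: mem; rewrite /= ?subr0 ?addr0.
- case: k0; rewrite /Sop.
  + by apply: (mem j KM); rewrite /alev /achg /=; lia.
  + by apply: (mem j KL); rewrite /alev /achg /=; lia.
  + by rewrite G1G1_same //; apply: nil.
  + by rewrite G1G1_same //; apply: nil.
- case: k0; rewrite /Sop.
  + by apply: (mem j KP); rewrite /alev /achg /=; lia.
  + by rewrite G1G1_same //; apply: nil.
  + rewrite G1G1_dual; apply: lspanD.
      by apply/lspanN/(mem j KL); rewrite /alev /achg /=; lia.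
    by apply: (mem j.+1 KH); rewrite /alev /achg /=; lia.
  + rewrite G1G1_dual G1G1_same // mode0 oppr0 add0r L2G1 //.
    by apply: (mem j.+1 KP); rewrite /alev /achg /=; lia.
- suff -> : mode KL 2 (Sop j k0 w) = Sop j.+1 k0 w.
    by apply: mem; rewrite /alev /achg /=; lia.
  by rewrite /Sop; case: (k0); rewrite /= ?L2G1.
Qed.

Lemma smallop_posmode k : (k != KH) ->
  exists2 n : nat, posmode k n & lvl k n%:Z = - (klev k)%:Z /\ forall u, smallop k u = mode k n%:Z u.
Proof. by case: k => // _; [exists 1%N | exists 1%N | exists 2%N]. Qed.

Definition slev (s : seq kind) : int := \sum_(k <- s) (klev k)%:Z.
Definition schg (s : seq kind) : int := \sum_(k <- s) kcharge k.

Lemma dop_smallword x s a : isbig x -> all isbig a -> all (fun k => k != KH) s ->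
  testspan (lev a + slev s + lvl x.1 (- x.2%:Z)) (chg a - schg s + kcharge x.1)
    (dop x (smallword s (Xop a v))).
Proof.
move=> bx ba; elim: s x bx => [|k s IH] x bx.
  move=> _; rewrite /slev /schg !big_nil /= subr0 addr0.
  have -> : dop x (Xop a v) = Xop (rcons a x) v by rewrite -cats1 Xop_cat.
  have bax : all isbig (rcons a x) by rewrite all_rcons bx.
  have := testspan_Sop 0 KH (Xop_sorted bax).
  by rewrite -cats1 lev_cat chg_cat lev_cons chg_cons lev_nil chg_nil /= !addr0.
move=> /= /andP[kH ks]; have [n pn [ln sn]] := smallop_posmode kH.
rewrite sn; have [e ee sp] := dop_comm (smallword s (Xop a v)) bx pn.
rewrite -[dop x _](subrK (e *: mode k n%:Z (dop x (smallword s (Xop a v))))).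
have sl : slev (k :: s) = (klev k)%:Z + slev s by apply: big_cons.
have sc : schg (k :: s) = kcharge k + schg s by apply: big_cons.
apply: lspanD; last first.
  rewrite -sn; apply: lspanZ; have := testspan_small k (IH x bx ks).
  by congr (testspan _ _ _); rewrite ?sl ?sc; ring.
apply: lspan_sub sp => _ [z [bz zl zc ->]]; have := IH z bz ks.
rewrite zl zc ln; congr (testspan _ _ _); rewrite ?sl ?sc; ring.
Qed.

(** A wedge mode is absorbed by the small part of the test. Any other positive mode is the dual mode
    of some big letter, and is moved through the small part to join the big word. *)
Lemma test_posmode a j k0 k (n : nat) : all isbig a -> sorted brel a -> posmode k n ->
  testspan (alev a j k0 - lvl k n%:Z) (achg a k0 - kcharge k) (mode k n%:Z (test a j k0 v)).
Proof.
move=> ba sa pk.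
have [wk|/dmode_surj[x bx dx]] := boolP (wedge k n).
  have kE : smallop k =1 mode k n%:Z /\ lvl k n%:Z = - (klev k)%:Z.
    move: wk pk; rewrite /wedge /posmode; case: (k) => /= w1 p1.
    - by lia.
    - by have -> : n = 1%N by lia.
    - by have -> : n = 1%N by lia.
    - by have -> : n = 2%N by lia.
  have [kE1 kE2] := kE; rewrite -kE1 kE2 opprK; apply: testspan_small.
  by apply: lspan_mem; exists a, j, k0.
pose s := match k0 with KH => [::] | KP => [:: KM] | KM => [:: KP] | KL => [:: KP; KM] end ++ nseq j KL.
have sE : test a j k0 v = c^-1 ^+ size a *: smallword s (Xop a v).
  have nE u : smallword (nseq j KL) u = iter j (mode KL 2) u by elim: j {s} => //= j ->.
  rewrite /test /sXop /Sop iter_modeZ.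
  by rewrite /s; case: (k0); rewrite /= ?nE ?modeZ.
have sK : all (fun k => k != KH) s by rewrite /s all_cat all_nseq orbT andbT; case: (k0).
have nseqs : slev (nseq j KL) = (j.*2)%:Z /\ schg (nseq j KL) = 0.
  rewrite /slev /schg; elim: j {s sE sK} => [|j [IH1 IH2]]; rewrite ?big_nil //= !big_cons IH1 IH2.
  by split=> //=; lia.
have sl : slev s = (j.*2 + klev k0)%N%:Z.
  rewrite /slev big_cat /= -/(slev (nseq j KL)); have [-> _] := nseqs.
  by case: (k0); rewrite ?big_cons ?big_nil /=; lia.
have sc : schg s = - kcharge k0.
  rewrite /schg big_cat /= -/(schg (nseq j KL)); have [_ ->] := nseqs.
  by case: (k0); rewrite ?big_cons ?big_nil /=; lia.
rewrite sE modeZ; apply: lspanZ.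
have [dl dc] := dmode_lvl x; rewrite dx /= in dl dc.
have := dop_smallword bx ba sK; rewrite sl sc /dop dx /=.
by congr (testspan _ _ _); rewrite /alev /achg ?dl ?dc; ring.
Qed.

End Spanning.

(** * Descendants with prescribed test values *)

Local Notation testx x := (test x.1 x.2.1 x.2.2).
Local Notation Bopx h q x := (Bop h q x.1 x.2.1 x.2.2).

Lemma test_lin (x : pbwidx) z v v' : testx x (z *: v + v') = z *: testx x v + testx x v'.
Proof. by rewrite /test sXop_lin Sop_lin. Qed.

Lemma test0 (x : pbwidx) : testx x 0 = 0.
Proof.
by have := test_lin x (-1) 0 0; rewrite scaler0 addr0 scaleN1r addrC subrr.
Qed.

Lemma test_sum (x : pbwidx) (I : Type) (r : seq I) (G : I -> V) :
  testx x (\sum_(i <- r) G i) = \sum_(i <- r) testx x (G i).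
Proof.
elim: r => [|i r IH]; first by rewrite !big_nil test0.
by rewrite !big_cons -[G i]scale1r test_lin IH !scale1r.
Qed.

Lemma testBZ (x : pbwidx) z v v' : testx x (z *: v - v') = z *: testx x v - testx x v'.
Proof.
rewrite test_lin; congr (_ + _).
by have := test_lin x (-1) v' 0; rewrite test0 !addr0 !scaleN1r.
Qed.

Lemma prim_lin h q z p p' : prim h q p -> prim h q p' -> prim h q (z *: p + p').
Proof.
move=> [a1 a2 a3] [b1 b2 b3]; split.
- by rewrite nprod_linr a1 b1 scalerDr !scalerA mulrC.
- by rewrite nprod_linr a2 b2 scalerDr !scalerA mulrC.
move=> m m1; have [c1 c2 c3 c4] := a3 m m1; have [d1 d2 d3 d4] := b3 m m1.
by split; rewrite nprod_linr ?c1 ?c2 ?c3 ?c4 ?d1 ?d2 ?d3 ?d4 scaler0 addr0.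
Qed.

Lemma prim0 h q : prim h q 0.
Proof. by split=> [||m _]; rewrite ?nprodr0 ?scaler0 //; split; rewrite nprodr0. Qed.

Lemma prim_sum h q (I : Type) (r : seq I) (G : I -> V) (z : I -> A) :
  (forall i, prim h q (G i)) -> prim h q (\sum_(i <- r) z i *: G i).
Proof.
move=> PG; elim: r => [|i r IH]; first by rewrite big_nil; apply: prim0.
by rewrite big_cons; apply: prim_lin.
Qed.

Lemma det_fe n (M : 'M[{poly F}]_n) : \det (map_mx fe M) = fe (\det M).
Proof.
rewrite /fe -[RHS]/(horner_eval c^-1 (map_poly phi (\det M))).
rewrite -(det_map_mx (map_poly phi)) -(det_map_mx (horner_eval c^-1)).
by congr (\det _); apply/matrixP => i j; rewrite !mxE.
Qed.

(* Cramer's rule: the adjugate of the matrix of pairings turns the values of  *)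
(* the annihilation words on a vector into a combination of creation words    *)
(* with the same values, up to the determinant.                               *)
Lemma solve_pairings h q (I : seq pbwidx) (r : pbwidx -> V) : uniq I ->
    (forall x, x \in I -> ivalid x) ->
    (forall x y, x \in I -> y \in I -> ilev x = ilev y /\ ichg x = ichg y) ->
    (nondeg h q \/ forall x, x \in I -> x.2 = (0%N, KH)) ->
    (forall x, prim h q (r x)) ->
  exists f : {poly F}, exists p : pbwidx -> V, [/\ f != 0, forall x, prim h q (p x) &
    forall x, x \in I -> testx x (\sum_(y <- I) Bopx h q y (p y)) = fe f *: r x].
Proof.
move=> uI vI lI nd rp.
pose n := size I; pose x0 : pbwidx := ([::], (0%N, KH)).
pose X (i : 'I_n) := nth x0 I i.
have XI i : X i \in I by apply: mem_nth.
have ent (i j : 'I_n) : exists f : {poly F}, [/\ forall p, prim h q p ->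
      testx (X i) (Bopx h q (X j) p) = fe f *: p,
    X i = X j -> f.[0] != 0 & before (X i) (X j) -> f.[0] = 0].
  have /andP[bi si] := vI _ (XI i); have /andP[bj sj] := vI _ (XI j).
  have [le ce] := lI _ _ (XI i) (XI j).
  have nd' : nondeg h q \/ (X i).2 = (0%N, KH) /\ (X j).2 = (0%N, KH).
    by case: nd => nd; [left | right; rewrite !nd].
  exact: (entry bi bj si sj nd' le ce).
pose M := \matrix_(i, j) projT1 (cid (ent i j)) : 'M[{poly F}]_n.
have [rk [rkI rkB]] := index_rank vI lI.
have Xinj : injective X.
  by move=> i j /eqP; rewrite nth_uniq // => /eqP/val_inj.
have detM : \det M != 0.
  (* The determinant is a polynomial in 1/c; it is nonzero as soon as its constant term, the
     determinant of the limit matrix, is. *)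
  suff : \det (map_mx (horner_eval (0 : F)) M) != 0.
    by rewrite det_map_mx; apply: contraNneq => ->; rewrite rmorph0.
  apply: (det_triangular_rank (r := fun i => rk (X i))).
  - by move=> i j /(rkI _ _ (XI i) (XI j)) /Xinj.
  - by move=> i; rewrite !mxE; have [_ f1 _] := projT2 (cid (ent i i)); apply: f1.
  - by move=> i j /(rkB _ _ (XI i) (XI j)) b; rewrite !mxE; have [_ _ f1] := projT2 (cid (ent i j)); apply: f1.
pose S := map_mx fe M.
pose p (x : pbwidx) : V := if insub (index x I) is Some j then
  \sum_(i <- enum 'I_n) (\adj S) j i *: r (X i) else 0.
have pX j : p (X j) = \sum_(i < n) (\adj S) j i *: r (X i).
  rewrite /p; have -> : index (X j) I = j by rewrite index_uniq.
  by rewrite valK big_enum.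
exists (\det M), p; split=> //.
  by move=> x; rewrite /p; case: insub => [j|]; [apply: prim_sum | apply: prim0].
move=> x xI; have [i ->] : exists i, x = X i.
  have lt : (index x I < n)%N by rewrite index_mem.
  by exists (Ordinal lt); rewrite /X nth_index.
rewrite test_sum (big_nth x0) big_mkord.
transitivity (\sum_(j < n) S i j *: \sum_(k < n) (\adj S) j k *: r (X k)).
  apply: eq_bigr => j _; rewrite -/(X j) -pX !mxE; have [fE _ _] := projT2 (cid (ent i j)).
  by rewrite fE // /p; case: insub => [k|]; [apply: prim_sum | apply: prim0].
under eq_bigr do rewrite scaler_sumr.
rewrite exchange_big /= (bigD1 i) //= [X in _ + X]big1 ?addr0 => [|k ki].
  under eq_bigr do rewrite scalerA.
  rewrite -scaler_suml; congr (_ *: _); rewrite -det_fe -/S.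
  by have /matrixP/(_ i i) := mul_mx_adj S; rewrite !mxE eqxx mulr1n.
under eq_bigr do rewrite scalerA.
rewrite -scaler_suml; have /matrixP/(_ i k) := mul_mx_adj S.
by rewrite !mxE eq_sym (negPf ki) mulr0n => ->; rewrite scale0r.
Qed.

(** * Simultaneous eigenvectors of L_(1) and H_(0), with doubled weights *)

Definition eig (z e : int) (v : V) :=
  mode KL 1 v = phi (z%:~R / 2%:R) *: v /\ mode KH 0 v = phi e%:~R *: v.

Lemma eig_lin z e x v v' : eig z e v -> eig z e v' -> eig z e (x *: v + v').
Proof.
move=> [v1 v2] [w1 w2]; split; rewrite mode_linear ?v1 ?v2 ?w1 ?w2 scalerDr !scalerA;
  by rewrite mulrC.
Qed.

Lemma eig0 z e : eig z e 0.
Proof. by split; rewrite mode0 scaler0. Qed.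

Lemma eigZ z e x v : eig z e v -> eig z e (x *: v).
Proof. by move=> ev; rewrite -[_ *: _]addr0; apply/eig_lin/eig0. Qed.

Lemma eigB z e v v' : eig z e v -> eig z e v' -> eig z e (v - v').
Proof. by move=> ev ev'; rewrite addrC -scaleN1r; apply: eig_lin. Qed.

Lemma eig_mode z e k n v : eig z e v -> eig (z + lvl k n) (e + kcharge k) (mode k n v).
Proof.
have ph (x y : F) : x = y -> phi x *: mode k n v = phi y *: mode k n v by move=> ->.
move=> [v1 v2]; split; rewrite mode_comm andFb expr0 scale1r ?v1 ?v2 modeZ /brv.
  have -> : cen F KL 1 k n = 0.
    by case: (k) => //=; case: ifP => // _; rewrite mulr0z mul0r.
  rewrite (rmorph0 phi) mul0r scale0r addr0.
  have -> : br F KL 1 k n = [:: ((lvl k n)%:~R / 2%:R, (k, n))].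
    by case: (k); rewrite /= /lvl /=; congr [:: (_, (_, _))]; try lia;
      rewrite !(intrD, mulrNz, intrM) /=; field.
  by rewrite big_seq1 -scalerDl -rmorphD; apply: ph; rewrite intrD mulrDl.
have -> : cen F KH 0 k n = 0.
  by case: (k) => //=; case: ifP => // _; rewrite mulr0z mul0r.
rewrite (rmorph0 phi) mul0r scale0r addr0.
have -> : \sum_(t <- br F KH 0 k n) phi t.1 *: mode t.2.1 t.2.2 v = phi (kcharge k)%:~R *: mode k n v.
  case: (k); rewrite /= ?big_nil ?big_seq1 /= ?mulr0z ?rmorph0 ?scale0r //.
  - by rewrite add0r.
  - by rewrite add0r.
by rewrite -scalerDl -rmorphD; apply: ph; rewrite intrD.
Qed.

Lemma eig_eq z e z' e' v : z = z' -> e = e' -> eig z e v -> eig z' e' v.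
Proof. by move=> -> ->. Qed.

Lemma eig_iter z e j k n v : eig z e v ->
  eig (z + j%:Z * lvl k n) (e + j%:Z * kcharge k) (iter j (mode k n) v).
Proof.
move=> ev; elim: j => [|j IH]; first by rewrite !mul0r !addr0.
by apply: eig_eq (eig_mode k n IH); lia.
Qed.

Lemma eig_Bop h q z e (x : pbwidx) p : eig z e p -> eig (z + ilev x) (e + ichg x) (Bopx h q x p).
Proof.
case: x => b [j k] ep; rewrite /ilev /ichg /alev /achg /= /Bop.
have {ep}ep : eig (z + (klev k)%:Z) (e + kcharge k) (svec h q k p).
  case: k => /=; rewrite ?addr0 //.
  - by apply: eig_eq (eig_mode KP 0 ep); rewrite /lvl /=; lia.
  - by apply: eig_eq (eig_mode KM 0 ep); rewrite /lvl /=; lia.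
  - apply: eigB; last apply: eigZ.
      by apply: eig_eq (eig_mode KP 0 (eig_mode KM 0 ep)); rewrite /lvl /=; lia.
    by apply: eig_eq (eig_mode KL 0 ep); rewrite /lvl /=; lia.
have {}ep := eig_iter j KL 0 ep.
elim: b => [|y b IH]; first by rewrite lev_nil chg_nil; apply: eig_eq ep; rewrite /lvl /=; lia.
by apply: eig_eq (eig_mode y.1 (- y.2%:Z) IH); rewrite ?lev_cons ?chg_cons; lia.
Qed.

Lemma eig_test z e (x : pbwidx) v : eig z e v -> eig (z - ilev x) (e - ichg x) (testx x v).
Proof.
case: x => a [j k] ev; rewrite /ilev /ichg /alev /achg /= /test /sXop.
have {}ev : eig (z - lev a) (e - chg a) (c^-1 ^+ size a *: Xop a v).
  apply: eigZ; elim: a z e v ev => [|x a IH] z e v ev.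
    by rewrite lev_nil chg_nil !subr0.
  have [dl dc] := dmode_lvl x.
  by apply: eig_eq (IH _ _ _ (eig_mode (dmode x).1 (dmode x).2%:Z ev));
    rewrite ?lev_cons ?chg_cons ?dl ?dc; lia.
have {}ev := eig_iter j KL 2 ev.
case: k; rewrite /Sop /=.
- by apply: eig_eq ev; rewrite /lvl /=; lia.
- by apply: eig_eq (eig_mode KM 1 ev); rewrite /lvl /=; lia.
- by apply: eig_eq (eig_mode KP 1 ev); rewrite /lvl /=; lia.
- by apply: eig_eq (eig_mode KP 1 (eig_mode KM 1 ev)); rewrite /lvl /=; lia.
Qed.

(** The first condition bounds the charge by the weight and so ensures [nondeg] in positive weight.
    The other two, on weights 1 and 1/2, replace nondegeneracy at the vacuum. *)
Hypothesis Vneg : forall (a : V) (z e : int), eig z e a -> z < 3 * `|e| -> a = 0.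
Hypothesis V2 : forall (a : V) e, eig 2 e a -> mode KL 2 a = 0.
Hypothesis V1 : forall (a : V) e, eig 1 e a -> a = 0.

(** * Descent on the level to a primary vector *)

Definition killed (l : int) (v : V) := forall x : pbwidx, ivalid x -> l < ilev x -> testx x v = 0.

Definition hw (z : int) : F := z%:~R / 2%:R.

(** A positive mode lowers the weight, so by [test_posmode] it turns a test of level at least [l]
    into tests of level above [l]. *)
Lemma killed_posmode l v (x : pbwidx) k (n : nat) : ivalid x -> killed l v -> l <= ilev x ->
  posmode k n -> mode k n%:Z (testx x v) = 0.
Proof.
case: x => a [j k0] /andP[/= ba sa] kv lx pk.
have := test_posmode v j k0 ba sa pk.
have zero u : testspan v (alev a j k0 - lvl k n%:Z) (achg a k0 - kcharge k) u -> u = 0.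
  elim=> // z b d [a' [j' [k' [ba' sa' la' _ ->]]]] _ ->.
  rewrite addr0; have -> : test a' j' k' v = 0; last by rewrite scaler0.
  apply: (kv (a', (j', k'))); first by rewrite /ivalid /= ba' sa'.
  rewrite /ilev /= la'; move: lx pk; rewrite /ilev /= /posmode /lvl; case: (k) => /=; lia.
exact: zero.
Qed.

Lemma test_prim D l v (x : pbwidx) : ivalid x -> eig D 0 v -> killed l v -> l <= ilev x ->
  prim (hw (D - ilev x)) (- ichg x)%:~R (testx x v).
Proof.
move=> vx ev kv lx; have [e1 e2] := eig_test x ev.
split=> //; first by rewrite -sub0r.
move=> m m1; split.
- by apply: (killed_posmode (k := KL) (n := m.+1) vx kv lx).
- exact: (killed_posmode (k := KH) (n := m) vx kv lx).
- exact: (killed_posmode (k := KP) (n := m) vx kv lx).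
- exact: (killed_posmode (k := KM) (n := m) vx kv lx).
Qed.

(** The test ends in weight 0. Just before its last small mode the vector has weight 1/2, where it
    is zero by [V1], or weight 1, where L_(2) kills it by [V2]. *)
Lemma test_vacuum D v (x : pbwidx) : eig D 0 v -> ilev x = D -> x.2 != (0%N, KH) -> testx x v = 0.
Proof.
case: x => a [j k] ev; rewrite /ilev /alev /= => lx ne.
have {ev}[e ev] : exists e, eig (j.*2 + klev k)%N%:Z e (sXop a v).
  have := eig_test (a, (0%N, KH)) ev; rewrite /test /Sop /ilev /alev /= => ev'.
  by eexists; apply: eig_eq ev'; [lia | reflexivity].
have ej := eig_iter j KL 2 ev; rewrite /test /Sop.
have M1 k1 u e1 : eig 1 e1 u -> mode k1 1 u = 0 by move=> /V1 ->; rewrite mode0.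
case: k ne ev ej {lx} => /= ne ev ej.
- case: j ne ev ej => // j _ ev _ /=; apply: (@V2 _ _).
  by have := eig_iter j KL 2 ev; apply: eig_eq; [rewrite /lvl /=; lia | reflexivity].
- by apply: M1; apply: eig_eq ej; [rewrite /lvl /=; lia | reflexivity].
- by apply: M1; apply: eig_eq ej; [rewrite /lvl /=; lia | reflexivity].
- by apply: M1; apply: eig_eq (eig_mode KM 1 ej); [rewrite /lvl /=; lia | reflexivity].
Qed.

Lemma fe1 : fe 1 = 1. Proof. by rewrite -polyC1 feC rmorph1. Qed.

Definition creation (D : int) (u : V) := exists h q (x : pbwidx) p z,
  [/\ ivalid x, 0 < ilev x, eig z (- ichg x) p, z + ilev x = D & u = Bopx h q x p].

Lemma eig_creation D y : lspan (creation D) y -> eig D 0 y.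
Proof.
elim=> [|x a b [h [q [i [p [z [_ _ ep zD ->]]]]]] _ eb]; first exact: eig0.
by apply: eig_lin eb; apply: eig_eq (eig_Bop h q i ep) => //; rewrite addNr.
Qed.

(** Descendants of level [l] and charge [e] are subtracted. Tests of higher level send them to
    negative level, and tests of level [l] and another charge kill them by charge conservation; the
    last clause lets the charges be treated one after the other. *)
Lemma stage (D : nat) (l e : int) v : eig D%:Z 0 v -> killed l v -> 0 < l ->
  exists f y, [/\ f != 0, lspan (creation D%:Z) y, killed l (fe f *: v - y),
    (forall x : pbwidx, ivalid x -> ilev x = l -> ichg x = e -> testx x (fe f *: v - y) = 0) &
    (forall x : pbwidx, ivalid x -> ilev x = l -> testx x v = 0 -> testx x (fe f *: v - y) = 0)].
Proof.
move=> ev kv l0; pose z : int := D%:Z - l.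
(* The test values have doubled weight [z] and charge [-e]; below this bound they vanish already. *)
have [zl|ze] := ltP z (3 * `|e|).
  have one : fe 1 *: v - 0 = v by rewrite fe1 scale1r subr0.
  exists 1, 0; rewrite one oner_eq0; split=> //; first exact: lspan_nil.
  move=> x vx lx cx; have := eig_test x ev; rewrite lx cx => /Vneg; apply.
  by rewrite sub0r normrN.
pose h := hw z; pose q : F := (- e)%:~R.
(* At [z = 0] the pairing of the small words degenerates, so only indices with trivial small part
   are kept; [test_vacuum] takes care of the others. *)
have [I [uI memI]] := pbwidx_enum l e
  (fun x => (z != 0) || (x.2 == (0%N, KH))).
have mI x : x \in I -> [/\ ivalid x, ilev x = l, ichg x = e & (z != 0) || (x.2 == (0%N, KH))].
  by rewrite memI => /and4P[? /eqP ? /eqP ?].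
pose r x := if x \in I then testx x v else 0.
have rp x : prim h q (r x).
  rewrite /r; case: ifP => [/mI[vx lx cx _]|_]; last exact: prim0.
  by have := test_prim vx ev kv; rewrite lx cx; apply.
have nd : nondeg h q \/ forall x, x \in I -> x.2 = (0%N, KH).
  have [z0|z0] := eqVneq z 0.
    by right=> x /mI[_ _ _]; rewrite z0 eqxx => /eqP.
  (* From [3 |e| <= z] and [0 < z], the absolute value of [q/2] is smaller than [h]. *)
  left; have zp : 0 < z by have : 0 <= `|e| by []; lia.
  rewrite /nondeg /h /q /hw; split.
  - rewrite -mulrDl -intrD mulf_neq0 ?invr_eq0 ?pnatr_eq0 // intr_eq0; lia.
  - rewrite -mulrBl -intrB mulf_neq0 ?invr_eq0 ?pnatr_eq0 // intr_eq0; lia.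
  - move=> n; rewrite mulrC divfK ?pnatr_eq0 // -[n%:R]/((n%:Z)%:~R) -intrD intr_eq0; lia.
have vI x : x \in I -> ivalid x by case/mI.
have lI x y : x \in I -> y \in I -> ilev x = ilev y /\ ichg x = ichg y.
  by move=> /mI[_ -> -> _] /mI[_ -> -> _].
have [f [p [f0 pp fE]]] := solve_pairings uI vI lI nd rp.
pose y := \sum_(x <- I) Bopx h q x (p x).
have cy : lspan (creation D%:Z) y.
  rewrite /y big_seq; apply: lspan_sum => x /mI[vx lx cx _]; apply: lspan_mem.
  have [p1 p2 _] := pp x.
  exists h, q, x, (p x), z; split=> //; rewrite ?lx ?cx //.
  by rewrite /z; lia.
have ev' : eig D%:Z 0 (fe f *: v - y) by apply: eigB; [apply: eigZ | apply: eig_creation].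
have ty x g : (forall i, i \in I -> testx x (Bopx h q i (p i)) = 0) -> testx x (g *: v - y) = g *: testx x v.
  by move=> t0; rewrite testBZ /y test_sum big_seq big1 ?subr0 // => i iI; exact: t0.
have tfam x i : ivalid x -> i \in I ->
    fam h q ((size i.1).+1 - size x.1) (l - ilev x) (e - ichg x)
      (fun u => testx x (Bopx h q i u)).
  move=> /andP[bx _] /mI[/andP[bi _] <- <- _].
  exact: (test_fam x.2.1 x.2.2 bx (Bop_fam h q i.2.1 i.2.2 bi)).
exists f, y; split=> //.
- move=> x vx lx; rewrite ty ?kv ?scaler0 // => i iI.
  by apply: (fam_lt0 _ (tfam x i vx iI) (pp i)); lia.
- move=> x vx lx cx; have [xI|xI] := boolP (x \in I).
    by rewrite testBZ /y fE // /r xI subrr.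
  move: xI; rewrite memI vx lx cx !eqxx /= negb_or negbK => /andP[/eqP z0 x2].
  by apply: (test_vacuum ev' _ x2); rewrite lx; move: z0; rewrite /z; lia.
- move=> x vx lx x0; have [cx|cx] := eqVneq (ichg x) e; last first.
    rewrite ty ?x0 ?scaler0 // => i iI.
    have := tfam x i vx iI; rewrite lx subrr => tf.
    by apply: (fam_charge _ tf (pp i)); rewrite subr_eq0 eq_sym.
  have [xI|xI] := boolP (x \in I).
    by rewrite testBZ /y fE // /r xI subrr.
  move: xI; rewrite memI vx lx cx !eqxx /= negb_or negbK => /andP[/eqP z0 x2].
  by apply: (test_vacuum ev' _ x2); rewrite lx; move: z0; rewrite /z; lia.
Qed.

Lemma compose_steps D f1 y1 f2 y2 v : lspan (creation D) y1 -> lspan (creation D) y2 ->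
  fe f2 *: (fe f1 *: v - y1) - y2 = fe (f2 * f1) *: v - (fe f2 *: y1 + y2) /\
  lspan (creation D) (fe f2 *: y1 + y2).
Proof.
move=> c1 c2; split; first by rewrite scalerBr scalerA feM opprD addrA.
by apply/lspanD/c2/lspanZ.
Qed.

Lemma ichg_bound (x : pbwidx) : ivalid x -> `|ichg x| <= ilev x.
Proof.
case: x => b [j k] /andP[/= + _]; rewrite /ichg /ilev /achg /alev /= => bb.
have : `|chg b| <= lev b.
  elim: b bb => [|y b IH] /=; first by rewrite lev_nil chg_nil.
  move=> /andP[yb /IH]; rewrite lev_cons chg_cons.
  by move: yb; rewrite /isbig /lvl; case: (y.1) => /=; lia.
by case: k => /=; lia.
Qed.

(** At level [l] the charges lie between [-l] and [l], so finitely many applications of [stage]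
    suffice. *)
Lemma level_step (D : nat) (l : int) v : eig D%:Z 0 v -> killed l v -> 0 < l ->
  exists f y, [/\ f != 0, lspan (creation D%:Z) y & killed (l - 1) (fe f *: v - y)].
Proof.
move=> ev kv l0.
have eigs f y : lspan (creation D%:Z) y -> eig D%:Z 0 (fe f *: v - y).
  by move=> cy; apply: eigB; [apply: eigZ | apply: eig_creation].
suff H0 (es : seq int) : exists f y, [/\ f != 0, lspan (creation D%:Z) y, killed l (fe f *: v - y) &
    forall x : pbwidx, ivalid x -> ilev x = l -> ichg x \in es -> testx x (fe f *: v - y) = 0].
  have [f [y [f0 cy ky ty]]] := H0 [seq i%:Z - l | i <- iota 0 (absz l).*2.+1].
  exists f, y; split=> // x vx lx; have [xl|xl] := eqVneq (ilev x) l; last first.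
    by apply: ky => //; lia.
  apply: ty => //; have := ichg_bound vx => cb.
  apply/mapP; exists (absz (ichg x + l)); last by lia.
  by rewrite mem_iota; lia.
elim: es => [|e es [f [y [f0 cy ky ty]]]].
  exists 1, 0; rewrite fe1 scale1r subr0 oner_eq0.
  by split=> //; apply: lspan_nil.
have [f' [y' [f'0 cy' ky' ty' ty'']]] := stage e (eigs f y cy) ky l0.
have [E cE] := compose_steps f f' v cy cy'.
exists (f' * f), (fe f' *: y + y'); rewrite -E; split=> //; first by rewrite mulf_neq0.
move=> x vx lx; rewrite inE => /predU1P[xe|xes]; first exact: ty'.
by apply: ty'' => //; apply: ty.
Qed.

(** The descent starts at level [D], above which test values would have negative weight, and stops
    at level 0. There the empty test returns the vector itself, and [test_prim] makes it primary. *)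
Theorem primary_exists (D : nat) v : eig D%:Z 0 v ->
  exists f y, [/\ f != 0, lspan (creation D%:Z) y & prim (hw D%:Z) 0 (fe f *: v - y)].
Proof.
move=> ev.
have [f [y [f0 cy ky]]] : exists f y, [/\ f != 0, lspan (creation D%:Z) y &
    killed 0 (fe f *: v - y)].
  suff H0 n : (n <= D)%N -> exists f y, [/\ f != 0, lspan (creation D%:Z) y &
    killed (D - n)%N%:Z (fe f *: v - y)] by have := H0 D (leqnn D); rewrite subnn.
  elim: n => [|n IH] nD.
    exists 1, 0; rewrite fe1 scale1r subr0 oner_eq0.
    split=> //; first exact: lspan_nil.
    move=> x vx lx; apply: (Vneg (eig_test x ev)).
    have : 0 <= `|0 - ichg x| by []; lia.
  have [f [y [f0 cy ky]]] := IH (ltnW nD).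
  have ev' : eig D%:Z 0 (fe f *: v - y) by apply: eigB; [apply: eigZ | apply: eig_creation].
  have l0 : 0 < (D - n)%N%:Z by lia.
  have [f' [y' [f'0 cy' ky']]] := level_step ev' ky l0.
  have [E cE] := compose_steps f f' v cy cy'.
  exists (f' * f), (fe f' *: y + y'); rewrite -E; split=> //; first by rewrite mulf_neq0.
  by have -> : (D - n.+1)%N%:Z = (D - n)%N%:Z - 1 by lia.
exists f, y; split=> //.
have ev' : eig D%:Z 0 (fe f *: v - y) by apply: eigB; [apply: eigZ | apply: eig_creation].
have l0 : ilev ([::], (0%N, KH)) = 0 by rewrite /ilev /alev /= lev_nil.
have c0 : ichg ([::], (0%N, KH)) = 0 by rewrite /ichg /achg /= chg_nil.
have vx : ivalid ([::], (0%N, KH)) by [].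
have le : 0 <= ilev ([::], (0%N, KH)) by rewrite l0.
have := test_prim vx ev' ky le; rewrite l0 c0 subr0 oppr0 mulr0z.
by rewrite /test /Sop /= /sXop /= expr0 scale1r.
Qed.

End Superconformal.

(** * Creation modes and odd zero modes on decomposable vectors *)

Section Decomposable.
Variables (A : comUnitRingType) (V : vertexSuperalgebraType A).
Variable hom : nat -> V -> Prop.
Hypothesis gr : grading hom.
Hypothesis natU : forall n, (n.+1%:R : A) \is a GRing.unit.

Lemma factU n : (n`!%:R : A) \is a GRing.unit.
Proof. by case: (n`!) (fact_gt0 n). Qed.

Lemma hom_deriv w a k : hom w a -> hom (w + k.*2) (iter k (@vder A V) a).
Proof.
move=> ha; elim: k => [|k IH]; first by rewrite addn0.
by apply: (hom_nprod gr IH (hom_vac gr)); lia.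
Qed.

Lemma creation_modeE k a b : a \o_(Negz k) b = (k`!%:R)^-1 *: ((iter k (@vder A V) a) \o_(-1) b).
Proof. by rewrite iter_vder_nprodN scalerA mulVr ?scale1r ?factU. Qed.

Lemma C1_prod w w1 w2 k a b : (0 < w1)%N -> hom w1 a -> (0 < w2)%N -> hom w2 b ->
  w = (w1 + w2 + k.*2)%N -> C1 hom w (a \o_(Negz k) b).
Proof.
move=> w10 ha w20 hb ->; rewrite creation_modeE; apply/lspanZ/lspan_mem; right.
exists (w1 + k.*2)%N, w2, (iter k (@vder A V) a), b; split=> //; last by lia.
by split; [lia | apply: hom_deriv].
Qed.

Lemma C1_deriv w w1 k a : hom w1 a -> w = (w1 + k.+1.*2)%N -> C1 hom w (a \o_(Negz k.+1) vac).
Proof.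
move=> ha ->; rewrite creation_modeE nprod_vacrN1; apply/lspanZ/lspan_mem; left.
exists (w1 + k.*2)%N, (iter k (@vder A V) a); split=> //; last by lia.
exact: hom_deriv.
Qed.

Lemma dec_word_C1 s : letters_in hom s -> decomposable s -> C1 hom (cweight s) (wvec s).
Proof.
case: s => [|[k [w a]] [|y s]] //= [w0 ha hs].
  by case: k => // k _; apply: (C1_deriv ha); rewrite /cweight /=; lia.
move=> _; have hy := wvec_hom gr (s := y :: s) hs.
apply: (C1_prod w0 ha _ hy); first exact: (@cweight_gt0 _ _ hom (y :: s) hs isT).
by rewrite /cweight /=; lia.
Qed.

Lemma C1_vder w b : hom w b -> C1 hom w.+2 (vder b).
Proof. by move=> hb; apply: lspan_mem; left; exists w, b. Qed.

Variable L : V.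
Hypothesis Lpar : vparity false L.
Hypothesis L0 : forall a, L \o_(0) a = vder a.

Lemma vder_nprod_cov p (a : V) n b : vparity p a ->
  vder (a \o_(n) b) = (vder a) \o_(n) b + a \o_(n) vder b.
Proof.
move=> pa; have [N HN] := nprod_field L a.
have HN' (i : nat) : (N.+1 <= i)%N -> L \o_(i%:Z) a = 0 by move=> ?; apply: HN; lia.
rewrite -!L0 (nprod_comm _ _ _ Lpar pa HN') /= expr0 scale1r addrC; congr (_ + _).
rewrite (@sum_first _ _ (fun i => ((L \o_(i%:Z) a) \o_(0 + n - i%:Z) b) *~ binz 0 i)).
  by rewrite binz0 mulr1z add0r subr0.
by case=> // i _; rewrite /= bin0n mulr0z.
Qed.

Lemma zero_mode_vder p (a b : V) : vparity p a -> a \o_(0) vder b = vder (a \o_(0) b).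
Proof.
by move=> pa; rewrite (vder_nprod_cov _ _ pa) vder_nprod mulr0z add0r.
Qed.

Lemma zero_mode_nop p q (a b d : V) : vparity p a -> vparity q b ->
  a \o_(0) b \o_(-1) d = (-1) ^+ (p && q) *: (b \o_(-1) a \o_(0) d) + (a \o_(0) b) \o_(-1) d.
Proof.
move=> pa pb; have [N HN] := nprod_field a b.
have HN' (i : nat) : (N.+1 <= i)%N -> a \o_(i%:Z) b = 0 by move=> ?; apply: HN; lia.
rewrite (nprod_comm _ _ _ pa pb HN'); congr (_ + _).
rewrite (@sum_first _ _ (fun i => ((a \o_(i%:Z) b) \o_(0 + -1 - i%:Z) d) *~ binz 0 i)).
  by rewrite binz0 mulr1z add0r subr0.
by case=> // i _; rewrite /= bin0n mulr0z.
Qed.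

(** A zero mode is a superderivation of the normally ordered product and commutes with the
    translation operator. *)
Lemma C1_zero_mode w a d : hom 3 a -> C1 hom w d -> C1 hom w.+1 (a \o_(0) d).
Proof.
move=> ha; have pa := hom_parity gr ha.
have h0 w' b : hom w' b -> hom w'.+1 (a \o_(0) b).
  by move=> hb; apply: (hom_nprod gr ha hb); lia.
apply: (lspan_bind (f := fun x => a \o_(0) x)) => [x b b'|]; first exact: nprod_linr.
move=> _ [[w' [b [hb -> ->]]]|[w1 [w2 [b [b' [[w10 hb] [w20 hb'] -> ->]]]]]].
  by rewrite (zero_mode_vder _ pa); apply: C1_vder; apply: h0.
rewrite (zero_mode_nop _ pa (hom_parity gr hb)); apply: lspanD.
  apply/lspanZ/lspan_mem; right; exists w1, w2.+1, b, (a \o_(0) b').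
  by split=> //; [split=> //; apply: h0 | lia].
apply/lspan_mem; right; exists w1.+1, w2, (a \o_(0) b), b'.
by split=> //; split=> //; apply: h0.
Qed.

End Decomposable.

(** * Coordinates in the PBW basis of a freely generated algebra *)

Section Coordinates.
Variables (A : comUnitRingType) (V : vertexSuperalgebraType A).
Variables (gen : nat -> V) (gwt : nat -> nat).
Hypothesis natU : forall n, (n.+1%:R : A) \is a GRing.unit.
Hypothesis free : freely_generated (odd_gen gwt) gen.

Definition pbw := seq (nat * nat).
Definition pvec (w : pbw) : V := wvec [seq gletter gen gwt x | x <- w].
Definition pfact (w : pbw) : A := (\prod_(x <- w) (x.2)`!)%:R.
Notation psorted := (sorted (pbw_rel (odd_gen gwt))).

Lemma pbw_monomialE w : pbw_monomial gen w = pfact w *: pvec w.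
Proof.
rewrite /pbw_monomial nomonomialE big_map; congr (_ *: _).
by rewrite /pvec /wvec -map_comp.
Qed.

Lemma pfactU w : pfact w \is a GRing.unit.
Proof.
rewrite /pfact; elim: w => [|x w IH]; first by rewrite big_nil unitr1.
by rewrite big_cons natrM unitrM IH andbT factU.
Qed.

Definition represents (v : V) (x : pbw -> A) := exists ws : seq pbw,
  [/\ uniq ws, all psorted ws, forall w, w \notin ws -> x w = 0 &
      v = \sum_(w <- ws) x w *: pvec w].

Lemma represents_uniq v x y : represents v x -> represents v y -> x = y.
Proof.
move=> [ws [u1 s1 x0 E1]] [ws' [u2 s2 y0 E2]].
pose W := undup (ws ++ ws').
have uW : uniq W by apply: undup_uniq.
have sW : all psorted W.
  by apply/allP => w; rewrite mem_undup mem_cat => /orP[/(allP s1)|/(allP s2)].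
have ext (z : pbw -> A) (vs : seq pbw) : uniq vs -> {subset vs <= W} ->
    (forall w, w \notin vs -> z w = 0) ->
    \sum_(w <- vs) z w *: pvec w = \sum_(w <- W) z w *: pvec w.
  move=> uv vW z0; rewrite [RHS](bigID (mem vs)) /= [X in _ + X]big1 ?addr0; last first.
    by move=> w wv; rewrite z0 ?scale0r.
  rewrite -[RHS]big_filter; apply: perm_big; apply: uniq_perm => //; first exact: filter_uniq.
  move=> w; rewrite mem_filter; case wv: (w \in vs) => //=; first by rewrite vW.
have [_ _ /(_ W (fun w => (pfact w)^-1 * (x w - y w)) uW sW) F] := free.
have D0 : forall w, w \in W -> (pfact w)^-1 * (x w - y w) = 0.
  apply: F; under eq_bigr => w _.
    rewrite pbw_monomialE scalerA mulrAC mulVr ?pfactU // mul1r scalerBl. over.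
  rewrite sumrB -(ext x ws) // => [|w ww]; last by rewrite mem_undup mem_cat ww.
  rewrite -(ext y ws') // => [|w ww]; last by rewrite mem_undup mem_cat ww orbT.
  by rewrite -E1 -E2 subrr.
apply/funext => w; have [wW|] := boolP (w \in W).
  have := D0 w wW; move/(congr1 (fun z => pfact w * z)).
  by rewrite mulrA mulrV ?pfactU // mul1r mulr0 => /eqP; rewrite subr_eq0 => /eqP.
rewrite mem_undup mem_cat negb_or => /andP[w1 w2].
by rewrite x0 // y0.
Qed.

Lemma represents_ex v : exists x, represents v x.
Proof.
have [_ span _] := free; have [ws [x [sw E]]] := span v.
exists (fun w => if w \in ws then (x w * pfact w) *+ count_mem w ws else 0).
exists (undup ws); split; [exact: undup_uniq| | |].
- by apply/allP => w; rewrite mem_undup => /(allP sw).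
- by move=> w; rewrite mem_undup => /negPf ->.
rewrite E -big_undup_iterop_count; apply: eq_big_seq => w; rewrite mem_undup => ww.
by rewrite ww pbw_monomialE scalerA Monoid.iteropE iter_addr_0 scalerMnl.
Qed.

Definition pcoord (v : V) : pbw -> A := projT1 (cid (represents_ex v)).
Lemma pcoordP v : represents v (pcoord v).
Proof. exact: projT2 (cid (represents_ex v)). Qed.

Lemma pcoordE v x : represents v x -> pcoord v = x.
Proof. exact: represents_uniq (pcoordP v). Qed.

Lemma represents_lin z v v' x y : represents v x -> represents v' y ->
  represents (z *: v + v') (fun w => z * x w + y w).
Proof.
move=> [ws [u1 s1 x0 E1]] [ws' [u2 s2 y0 E2]].
pose W := undup (ws ++ ws').
have ext (f : pbw -> A) (vs : seq pbw) : uniq vs -> {subset vs <= W} ->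
    (forall w, w \notin vs -> f w = 0) ->
    \sum_(w <- vs) f w *: pvec w = \sum_(w <- W) f w *: pvec w.
  move=> uv vW f0; rewrite [RHS](bigID (mem vs)) /= [X in _ + X]big1 ?addr0; last first.
    by move=> w wv; rewrite f0 ?scale0r.
  rewrite -[RHS]big_filter; apply: perm_big; apply: uniq_perm => //.
    exact/filter_uniq/undup_uniq.
  move=> w; rewrite mem_filter; case wv: (w \in vs) => //=; first by rewrite vW.
exists W; split.
- exact: undup_uniq.
- by apply/allP => w; rewrite mem_undup mem_cat => /orP[/(allP s1)|/(allP s2)].
- by move=> w; rewrite mem_undup mem_cat negb_or => /andP[w1 w2]; rewrite x0 // y0 // mulr0 addr0.
rewrite E1 E2 (ext x) // => [|w ww]; last by rewrite mem_undup mem_cat ww.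
rewrite (ext y) // => [|w ww]; last by rewrite mem_undup mem_cat ww orbT.
rewrite scaler_sumr -big_split; apply: eq_bigr => w _.
by rewrite scalerA scalerDl.
Qed.

Lemma pcoord_lin z v v' w : pcoord (z *: v + v') w = z * pcoord v w + pcoord v' w.
Proof. by rewrite (pcoordE (represents_lin z (pcoordP v) (pcoordP v'))). Qed.

Lemma pcoord0 w : pcoord 0 w = 0.
Proof.
have := pcoord_lin (-1) 0 0 w; rewrite scaler0 addr0 mulN1r addrC subrr.
by [].
Qed.

Lemma pcoord_pvec w w' : psorted w -> pcoord (pvec w) w' = (w' == w)%:R.
Proof.
move=> sw; rewrite (@pcoordE _ (fun u => (u == w)%:R)) //.
exists [:: w]; split=> //=; first by rewrite sw.
  by move=> u; rewrite inE => /negPf ->.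
by rewrite big_seq1 eqxx scale1r.
Qed.

(** An operator that is diagonal on the PBW basis: compare the coordinates of both sides of
    [T v = z *: v]. *)
Lemma eigen_pcoord (T : V -> V) (z : A) (ev : pbw -> A) v :
    (forall x a b, T (x *: a + b) = x *: T a + T b) ->
    (forall w, T (pvec w) = ev w *: pvec w) -> T v = z *: v ->
  forall w, ev w * pcoord v w = z * pcoord v w.
Proof.
move=> Tl Tw Tv w; have T0 : T 0 = 0.
  by have := Tl (-1) 0 0; rewrite scaler0 addr0 scaleN1r addrC subrr.
have [ws [u s x0 E]] := pcoordP v.
have r1 : represents (T v) (fun w => ev w * pcoord v w).
  exists ws; split=> // [w' w0|]; first by rewrite x0 ?mulr0.
  rewrite [in LHS]E; elim: (ws) => [|w' vs IH]; first by rewrite !big_nil T0.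
  by rewrite !big_cons Tl IH Tw scalerA mulrC.
have r2 : represents (z *: v) (fun w => z * pcoord v w).
  exists ws; split=> // [w' w0|]; first by rewrite x0 ?mulr0.
  by rewrite [in LHS]E scaler_sumr; apply: eq_bigr => w' _; rewrite scalerA.
by rewrite Tv in r1; have := represents_uniq r1 r2 => /(congr1 (fun f => f w)).
Qed.

Lemma lspan_pvec v (P : pbw -> Prop) : (forall w, psorted w -> pcoord v w != 0 -> P w) ->
  lspan (fun u => exists w, [/\ psorted w, P w & u = pvec w]) v.
Proof.
move=> Pw; have [ws [_ sw _ ->]] := pcoordP v.
rewrite big_seq; apply: lspan_sum => w /(allP sw) ww.
have [->|c0] := eqVneq (pcoord v w) 0; first by rewrite scale0r; apply: lspan_nil.
by apply/lspanZ/lspan_mem; exists w; split=> //; apply: Pw.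
Qed.

End Coordinates.

Section CstMorphism.
Variable K : realType.

Lemma cst_is_zmod_morphism : zmod_morphism (@cst K).
Proof.
move=> x y; rewrite /cst (rmorphB polyC) (rmorphB polyC).
exact: of_poly2_is_zmod_morphism.
Qed.
Lemma cst_is_monoid_morphism : monoid_morphism (@cst K).
Proof.
have [of1 ofM] := @of_poly2_is_monoid_morphism K.
split=> [|x y]; rewrite /cst; first by rewrite !(rmorph1 polyC).
by rewrite !(rmorphM polyC) ofM.
Qed.
HB.instance Definition _ := GRing.isZmodMorphism.Build K[i] (coefR K) (@cst K)
  cst_is_zmod_morphism.
HB.instance Definition _ := GRing.isMonoidMorphism.Build K[i] (coefR K) (@cst K)
  cst_is_monoid_morphism.

End CstMorphism.

(** * Numbering of the generators by diamond and corner *)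

Definition kind_of (r : nat) : kind := odflt KL (kind_decode r).
Definition gwt (i : nat) : nat := ((i %/ 4).+1.*2 + klev (kind_of (i %% 4)))%N.
Definition gch (i : nat) : int := kcharge (kind_of (i %% 4)).
Definition gidx (n : nat) (k : kind) : nat := (n * 4 + kind_code k)%N.

Lemma gidx_divn n k : (gidx n k %/ 4)%N = n.
Proof. by rewrite /gidx divnMDl // divn_small ?addn0 //; case: k. Qed.
Lemma gidx_modn n k : (gidx n k %% 4)%N = kind_code k.
Proof. by rewrite /gidx modnMDl modn_small //; case: k. Qed.
Lemma kind_of_code k : kind_of (kind_code k) = k. Proof. by case: k. Qed.
Lemma gwt_gidx n k : gwt (gidx n k) = (n.+1.*2 + klev k)%N.
Proof. by rewrite /gwt gidx_divn gidx_modn kind_of_code. Qed.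
Lemma gch_gidx n k : gch (gidx n k) = kcharge k.
Proof. by rewrite /gch gidx_modn kind_of_code. Qed.
Lemma gidx_surj i : exists n k, i = gidx n k.
Proof.
exists (i %/ 4)%N, (kind_of (i %% 4)).
rewrite {1}(divn_eq i 4) /gidx; congr (_ + _)%N.
by have := ltn_pmod i (isT : 0 < 4)%N; case: (i %% 4)%N => [|[|[|[|]]]].
Qed.
Lemma gidx_inj n k n' k' : gidx n k = gidx n' k' -> n = n' /\ k = k'.
Proof.
move=> e; split; first by rewrite -(gidx_divn n k) e gidx_divn.
by rewrite -(kind_of_code k) -(gidx_modn n k) e gidx_modn kind_of_code.
Qed.
Lemma gwt_gt0 i : (0 < gwt i)%N. Proof. by rewrite /gwt doubleS. Qed.
Lemma Winfty_oddgenE : Winfty_oddgen = odd_gen gwt.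
Proof.
apply/funext => i; rewrite /Winfty_oddgen /odd_gen /gwt oddD odd_double.
by have := ltn_pmod i (isT : 0 < 4)%N; case: (i %% 4)%N => [|[|[|[|]]]].
Qed.

(** * Evaluation of the base ring at a point (c0, l0) *)

Section Evaluation.
Variables (K : realType) (c0 l0 : K[i]).
Local Notation C := K[i].
Local Notation A := (coefR K).
Local Notation P2 := {poly {poly C}}.
Local Notation phi := (@cst K).
Local Notation of2 := (@of_poly2 K).
Local Notation c := (@ccR K).
Local Notation lam := (@lamR K).

Lemma ev2D (p q : P2) : ev2 (p + q) c0 l0 = ev2 p c0 l0 + ev2 q c0 l0.
Proof. by rewrite /ev2 !hornerD. Qed.
Lemma ev2M (p q : P2) : ev2 (p * q) c0 l0 = ev2 p c0 l0 * ev2 q c0 l0.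
Proof. by rewrite /ev2 !hornerM. Qed.
Lemma ev2X (p : P2) n : ev2 (p ^+ n) c0 l0 = ev2 p c0 l0 ^+ n.
Proof. by rewrite /ev2 !horner_exp. Qed.
Lemma ev2C (z : C) : ev2 z%:P%:P c0 l0 = z.
Proof. by rewrite /ev2 !hornerC. Qed.

Lemma of_poly2B p q : of2 (p - q) = of2 p - of2 q.
Proof. exact: of_poly2_is_zmod_morphism. Qed.
Lemma of_poly2M p q : of2 (p * q) = of2 p * of2 q.
Proof. exact: (@of_poly2_is_monoid_morphism K).2. Qed.
Lemma of_poly2_0 : of2 0 = 0.
Proof. by rewrite -(subrr (0 : P2)) of_poly2B subrr. Qed.
Lemma of_poly2D p q : of2 (p + q) = of2 p + of2 q.
Proof. by rewrite -{1}[q]opprK of_poly2B -sub0r of_poly2B of_poly2_0 sub0r opprK. Qed.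
Lemma of_poly2X p n : of2 (p ^+ n) = of2 p ^+ n.
Proof.
elim: n => [|n IH]; last by rewrite !exprS of_poly2M IH.
by rewrite !expr0; exact: (@of_poly2_is_monoid_morphism K).1.
Qed.

(** This is c^(size f) f(1/c), a polynomial in c and constant in lambda: it clears the denominators
    of [fe]. *)
Definition numer (f : {poly C}) : P2 :=
  (\sum_(i < size f) f`_i *: 'X^(size f - i))%:P.

Lemma numer_neq0 f : f != 0 -> numer f != 0.
Proof.
move=> fn0; have f0 : (0 < size f)%N by rewrite size_poly_gt0.
(* The coefficient of c^1 is the leading coefficient of [f], since [size f] is one more than the
   degree. *)
rewrite /numer polyC_eq0; apply/eqP => /(congr1 (fun q : {poly C} => q`_1)).
have lt : ((size f).-1 < size f)%N by rewrite prednK.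
rewrite coef0 coef_sum (bigD1 (Ordinal lt)) //= big1 ?addr0 => [|i /eqP ne].
  have -> : (size f - (size f).-1 = 1)%N by move: f0; case: (size f) => // n _; rewrite /= subSnn.
  rewrite coefZ coefXn eqxx mulr1.
  by move/eqP; rewrite lead_coef_eq0 (negPf fn0).
rewrite coefZ coefXn; case: eqP => [e|_]; last by rewrite mulr0.
by case: ne; apply: val_inj => /=; have := ltn_ord i; lia.
Qed.

Lemma numerE f : of2 (numer f) = c ^+ size f * fe phi c f.
Proof.
have [cU _ _] := ccR_units K; rewrite /numer /fe (rmorph_sum polyC) (big_morph of2 of_poly2D of_poly2_0) /=.
rewrite horner_coef size_map_poly mulr_sumr; apply: eq_bigr => i _.
rewrite coef_map /= -mul_polyC !(rmorphM polyC) of_poly2M !(rmorphXn polyC) of_poly2X.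
rewrite mulrCA -/(phi _) -/c; congr (_ * _).
by rewrite exprVn -exprB ?(ltnW (ltn_ord i)).
Qed.

Hypothesis den0 : ev2 (locden K) c0 l0 != 0.

Lemma of_poly2_inj : injective of2.
Proof. by move=> p q /(congr1 val) /= /eqP; rewrite tofrac_eq => /eqP. Qed.

Lemma clear_den (x : A) : exists n p, of2 (locden K) ^+ n * x = of2 p.
Proof.
have /asboolP[p [n E]] := valP x; exists n, p; apply: val_inj.
rewrite rmorphM rmorphXn /= E mulrC divfK //; exact: tofrac_locden_neq0.
Qed.

Definition evI (x : A) := exists u w, x = (c - phi c0) * u + (lam - phi l0) * w.

Lemma evID x y : evI x -> evI y -> evI (x + y).
Proof.
move=> [u [w ->]] [u' [w' ->]]; exists (u + u'), (w + w').
by rewrite !mulrDr addrACA.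
Qed.
Lemma evIM x y : evI x -> evI (y * x).
Proof. by move=> [u [w ->]]; exists (y * u), (y * w); ring. Qed.

Lemma evI_poly (p : P2) : evI (of2 p - phi (ev2 p c0 l0)).
Proof.
have /factor_theorem[q pE] : root (p - p.[l0%:P]%:P) l0%:P.
  by rewrite /root hornerD hornerN hornerC subrr.
have /factor_theorem[s rE] : root (p.[l0%:P] - (ev2 p c0 l0)%:P) c0.
  by rewrite /root hornerD hornerN hornerC subrr.
exists (of2 s%:P), (of2 q).
have -> : c - phi c0 = of2 ('X - c0%:P)%:P by rewrite (rmorphB polyC) of_poly2B.
have -> : lam - phi l0 = of2 ('X - l0%:P%:P) by rewrite of_poly2B.
rewrite -!of_poly2M -(rmorphM polyC) -of_poly2D -of_poly2B; congr of2.
by rewrite [('X - c0%:P) * s]mulrC -rE [_ * q]mulrC -pE (rmorphB polyC) [RHS]addrC addrA subrK.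
Qed.

Lemma evIN x : evI x -> evI (- x).
Proof. by rewrite -mulN1r; apply: evIM. Qed.

(** Clear the denominators of the two cofactors and evaluate at (c0, l0): the right-hand side
    vanishes, while the power of [locden] multiplying [z] does not. *)
Lemma evI_cst (z : C) : evI (phi z) -> z = 0.
Proof.
move=> [u [w E]]; have [n [p uE]] := clear_den u; have [m [q wE]] := clear_den w.
pose d := locden K.
have : of2 (d ^+ (n + m) * z%:P%:P) =
    of2 (('X - c0%:P)%:P * (d ^+ m * p) + ('X - l0%:P%:P) * (d ^+ n * q)).
  rewrite of_poly2M -/(phi z) E of_poly2D !of_poly2M !of_poly2X -uE -wE.
  rewrite (rmorphB polyC) !of_poly2B -!/(phi _) -/c -/lam exprD /d.
  by move: (phi c0) (phi l0) => x y; ring.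
move/of_poly2_inj/(congr1 (fun p => ev2 p c0 l0)).
rewrite ev2M ev2C ev2D !ev2M ev2X {2 4}/ev2 !hornerE /= subrr mul0r.
rewrite (_ : ev2 ('X - l0%:P%:P) c0 l0 = 0) ?mul0r ?addr0; last first.
  by rewrite /ev2 !hornerE subrr ?horner0.
by move/eqP; rewrite mulf_eq0 expf_eq0 (negPf den0) andbF /= => /eqP.
Qed.

Lemma evI_exists x : exists z, evI (x - phi z).
Proof.
have [n [p E]] := clear_den x; set d := of2 _ in E.
pose z := ev2 (locden K) c0 l0 ^+ n; have z0 : z != 0 by rewrite expf_neq0.
exists (ev2 p c0 l0 / z); rewrite -[x - _]mul1r -(rmorph1 phi) -(mulVf z0) rmorphM -mulrA.
apply: evIM; rewrite mulrBr -rmorphM [z * _]mulrC divfK //.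
have dz : evI (d ^+ n - phi z) by rewrite -of_poly2X /z -ev2X; apply: evI_poly.
have -> : phi z * x - phi (ev2 p c0 l0) =
  (of2 p - phi (ev2 p c0 l0)) + - x * (d ^+ n - phi z) by rewrite -E; ring.
by apply: evID; [apply: evI_poly | apply: evIM].
Qed.

(** Evaluation as the only constant congruent to [x] modulo the ideal of the point; no choice of
    numerator enters. *)
Definition ev (x : A) : C := projT1 (cid (evI_exists x)).
Lemma evP x : evI (x - phi (ev x)).
Proof. exact: projT2 (cid (evI_exists x)). Qed.

Lemma evE x z : evI (x - phi z) -> ev x = z.
Proof.
move=> xz; apply/eqP; rewrite -subr_eq0; apply/eqP/evI_cst.
have := evID xz (evIN (evP x)); rewrite opprB addrC subrKA rmorphB.
by [].
Qed.

Lemma ev_lin x y z : ev (x * y + z) = ev x * ev y + ev z.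
Proof.
apply: evE; rewrite rmorphD rmorphM.
have -> : x * y + z - (phi (ev x) * phi (ev y) + phi (ev z)) =
  y * (x - phi (ev x)) + (phi (ev x) * (y - phi (ev y)) + (z - phi (ev z))) by ring.
by apply: evID; [|apply: evID; [|exact: evP]]; apply/evIM/evP.
Qed.

Lemma ev_cst z : ev (phi z) = z.
Proof. by apply: evE; rewrite subrr; exists 0, 0; rewrite !mulr0 addr0. Qed.
Lemma ev0 : ev 0 = 0. Proof. by rewrite -(rmorph0 phi) ev_cst. Qed.
Lemma evM x y : ev (x * y) = ev x * ev y.
Proof. by rewrite -[x * y]addr0 ev_lin ev0 addr0. Qed.
Lemma evN x : ev (- x) = - ev x.
Proof. by rewrite -mulN1r evM -(rmorphN1 phi) ev_cst mulN1r. Qed.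

Lemma ev_ideal x : evI x -> ev x = 0.
Proof. by move=> xI; apply: evE; rewrite rmorph0 subr0. Qed.

Lemma ev_poly p : ev (of2 p) = ev2 p c0 l0.
Proof. exact/evE/evI_poly. Qed.

Lemma ev_fe_neq0 f : ev2 (numer f) c0 l0 != 0 -> ev (fe phi c f) != 0.
Proof. by apply: contraNneq => f0; rewrite -ev_poly numerE evM f0 mulr0. Qed.

End Evaluation.

(** * Criteria for strong generation and for minimality *)

Section StrongGeneration.
Variables (A : comUnitRingType) (V : vertexSuperalgebraType A).
Implicit Types S P : V -> Prop.

Lemma strongly_generates_lspan S : (forall n, (n.+1%:R : A) \is a GRing.unit) ->
  (forall v, lspan (fun u => exists2 s : seq (nat * V),
     forall x, x \in s -> S x.2 & u = word_vec s) v) -> strongly_generates S.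
Proof.
move=> natU gen v; elim: (gen v) => [|x _ b [s Ss ->] _ [ts [tsS ->]]].
  by exists [::]; rewrite big_nil.
pose n := (\prod_(y <- s) (y.1)`!)%N.
have nU : (n%:R : A) \is a GRing.unit.
  have : (0 < n)%N by apply: prodn_gt0 => y; apply: fact_gt0.
  by case: n.
exists ((x / n%:R, s) :: ts); split.
  by move=> t; rewrite inE => /predU1P[->|/tsS//] ka /Ss.
by rewrite big_cons /= nomonomialE scalerA divrK.
Qed.

(* A linear form that vanishes on the vacuum, on the decomposable vectors and *)
(* on all the generators but one shows that this one cannot be dispensed with. *)
Lemma generator_needed (F : V -> A) (hom : nat -> V -> Prop) S v :
    grading hom -> (forall n, (n.+1%:R : A) \is a GRing.unit) ->
    (forall x a b, F (x *: a + b) = x * F a + F b) ->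
    F vac = 0 -> (forall w a, C1 hom w a -> F a = 0) ->
    (forall u, S u -> exists2 w, (0 < w)%N & hom w u) ->
    (forall u, S u -> u <> v -> F u = 0) -> F v != 0 ->
  forall S', (forall u, S' u -> S u) -> strongly_generates S' -> S' v.
Proof.
move=> gr natU Flin Fvac FC1 Shom FS Fv S' S'S gen; apply: contrapT => nv.
have F0 : F 0 = 0 by have := Flin (-1) 0 0; rewrite scaler0 addr0 mulN1r addNr.
have Fnom s : (forall ka, ka \in s -> S' ka.2) -> F (nomonomial s) = 0.
  move=> sS; have [s' [s'E hs']] : exists s', s = [seq (x.1, x.2.2) | x <- s'] /\ letters_in hom s'.
    elim: s sS => [|[k a] s IH] sS; first by exists [::].
    have [|s' [-> hs']] := IH; first by move=> ka kas; apply: sS; rewrite inE kas orbT.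
    have [w w0 hw] := Shom a (S'S _ (sS (k, a) (mem_head _ _))).
    by exists ((k, (w, a)) :: s').
  have Fword : F (word_vec s) = 0.
    have [ds|] := boolP (decomposable s').
      by rewrite s'E; apply: (FC1 (cweight s')); apply: dec_word_C1.
    case: s' s'E hs' => [|[[|k] [w a]] [|]] //= sE.
      by rewrite sE.
    rewrite sE in sS *; move=> _ _; rewrite [word_vec _]nprod_vacrN1; apply: FS.
      by apply/S'S/(sS (0%N, a)); rewrite ?mem_head.
    by move=> av; apply: nv; rewrite -av; apply: (sS (0%N, a)); rewrite ?mem_head.
  by rewrite nomonomialE -[_ *: _]addr0 Flin Fword F0 mulr0 addr0.
have [s [sS vE]] := gen v; move: Fv; rewrite vE; apply/negP; rewrite negbK; apply/eqP.
rewrite big_seq; elim/big_rec: _ => [//|t u ts Fu].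
by rewrite Flin Fu (Fnom _ (sS _ ts)) mulr0 addr0.
Qed.

End StrongGeneration.

(** * The universal algebra: weight grading and primary diamonds over the base ring *)

Section Winfty.
Variable K : realType.
Local Notation C := K[i].
Local Notation A := (coefR K).
Local Notation phi := (@cst K).
Variables (V : vertexSuperalgebraType A) (omega : A) (X : Winfty_fields V).
Hypothesis hW : is_Winfty omega X.
Local Notation H := (fH X).
Local Notation Gp := (fGp X).
Local Notation Gm := (fGm X).
Local Notation L := (fL X).
Local Notation modeX := (mode H Gp Gm L).
Local Notation eigX := (eig phi H Gp Gm L).
Local Notation gen := (Winfty_gen X).
Local Notation c := (@ccR K).
Let natU := @natR_unit K.

Lemma Winfty_free : freely_generated (odd_gen gwt) gen.
Proof. by move: hW; rewrite -Winfty_oddgenE; case: X => ? ? ? ? ? ? ? ? []. Qed.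

Lemma Winfty_N2 : N2_superconformal c H Gp Gm L.
Proof. by case: X hW => ? ? ? ? ? ? ? ? [_ [? _]]. Qed.

Definition dgen n k := gen (gidx n k).

Lemma dgenE n k : dgen n k = match k with
  | KH => if n == 0%N then H else Wb X n.+1 | KP => if n == 0%N then Gp else Wp X n.+1
  | KM => if n == 0%N then Gm else Wm X n.+1 | KL => if n == 0%N then L else Wt X n.+1 end.
Proof. by rewrite /dgen /Winfty_gen gidx_modn gidx_divn; case: k. Qed.

Lemma gen_parity i : vparity (odd (gwt i)) (gen i).
Proof. by have [E _ _] := Winfty_free; apply: E. Qed.

Lemma fld_dgen k : fld H Gp Gm L k = dgen 0 k.
Proof. by rewrite dgenE; case: k. Qed.

Lemma H_even : vparity false H.
Proof. by have := gen_parity (gidx 0 KH); rewrite gwt_gidx -/(dgen 0 KH) dgenE. Qed.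
Lemma L_even : vparity false L.
Proof. by have := gen_parity (gidx 0 KL); rewrite gwt_gidx -/(dgen 0 KL) dgenE. Qed.
Lemma Gp_odd : vparity true Gp.
Proof. by have := gen_parity (gidx 0 KP); rewrite gwt_gidx -/(dgen 0 KP) dgenE. Qed.
Lemma Gm_odd : vparity true Gm.
Proof. by have := gen_parity (gidx 0 KM); rewrite gwt_gidx -/(dgen 0 KM) dgenE. Qed.

Lemma c_unit : c \is a GRing.unit.
Proof. by have [] := ccR_units K. Qed.

Lemma L_vder a : L \o_(0) a = vder a.
Proof. by have [[[_ -> _] _ _ _] _ _ _ _] := Winfty_N2. Qed.

Let mode_comm := @mode_comm _ _ phi _ _ _ _ _ _ c_unit Winfty_N2 H_even Gp_odd Gm_odd L_even.
Let eig_mode := @eig_mode _ _ phi _ _ _ _ _ _ c_unit Winfty_N2 H_even Gp_odd Gm_odd L_even.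

Lemma phi_half : phi (2%:R^-1) = 2%:R^-1.
Proof. by rewrite rmorphV ?rmorph_nat // unitfE pnatr_eq0. Qed.

Lemma mode_vac k (n : nat) : modeX k n%:Z vac = 0.
Proof. exact: nprod_vacr. Qed.

Lemma brv_seq k m k' n v : cen C k m k' n = 0 -> brv phi c H Gp Gm L k m k' n v =
  \sum_(t <- br C k m k' n) phi t.1 *: modeX t.2.1 t.2.2 v.
Proof. by move=> c0; rewrite /brv c0 rmorph0 mul0r scale0r addr0. Qed.

(* The generating fields of the superconformal algebra satisfy the relations  *)
(* of the other diamonds.                                                     *)
Lemma dgen_rel n :
  [/\ modeX KP 0 (dgen n KH) = - dgen n KP, modeX KM 0 (dgen n KH) = dgen n KM,
      dgen n KL = modeX KP 0 (modeX KM 0 (dgen n KH)) - 2%:R^-1 *: vder (dgen n KH) &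
      dgen n KL = - modeX KM 0 (modeX KP 0 (dgen n KH)) + 2%:R^-1 *: vder (dgen n KH)].
Proof.
rewrite !dgenE; case: n => [|n] /=; last first.
  case: X hW => h gp gm l wb wp wm wt [_ _ /(_ n.+2 isT)[_ _ [wpE wmE] [E1 E2] _] _ _] /=; rewrite wpE wmE.
  by rewrite /mode /= opprK -E1 -E2.
have fE k : modeX k (-1) vac = fld H Gp Gm L k by apply: nprod_vacrN1.
(* A field is its own (-1)-mode applied to the vacuum, and zero modes kill the vacuum; zero modes on
   fields are thus read off the brackets. *)
have bvac k k' : modeX k 0 (fld H Gp Gm L k') = brv phi c H Gp Gm L k 0 k' (-1) vac.
  by rewrite -fE mode_comm mode_vac /mode nprodr0 scaler0 add0r.
have e1 : modeX KP 0 H = - Gp.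
  by rewrite (bvac KP KH) brv_seq // big_seq1 /= rmorphN1 scaleN1r fE.
have e2 : modeX KM 0 H = Gm.
  by rewrite (bvac KM KH) brv_seq // big_seq1 /= rmorph1 scale1r fE.
have [_ _ _ [G0 _ _ _] _] := Winfty_N2.
have G0' : modeX KM 0 Gp = L - 2%:R^-1 *: vder H.
  rewrite (bvac KM KP) brv_seq // big_cons big_seq1 /= rmorph1 scale1r add0r fE.
  have -> : (- 1 - 0)%:~R / 2%:R = - 2%:R^-1 :> C by rewrite subr0 mulrNz mulN1r.
  congr (_ + _); rewrite -scaleNr -phi_half; congr (_ *: _); exact: (rmorphN phi).
split=> //; rewrite ?e1 ?e2; first by rewrite /mode /= G0 addrK.
by rewrite /mode nprodNr -/(modeX _ _ _) G0' opprK subrK.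
Qed.

Notation coord := (pcoord Winfty_free).
Notation gvec := (pvec gen gwt).
Notation psorted := (sorted (pbw_rel (odd_gen gwt))).

Lemma mode_vder v : modeX KL 0 v = vder v.
Proof. exact: L_vder. Qed.

Lemma eig_dgen n k : eigX (gwt (gidx n k)) (kcharge k) (dgen n k).
Proof.
have eb : eigX n.+1.*2 0 (dgen n KH).
  have hE : (n.+1.*2%:Z)%:~R / 2%:R = n.+1%:R :> C.
    by rewrite -muln2 PoszM intrM mulfK ?pnatr_eq0.
  rewrite /eig /mode hE rmorph0 scale0r rmorph_nat dgenE; case: n {hE} => [|n] /=.
    by have [[_ [-> _] _ _] [-> _ _] _ _ _] := Winfty_N2.
  case: X hW => h gp gm l wb wp wm wt [_ _ /(_ n.+2 isT)[[E _ _ _] E0 _ _ _] _ _].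
  by rewrite /= E E0.
have [e1 e2 e3 _] := dgen_rel n; rewrite gwt_gidx; case: k => /=.
- by rewrite addn0.
- rewrite -[dgen n KP]opprK -e1 -[X in eig _ _ _ _ _ _ _ X]add0r; apply: eigB; first exact: eig0.
  by apply: eig_eq (eig_mode KP 0 eb); rewrite /lvl /=; lia.
- by rewrite -e2; apply: eig_eq (eig_mode KM 0 eb); rewrite /lvl /=; lia.
- rewrite e3 -mode_vder; apply: eigB; last apply: eigZ.
    by apply: eig_eq (eig_mode KP 0 (eig_mode KM 0 eb)); rewrite /lvl /=; lia.
  by apply: eig_eq (eig_mode KL 0 eb); rewrite /lvl /=; lia.
Qed.

Lemma eig_gen i : eigX (gwt i) (gch i) (gen i).
Proof. by have [n [k ->]] := gidx_surj i; rewrite gch_gidx; apply: eig_dgen. Qed.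

Lemma L1_nprod p (z z' : int) (a b : V) n : vparity p a ->
    modeX KL 1 a = phi (z%:~R / 2%:R) *: a -> modeX KL 1 b = phi (z'%:~R / 2%:R) *: b ->
  modeX KL 1 (a \o_(n) b) = phi ((z + z' - 2 * n - 2)%:~R / 2%:R) *: (a \o_(n) b).
Proof.
rewrite /mode /= => pa ea eb; have [N HN] := nprod_field L a.
have HN' (i : nat) : (N.+2 <= i)%N -> L \o_(i%:Z) a = 0 by move=> ?; apply: HN; lia.
rewrite (nprod_comm _ _ _ L_even pa HN') /= expr0 scale1r eb nprodZr.
rewrite (@sum_truncate _ 2 _ (fun i => ((L \o_(i%:Z) a) \o_(1 + n - i%:Z) b) *~ binz 1 i)) //.
  rewrite !big_ord_recl big_ord0 /= /bump /= addr0 bin0 bin1 !mulr1z ea nprodZl L_vder.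
  have -> : 1 + n - 1%:Z = n by lia.
  rewrite vder_nprod (_ : 1 + n - 1 = n); last by lia.
  rewrite -[_ *~ (1 + n)]scaler_int scalerN -scaleNr ?addr0 -!scalerDl; congr (_ *: _).
  rewrite -(rmorph_int phi) -rmorphN -!rmorphD; congr (phi _).
  by rewrite !(intrD, mulrNz, intrM) /=; field.
by move=> [|[|i]] // _; rewrite bin_small ?mulr0z.
Qed.

Lemma H0_nprod p (e e' : int) (a b : V) n : vparity p a ->
    modeX KH 0 a = phi e%:~R *: a -> modeX KH 0 b = phi e'%:~R *: b ->
  modeX KH 0 (a \o_(n) b) = phi (e + e')%:~R *: (a \o_(n) b).
Proof.
rewrite /mode /= => pa ea eb; have [N HN] := nprod_field H a.
have HN' (i : nat) : (N.+1 <= i)%N -> H \o_(i%:Z) a = 0 by move=> ?; apply: HN; lia.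
rewrite (nprod_comm _ _ _ H_even pa HN') /= expr0 scale1r eb nprodZr.
rewrite (@sum_first _ _ (fun i => ((H \o_(i%:Z) a) \o_(0 + n - i%:Z) b) *~ binz 0 i)).
  by rewrite binz0 mulr1z ea nprodZl add0r subr0 -scalerDl -rmorphD addrC -intrD.
by case=> // i _; rewrite /= bin0n mulr0z.
Qed.

Definition pwt (w : pbw) : nat := cweight [seq gletter gen gwt x | x <- w].
Definition pch (w : pbw) : int := \sum_(x <- w) gch x.1.

Lemma pwt_cons x w : pwt (x :: w) = (gwt x.1 + x.2.*2 + pwt w)%N.
Proof. by []. Qed.

Lemma pvec_eig w : vparity (odd (pwt w)) (gvec w) /\ eigX (pwt w) (pch w) (gvec w).
Proof.
elim: w => [|[i k] w [IHp [IH1 IH2]]].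
  split; first exact: vparity_vac.
  by split; rewrite ?/pwt ?/pch ?big_nil /= mulr0z ?mul0r rmorph0 scale0r; apply: nprod_vacr.
have gp := gen_parity i; have [g1 g2] := eig_gen i.
rewrite pwt_cons /pch big_cons -!/(pch _) [(i, k).1]/= [(i, k).2]/=; split.
  rewrite (oddD (gwt i + _)%N) (oddD (gwt i)) odd_double addbF.
  exact: (vparity_nprod _ _ _ (Negz k) _ gp IHp).
split; last exact: (H0_nprod _ gp).
have := L1_nprod (Negz k) gp g1 IH1.
by have -> : (gwt i)%:Z + (pwt w)%:Z - 2 * Negz k - 2 = (gwt i + k.*2 + pwt w)%N%:Z by lia.
Qed.

Lemma cst_inj0 (x : C) (a : A) : x != 0 -> phi x * a = 0 -> a = 0.
Proof.
move=> x0 /(congr1 (fun b => phi x^-1 * b)).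
by rewrite mulrA -rmorphM mulVf // rmorph1 mul1r mulr0.
Qed.

(** L_(1) is diagonal on PBW monomials, and a difference of two distinct eigenvalues is a nonzero
    complex constant, hence not a zero divisor. *)
Lemma coord_L1 (z : int) a w : modeX KL 1 a = phi (z%:~R / 2%:R) *: a ->
  coord a w != 0 -> (pwt w)%:Z = z.
Proof.
move=> ea; apply: contra_neq_eq => ne.
have := eigen_pcoord natU Winfty_free (T := modeX KL 1)
  (ev := fun w => phi (((pwt w)%:Z)%:~R / 2%:R)) _ _ ea.
move/(_ (fun x a b => nprod_linr _ _ _ _ _) (fun w => (pvec_eig w).2.1) w)/eqP.
rewrite -subr_eq0 -mulrBl -rmorphB => /eqP; apply: cst_inj0.
by rewrite -mulrBl -intrB mulf_neq0 ?invr_eq0 ?pnatr_eq0 // intr_eq0 subr_eq0.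
Qed.

Lemma coord_H0 (e : int) a w : modeX KH 0 a = phi e%:~R *: a -> coord a w != 0 -> pch w = e.
Proof.
move=> ea; apply: contra_neq_eq => ne.
have := eigen_pcoord natU Winfty_free (T := modeX KH 0)
  (ev := fun w => phi (pch w)%:~R) _ _ ea.
move/(_ (fun x a b => nprod_linr _ _ _ _ _) (fun w => (pvec_eig w).2.2) w)/eqP.
rewrite -subr_eq0 -mulrBl -rmorphB => /eqP; apply: cst_inj0.
by rewrite -intrB intr_eq0 subr_eq0.
Qed.

Definition whom (w : nat) (a : V) := modeX KL 1 a = phi ((w%:Z)%:~R / 2%:R) *: a.

Lemma hom_lspan w a : whom w a ->
  lspan (fun u => exists s, [/\ psorted s, pwt s = w & u = gvec s]) a.
Proof.
by move=> ha; apply: (lspan_pvec (free := Winfty_free)) => s _ /(coord_L1 ha)[->].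
Qed.

Lemma vparity_lspan p P (a : V) : (forall u, P u -> vparity p u) -> lspan P a -> vparity p a.
Proof.
move=> HP; elim=> [|x u b Pu _ pb]; first exact: vparity0.
by apply/vparityD/pb/vparityZ/HP.
Qed.

Lemma no_pvec_eq0 (P : pbw -> Prop) a : (forall w, coord a w != 0 -> P w) ->
  (forall w, ~ P w) -> a = 0.
Proof.
move=> aP no; have := lspan_pvec (free := Winfty_free) (fun w (_ : psorted w) => aP w).
by case=> // x u b [s [_ /no]].
Qed.

Lemma eig_zero (z e : int) a : (forall w, pwt w = z :> int -> pch w <> e) -> eigX z e a -> a = 0.
Proof.
move=> no [e1 e2]; apply: (@no_pvec_eq0 (fun w => pwt w = z :> int /\ pch w = e)).
  by move=> w w0; split; [apply: coord_L1 w0 | apply: coord_H0 w0].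
by move=> w [/no].
Qed.

Lemma L1_zero (z : int) a : (forall w, pwt w <> z :> int) ->
  modeX KL 1 a = phi (z%:~R / 2%:R) *: a -> a = 0.
Proof.
by move=> no ea; apply: (@no_pvec_eq0 (fun w => pwt w = z :> int)) => // w; apply: coord_L1.
Qed.

Lemma pwt_eq0 w : pwt w = 0%N -> w = [::].
Proof. by case: w => // x w; rewrite pwt_cons; have := gwt_gt0 x.1; lia. Qed.

(** All is read off the PBW basis: the odd generators are those of half-integral weight, no monomial
    has negative weight, and the empty one alone has weight 0. *)
Lemma hom_grading : grading whom.
Proof.
have par w a : whom w a -> vparity (odd w) a.
  move=> /hom_lspan; apply: vparity_lspan => _ [s [_ <- ->]].
  by have [] := pvec_eig s.
split=> //.
- by move=> w; rewrite /whom /mode nprodr0 scaler0.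
- by move=> w x a b; rewrite /whom mode_linear => -> ->; rewrite scalerDr !scalerA mulrC.
- move=> w w' a b n W ha hb WE; rewrite /whom WE.
  exact: (L1_nprod n (par _ _ ha) ha hb).
- move=> w w' a b n ha hb neg.
  by apply: (L1_zero _ (L1_nprod n (par _ _ ha) ha hb)) => s; lia.
- by rewrite /whom /mode nprod_vacr mul0r rmorph0 scale0r.
- move=> a /hom_lspan; elim=> [|x u b [s [_ /pwt_eq0-> ->]] _ [y ->]].
    by exists 0; rewrite scale0r.
  by exists (x + y); rewrite scalerDl.
Qed.

Lemma gen_hom i : whom (gwt i) (gen i).
Proof. by have [] := eig_gen i. Qed.

Lemma pvec_gen_or_C1 s : (0 < pwt s)%N -> isgen gen gwt (pwt s) (gvec s) \/ C1 whom (pwt s) (gvec s).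
Proof.
have [dec|] := boolP (decomposable [seq gletter gen gwt x | x <- s]).
  move=> _; right; apply: (dec_word_C1 hom_grading natU) => //.
  exact: letters_in_gword gwt_gt0 gen_hom _.
case: s => [|[i [|k]] [|]] //= _ _; left; exists i; rewrite ?/pwt ?/cweight /= ?addn0 //.
exact: nprod_vacrN1.
Qed.

Lemma lspan_split P Q R (a : V) : (forall u, P u -> Q u \/ lspan R u) -> lspan P a ->
  exists b d, [/\ lspan Q b, lspan R d & a = b + d].
Proof.
move=> PQR; elim=> [|x u v /PQR + _ [b [d [Qb Rd ->]]]].
  by exists 0, 0; rewrite addr0; split=> //; apply: lspan_nil.
case=> [Qu|Ru].
  by exists (x *: u + b), d; rewrite addrA; split=> //; apply: lspan_cons.
by exists b, (x *: u + d); rewrite addrCA; split=> //; apply/lspanD/Rd/lspanZ.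
Qed.

Lemma gen_span w a : (0 < w)%N -> whom w a ->
  exists b d, [/\ lspan (isgen gen gwt w) b, C1 whom w d & a = b + d].
Proof.
move=> w0 /hom_lspan; apply: lspan_split => _ [s [_ sw ->]].
by rewrite -sw in w0 *; apply: pvec_gen_or_C1.
Qed.

(** The extremal generators are G^+ and G^-, of doubled weight 3 and charge 1 or -1. *)
Lemma pwt_pch w : 3 * `|pch w| <= pwt w.
Proof.
rewrite /pch; elim: w => [|x w IH]; first by rewrite big_nil.
rewrite big_cons pwt_cons; have [n [k e]] := gidx_surj x.1; rewrite e gch_gidx gwt_gidx.
by move: IH; case: k {e} => /=; lia.
Qed.

Let Vneg (a : V) (z e : int) : eigX z e a -> z < 3 * `|e| -> a = 0.
Proof.
move=> ea lt; apply: eig_zero ea => w wz we.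
by have := pwt_pch w; lia.
Qed.

Let V1 (a : V) (e : int) : eigX 1 e a -> a = 0.
Proof.
by apply: eig_zero => -[|x w] /=; rewrite ?pwt_cons.
Qed.

(** Weight 1 contains only the multiples of H, and H is Virasoro primary. *)
Let V2 (a : V) (e : int) : eigX 2 e a -> modeX KL 2 a = 0.
Proof.
move=> [/(@hom_lspan 2) sa _]; elim: sa => [|x u b [s [_ s2 ->]] _ E]; first exact: nprodr0.
rewrite mode_linear E addr0; suff -> : s = [:: (0%N, 0%N)].
  have -> : gvec [:: (0%N, 0%N)] = H by rewrite /pvec /wvec /= nprod_vacrN1 -[gen 0]/(dgen 0 KH) dgenE.
  by have [[_ [_ H2] _ _] _ _ _ _] := Winfty_N2; rewrite /mode H2 // scaler0.
case: s s2 => [|[i k] w] //; rewrite pwt_cons -[(i, k).1]/i -[(i, k).2]/k => E2.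
have i0 : i = 0%N.
  have [n [k' ie]] := gidx_surj i; move: E2; rewrite ie gwt_gidx /gidx.
  by case: n {ie} => [|n]; case: k' => /=; lia.
have g0 : gwt 0 = 2%N by [].
rewrite i0 g0 in E2 *; have [-> w0] : k = 0%N /\ pwt w = 0%N by lia.
by rewrite (pwt_eq0 w0).
Qed.

Let modeB k n a b : modeX k n (a - b) = modeX k n a - modeX k n b.
Proof. exact: nprodBr. Qed.
Let modeN k n a : modeX k n (- a) = - modeX k n a.
Proof. exact: nprodNr. Qed.
Let modeZ k n x a : modeX k n (x *: a) = x *: modeX k n a.
Proof. exact: nprodZr. Qed.
Let modeD k n a b : modeX k n (a + b) = modeX k n a + modeX k n b.
Proof. exact: nprodDr. Qed.
Let mode0 k n : modeX k n 0 = 0.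
Proof. exact: nprodr0. Qed.

Lemma supercurrent_hom k : kodd k -> whom 3 (fld H Gp Gm L k).
Proof. by rewrite (fld_dgen k); case: k => // _; exact: (gen_hom (gidx 0 _)). Qed.

Lemma zero_mode_hom k w a : kodd k -> whom w a -> whom w.+1 (modeX k 0 a).
Proof. by move=> /supercurrent_hom G ha; apply: (hom_nprod hom_grading G ha); lia. Qed.

Lemma zero_mode_C1 k w a : kodd k -> C1 whom w a -> C1 whom w.+1 (modeX k 0 a).
Proof. by move=> /supercurrent_hom G; apply: (C1_zero_mode hom_grading L_even L_vder). Qed.

Lemma zero_mode_sq k v : kodd k -> modeX k 0 (modeX k 0 v) = 0.
Proof.
move=> ok; have := mode_comm k 0 k 0 v; rewrite andbb ok expr1 scaleN1r /brv.
have -> : cen C k 0 k 0 = 0 by case: k ok.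
have -> : br C k 0 k 0 = [::] by case: k ok.
rewrite big_nil rmorph0 mul0r scale0r !addr0 => /eqP.
rewrite -addr_eq0 -mulr2n -scaler_nat => /eqP/(congr1 (fun u => 2%:R^-1 *: u)).
by rewrite scalerA mulVr ?natU // scale1r scaler0.
Qed.

Lemma zero_mode_der k v : kodd k -> modeX k 0 (vder v) = vder (modeX k 0 v).
Proof.
move=> ok; apply: (zero_mode_vder L_even L_vder _ (fld_parity H_even Gp_odd Gm_odd L_even k)).
Qed.

(* Up to C1, the zero modes of G+ and G- move along the edges of a diamond.   *)
Lemma zero_mode_dgen n :
  [/\ forall k, kodd k -> C1 whom (n.+1.*2 + 3) (modeX k 0 (dgen n KL)),
      modeX KP 0 (dgen n KP) = 0, modeX KM 0 (dgen n KM) = 0,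
      C1 whom (n.+1.*2 + 2) (modeX KP 0 (dgen n KM) - dgen n KL) &
      C1 whom (n.+1.*2 + 2) (modeX KM 0 (dgen n KP) - dgen n KL)].
Proof.
have [e1 e2 e3 e4] := dgen_rel n.
have hb : whom n.+1.*2 (dgen n KH) by have := gen_hom (gidx n KH); rewrite gwt_gidx addn0.
have der w v : whom w v -> C1 whom w.+2 (2%:R^-1 *: vder v) by move=> hv; apply/lspanZ/C1_vder.
have hd k : kodd k -> C1 whom (n.+1.*2 + 3) (2%:R^-1 *: vder (modeX k 0 (dgen n KH))).
  by move=> ok; rewrite addnS addn2; apply/der/zero_mode_hom.
split.
- case=> // _.
    rewrite e3 modeB modeZ zero_mode_sq // sub0r.
    by rewrite zero_mode_der //; apply/lspanN/hd.
  rewrite e4 modeD modeN modeZ zero_mode_sq //.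
  by rewrite oppr0 add0r zero_mode_der //; apply/hd.
- by rewrite -[dgen n KP]opprK -e1 modeN zero_mode_sq ?oppr0.
- by rewrite -e2 zero_mode_sq.
- by rewrite e3 e2 opprB addrCA subrr addr0 addn2; apply: der.
- rewrite e4 -[dgen n KP]opprK -e1 modeN opprD addrA subrr sub0r addn2.
  exact/lspanN/der.
Qed.

Definition top_or_C1 n u := exists x y, C1 whom n.+2.*2 y /\ u = x *: dgen n KL + y.

Lemma top_or_C1_lin n x u v : top_or_C1 n u -> top_or_C1 n v -> top_or_C1 n (x *: u + v).
Proof.
move=> [y [a [Ca ->]]] [z [b [Cb ->]]]; exists (x * y + z), (x *: a + b).
split; first by apply/lspanD/Cb/lspanZ.
by rewrite scalerDr scalerA scalerDl addrACA.
Qed.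

Lemma top_or_C1_C1 n u : C1 whom n.+2.*2 u -> top_or_C1 n u.
Proof. by exists 0, u; rewrite scale0r add0r. Qed.

(** In this odd degree, [u] is modulo [C1] a combination of the two odd corners of diamond [n]; a
    zero mode sends these to the top corner or to zero, modulo [C1]. *)
Lemma zero_mode_top_or_C1 k n u : kodd k -> whom n.+1.*2.+1 u -> top_or_C1 n (modeX k 0 u).
Proof.
move=> ok hu; have [b [d [gb Cd ->]]] := gen_span (w := n.+1.*2.+1) isT hu.
rewrite -[b]scale1r mode_linear; apply: top_or_C1_lin; last first.
  by apply: top_or_C1_C1; have := zero_mode_C1 ok Cd; rewrite !doubleS.
elim: gb => [|x _ v [i wi ->] _ IH].
  by rewrite mode0; apply: top_or_C1_C1; apply: lspan_nil.
rewrite mode_linear; apply: top_or_C1_lin => //; have [m [k' ie]] := gidx_surj i.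
have [_ PP MM PM MP] := zero_mode_dgen n.
have [mn ok'] : m = n /\ kodd k'.
  by move: wi; rewrite ie gwt_gidx; case: (k') => /=; lia.
rewrite ie mn -/(dgen n k'); case: k k' ok ok' {ie IH Cd} => -[] // _ _; rewrite ?PP ?MM;
  try by apply: top_or_C1_C1; apply: lspan_nil.
  exists 1, (modeX KP 0 (dgen n KM) - dgen n KL); rewrite scale1r [dgen n KL + _]addrC subrK; split=> //.
  by rewrite doubleS -addn2.
exists 1, (modeX KM 0 (dgen n KP) - dgen n KL); rewrite scale1r [dgen n KL + _]addrC subrK; split=> //.
by rewrite doubleS -addn2.
Qed.

Local Notation wop := (wop H Gp Gm L).
Local Notation fe := (fe phi c).

Lemma eig_wop z e w p : eigX z e p -> eigX (z + lev w) (e + chg w) (wop w p).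
Proof.
move=> ep; elim: w => [|y w IH]; first by rewrite lev_nil chg_nil !addr0.
by apply: eig_eq (eig_mode y.1 (- y.2%:Z) IH); rewrite ?lev_cons ?chg_cons; lia.
Qed.

Lemma eig_hom_nat (z e : int) u : eigX z e u -> u = 0 \/ exists2 w : nat, z = w & whom w u.
Proof.
case: z => w ew; first by right; exists w => //; case: ew.
by left; apply: (Vneg ew); have : 0 <= `|e| by []; lia.
Qed.

Lemma fld_hom k : whom (kweight k) (fld H Gp Gm L k).
Proof. by rewrite (fld_dgen k); case: k; exact: (gen_hom (gidx 0 _)). Qed.

(** The first letter decides. A big letter makes a product, L_(0) a derivative, and G_(0) falls
    under [zero_mode_top_or_C1]. *)
Lemma creation_word n z e w p : all nvalid w -> eigX z e p -> 0 < lev w ->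
  z + lev w = n.+2.*2%:Z -> top_or_C1 n (wop w p).
Proof.
case: w => [|[k i] w]; first by rewrite lev_nil.
move=> /= /andP[kv wv] ep _; rewrite lev_cons addrCA /= => zE.
have [->|[W WE hw]] := eig_hom_nat (eig_wop w ep).
  by rewrite mode0; apply/top_or_C1_C1/lspan_nil.
rewrite WE in zE; move: (wop w p) hw => u hu {ep WE wv}.
case: i kv zE => [|i] kv; rewrite /lvl => zE.
  rewrite oppr0; case: k kv zE => //= _ zE.
  - by apply: zero_mode_top_or_C1; rewrite // (_ : _.+1 = W)//; lia.
  - by apply: zero_mode_top_or_C1; rewrite // (_ : _.+1 = W)//; lia.
  - rewrite mode_vder; apply: top_or_C1_C1; have -> : n.+2.*2 = W.+2 by lia.
    exact: C1_vder.
have hk := fld_hom k; have k0 : (0 < kweight k)%N by case: (k).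
have -> : modeX k (- i.+1%:Z) u = fld H Gp Gm L k \o_(Negz i) u by rewrite NegzE.
case: W hu zE => [|W] hu zE; last first.
  by apply: top_or_C1_C1; apply: (C1_prod hom_grading natU k0 hk (ltn0Sn W) hu); lia.
(* A big letter on a multiple of the vacuum is no product. It gives a derivative, or a field of
   doubled weight at least 4, namely L, which is the top of the first diamond. *)
have [x ->] := hom0_vac hom_grading hu; rewrite nprodZr; case: i kv zE => [|i] kv zE.
  rewrite nprod_vacrN1; case: k {kv hk k0} zE => /= zE; try lia.
  have -> : n = 0%N by lia.
  by exists x, 0; rewrite addr0 -(fld_dgen KL); split=> //; apply: lspan_nil.
by apply/top_or_C1_C1/lspanZ/(C1_deriv hom_grading natU hk); lia.
Qed.

Lemma creation_top_or_C1 n y : lspan (creation phi H Gp Gm L n.+2.*2%:Z) y -> top_or_C1 n y.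
Proof.
elim=> [|x u v [h [q [[b [j k]] [p [z [/andP[/= bv _] + ep + ->]]]]]] _ IH].
  by apply/top_or_C1_C1/lspan_nil.
rewrite /ilev /= => l0 zD; apply: top_or_C1_lin IH; rewrite Bop_words.
have vb : all nvalid b by apply: sub_all bv => ?; apply: nvalid_big.
have word j' k' : (j'.*2 + klev k' = j.*2 + klev k)%N -> top_or_C1 n (wop (b ++ sword j' k') p).
  move=> jk; have lE : lev (b ++ sword j' k') = alev b j k.
    by rewrite lev_cat lev_sword jk.
  by apply: creation_word ep _ _; rewrite ?lE // all_cat vb sword_valid.
rewrite addrC -scaleNr; have [kl|] := eqVneq k KL.
  by apply: top_or_C1_lin; apply: word; rewrite // kl /= doubleS addn0 addn2.
move=> kl; have -> : kcoef phi h q k = 0 by case: (k) kl.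
rewrite oppr0 scale0r add0r; exact: word.
Qed.

(** Only the bottom corner sees the preceding top vector: applying a zero mode to it lands in [C1],
    so the other corners keep the single factor [fe f] up to sign. *)
Lemma diamond_exists n : exists v f r,
  [/\ f != 0, n = 0%N -> v = H /\ r = 0, (0 < n)%N -> N2_primary H Gp Gm L n.+1%:R 0 v &
    [/\ whom n.+1.*2 v,
      exists2 y, C1 whom n.+1.*2 y & v = fe f *: dgen n KH + r *: dgen n.-1 KL + y,
      C1 whom (n.+1.*2 + 1) (modeX KP 0 v + fe f *: dgen n KP),
      C1 whom (n.+1.*2 + 1) (modeX KM 0 v - fe f *: dgen n KM) &
      C1 whom (n.+1.*2 + 2) (modeX KP 0 (modeX KM 0 v) - fe f *: dgen n KL)]].
Proof.
have [e1 e2 _ _] := dgen_rel n.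
have eb : eigX n.+1.*2 0 (dgen n KH) by have := eig_dgen n KH; rewrite gwt_gidx addn0.
have [_ _ _ PM _] := zero_mode_dgen n.
have [v [f [r [y [f0 v1 vp hv [Cy vE]]]]]] : exists v f r y,
    [/\ f != 0, n = 0%N -> v = H, (0 < n)%N -> N2_primary H Gp Gm L n.+1%:R 0 v,
     whom n.+1.*2 v & C1 whom n.+1.*2 y /\ v = fe f *: dgen n KH + r *: dgen n.-1 KL + y /\
     (n = 0%N -> r = 0)].
  case: n eb {e1 e2 PM} => [|n] eb.
    (* The first diamond needs no correction. *)
    exists H, 1, 0, 0; rewrite oner_eq0 fe1 scale1r scale0r !addr0 dgenE.
    split=> //; first exact: (gen_hom (gidx 0 KH)).
    by split=> //; apply: lspan_nil.
  have [f [y [f0 cy pv]]] := primary_exists c_unit Winfty_N2 H_even Gp_odd Gm_odd L_even Vneg V2 V1 eb.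
  have [r [u [Cu yE]]] := creation_top_or_C1 cy.
  have hE : phi (hw C n.+2.*2%:Z) = n.+2%:R.
    by rewrite /hw -muln2 PoszM intrM mulfK ?pnatr_eq0 // rmorph_nat.
  have pv' : N2_primary H Gp Gm L n.+2%:R 0 (fe f *: dgen n.+1 KH - y).
    by rewrite -hE -(rmorph0 phi).
  exists (fe f *: dgen n.+1 KH - y), f, (- r), (- u); split=> //.
    by case: pv' => e _ _; rewrite /whom /mode /= e -hE.
  split; first exact: lspanN.
  by rewrite yE opprD addrA scaleNr.
have [PL ML] : C1 whom (n.+1.*2 + 1) (r *: modeX KP 0 (dgen n.-1 KL)) /\
    C1 whom (n.+1.*2 + 1) (r *: modeX KM 0 (dgen n.-1 KL)).
  case: n vE {eb e1 e2 PM f0 v1 vp hv Cy} => [|n] [_ r0].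
    by rewrite r0 // !scale0r; split; apply: lspan_nil.
  have [CL _ _ _ _] := zero_mode_dgen n.
  have wE : (n.+2.*2 + 1 = n.+1.*2 + 3)%N by lia.
  by rewrite wE; split; apply/lspanZ/CL.
have {vE}[vE r0] := vE.
have Py := zero_mode_C1 (k := KP) isT Cy; have My := zero_mode_C1 (k := KM) isT Cy.
have Mv : C1 whom (n.+1.*2 + 1) (modeX KM 0 v - fe f *: dgen n KM).
  rewrite vE !modeD !modeZ e2 -[X in X - _]addrA addrAC subrr add0r.
  by apply/lspanD; rewrite // addn1.
exists v, f, r; split=> //; first by split; auto.
split=> //; first by exists y.
  rewrite vE !modeD !modeZ e1 scalerN -[X in X + fe f *: dgen n KP]addrA addrAC addNr add0r.
  by apply/lspanD; rewrite // addn1.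
have := zero_mode_C1 (k := KP) isT Mv; rewrite modeB modeZ addn1 => Mv'.
have -> : modeX KP 0 (modeX KM 0 v) - fe f *: dgen n KL =
  (modeX KP 0 (modeX KM 0 v) - fe f *: modeX KP 0 (dgen n KM)) +
  fe f *: (modeX KP 0 (dgen n KM) - dgen n KL).
  by rewrite scalerBr addrA subrK.
by apply: lspanD; [rewrite addn2 | apply: lspanZ].
Qed.

Definition gcoord (i : nat) (a : V) : A := pcoord Winfty_free a [:: (i, 0%N)].

Lemma gcoord_lin i x a b : gcoord i (x *: a + b) = x * gcoord i a + gcoord i b.
Proof. exact: (pcoord_lin natU Winfty_free). Qed.

Lemma gcoord0 i : gcoord i 0 = 0.
Proof. exact: (pcoord0 natU Winfty_free). Qed.

Lemma gcoord_gen i j : gcoord i (gen j) = (i == j)%:R.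
Proof.
have -> : gen j = pvec gen gwt [:: (j, 0%N)] by rewrite /pvec /wvec /= nprod_vacrN1.
by rewrite /gcoord (pcoord_pvec natU) //= eqseq_cons andbT xpair_eqE eqxx andbT.
Qed.

Lemma gcoord_vac i : gcoord i vac = 0.
Proof. by rewrite /gcoord (pcoord_pvec natU Winfty_free (w := [::])). Qed.

(** By [C1_nonlinear] only monomials other than single generators occur; here freeness enters the
    minimality argument. *)
Lemma gcoord_C1 i w a : C1 whom w a -> gcoord i a = 0.
Proof.
have two : (2%:R : A) \is a GRing.unit := natU 1.
move=> /(C1_nonlinear hom_grading two gwt_gt0 gen_hom gen_span).
elim=> [|x u b [s [ss sn ->]] _ IH]; first exact: gcoord0.
rewrite gcoord_lin IH addr0 /gcoord (pcoord_pvec natU Winfty_free (w := s)) //.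
suff -> : ([:: (i, 0%N)] == s) = false by rewrite mulr0.
by apply/eqP => sE; rewrite -sE in sn.
Qed.

(** * Transfer to the specialized algebra: generation and minimality *)

Section Specialization.

Variables (v : nat -> V) (ka r : nat -> A).
Hypothesis v0 : v 0%N = H.
Hypothesis r0 : r 0%N = 0.
Hypothesis v_prim : forall n, (0 < n)%N -> N2_primary H Gp Gm L n.+1%:R 0 (v n).
Hypothesis v_hom : forall n, whom n.+1.*2 (v n).
Hypothesis vE : forall n, exists2 y, C1 whom n.+1.*2 y &
  v n = ka n *: dgen n KH + r n *: dgen n.-1 KL + y.
Hypothesis vpE : forall n, C1 whom (n.+1.*2 + 1) (modeX KP 0 (v n) + ka n *: dgen n KP).
Hypothesis vmE : forall n, C1 whom (n.+1.*2 + 1) (modeX KM 0 (v n) - ka n *: dgen n KM).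
Hypothesis vtE : forall n,
  C1 whom (n.+1.*2 + 2) (modeX KP 0 (modeX KM 0 (v n)) - ka n *: dgen n KL).

Variables (c0 l0 : C) (S : vertexSuperalgebraType C) (pi : V -> S).
Hypothesis den0 : ev2 (locden K) c0 l0 != 0.
Hypothesis hpi : is_specialization c0 l0 pi.
Local Notation ev := (ev den0).
Hypothesis ka0 : forall n, ev (ka n) != 0.

Let piD a b : pi (a + b) = pi a + pi b. Proof. by have [[-> _ _ _ _] _ _] := hpi. Qed.
Let pi_cst z a : pi (phi z *: a) = z *: pi a. Proof. by have [[_ -> _ _ _] _ _] := hpi. Qed.
Let pi_vac : pi vac = vac. Proof. by have [[_ _ -> _ _] _ _] := hpi. Qed.
Let pi_nprod a n b : pi (a \o_(n) b) = pi a \o_(n) pi b.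
Proof. by have [[_ _ _ -> _] _ _] := hpi. Qed.
Let pi_par p a : vparity p a -> vparity p (pi a).
Proof. by have [[_ _ _ _ E] _ _] := hpi; apply: E. Qed.
Let pi_surj y : exists a, pi a = y. Proof. by have [_ E _] := hpi; apply: E. Qed.
Let pi_ker a : pi a = 0 <-> exists a1 a2, a = (c - phi c0) *: a1 + (lamR - phi l0) *: a2.
Proof. by have [_ _ E] := hpi; apply: E. Qed.

Let pi0 : pi 0 = 0. Proof. by rewrite -(scale0r (0 : V)) -(rmorph0 phi) pi_cst scale0r. Qed.
Let piN a : pi (- a) = - pi a.
Proof. by rewrite -scaleN1r -(rmorphN1 phi) pi_cst scaleN1r. Qed.
Let piB a b : pi (a - b) = pi a - pi b. Proof. by rewrite piD piN. Qed.

Let piZ x a : pi (x *: a) = ev x *: pi a.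
Proof.
have [u [w E]] := evP den0 x.
rewrite -pi_cst; apply/eqP; rewrite -subr_eq0 -piB -scalerBl E; apply/eqP/pi_ker.
by exists (u *: a), (w *: a); rewrite scalerDl !scalerA.
Qed.

Let pi_lin x a b : pi (x *: a + b) = ev x *: pi a + pi b.
Proof. by rewrite piD piZ. Qed.

Lemma pi_lspan (P : V -> Prop) (Q : S -> Prop) :
  (forall u, P u -> lspan Q (pi u)) -> forall a, lspan P a -> lspan Q (pi a).
Proof.
move=> PQ a; elim=> [|x u b /PQ Pu _ IH]; first by rewrite pi0; apply: lspan_nil.
by rewrite pi_lin; apply/lspanD/IH/lspanZ.
Qed.

Definition homS w y := exists2 a, whom w a & pi a = y.

Lemma homS_grading : grading homS.
Proof.
have gr := hom_grading; split.
- by move=> w; exists 0; [apply: (hom_zero gr) | exact: pi0].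
- move=> w x _ _ [a ha <-] [b hb <-]; exists (phi x *: a + b); first exact: (hom_lin gr).
  by rewrite piD pi_cst.
- by move=> w _ [a ha <-]; apply/pi_par/(hom_parity gr).
- move=> w w' _ _ n W [a ha <-] [b hb <-] WE; exists (a \o_(n) b) => //.
  exact: (hom_nprod gr ha hb WE).
- move=> w w' _ _ n [a ha <-] [b hb <-] neg.
  by rewrite -pi_nprod (hom_nprod_neg gr ha hb neg) pi0.
- by exists vac; [apply: (hom_vac gr) | exact: pi_vac].
- move=> _ [a ha <-]; have [x ->] := hom0_vac gr ha.
  by exists (ev x); rewrite piZ pi_vac.
Qed.

Lemma pi_C1 w a : C1 whom w a -> C1 homS w (pi a).
Proof.
apply: pi_lspan => _ [[w' [b [hb -> ->]]]|[w1 [w2 [b [d [[w10 hb] [w20 hd] -> ->]]]]]];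
  apply: lspan_mem.
  left; exists w', (pi b); split=> //; first by exists b.
  by rewrite /vder pi_nprod pi_vac.
right; exists w1, w2, (pi b), (pi d); split=> //; rewrite ?pi_nprod //.
- by split=> //; exists b.
- by split=> //; exists d.
Qed.

(** Homogeneous vectors of the specialization are images by definition, so decomposables lift, and
    forms that vanish on [C1] upstairs descend to forms that vanish on it. *)
Lemma C1_lift w y : C1 homS w y -> exists2 a, C1 whom w a & pi a = y.
Proof.
elim=> [|x u b Pu _ [d Cd <-]]; first by exists 0; [apply: lspan_nil | exact: pi0].
suff [u' Cu <-] : exists2 u', C1 whom w u' & pi u' = u.
  by exists (phi x *: u' + d); [apply/lspanD/Cd/lspanZ | rewrite piD pi_cst].
case: Pu => [[w' [_ [[a ha <-] -> ->]]]|[w1 [w2 [_ [_ [[w10 [a ha <-]] [w20 [e he <-]] -> ->]]]]]].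
  by exists (vder a); [apply: C1_vder | rewrite /vder pi_nprod pi_vac].
exists (a \o_(-1) e); last exact: pi_nprod.
by apply: lspan_mem; right; exists w1, w2, a, e.
Qed.

(* The four corners of the n-th diamond of primary vectors.                   *)
Definition corner n k : V := match k with
  | KH => v n | KP => modeX KP 0 (v n) | KM => modeX KM 0 (v n)
  | KL => modeX KP 0 (modeX KM 0 (v n)) end.

Lemma corner_hom n k : whom (gwt (gidx n k)) (corner n k).
Proof.
rewrite gwt_gidx; case: k; rewrite /= ?addn0 ?addn1 ?addn2; first exact: v_hom.
- by apply: zero_mode_hom.
- by apply: zero_mode_hom.
- by apply: zero_mode_hom => //; apply: zero_mode_hom.
Qed.

Definition cornerS w y := exists n k, w = gwt (gidx n k) /\ y = pi (corner n k).

Lemma cornerS_hom w y : cornerS w y -> homS w y.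
Proof. by move=> [n [k [-> ->]]]; exists (corner n k) => //; apply: corner_hom. Qed.

Definition modC1 w y := exists b d, [/\ lspan (cornerS w) b, C1 homS w d & y = b + d].

Lemma modC1_lin w x y z : modC1 w y -> modC1 w z -> modC1 w (x *: y + z).
Proof.
move=> [b [d [Tb Cd ->]]] [b' [d' [Tb' Cd' ->]]]; exists (x *: b + b'), (x *: d + d').
by split; [apply/lspanD/Tb'/lspanZ | apply/lspanD/Cd'/lspanZ | rewrite scalerDr addrACA].
Qed.

Lemma modC1_C1 w y : C1 homS w y -> modC1 w y.
Proof. by exists 0, y; rewrite add0r; split=> //; apply: lspan_nil. Qed.

Lemma modC1Z w x y : modC1 w y -> modC1 w (x *: y).
Proof.
move=> my; rewrite -[_ *: _]addr0; apply: modC1_lin my _.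
exact/modC1_C1/lspan_nil.
Qed.

Lemma modC1_corner n k : modC1 (gwt (gidx n k)) (pi (corner n k)).
Proof.
exists (pi (corner n k)), 0; rewrite addr0; split=> //; last exact: lspan_nil.
by apply: lspan_mem; exists n, k.
Qed.

Lemma modC1_cancel w z y : z != 0 -> modC1 w (z *: y) -> modC1 w y.
Proof. by move=> z0 /(@modC1Z _ z^-1); rewrite scalerA mulVf // scale1r. Qed.

(** Off the bottom, corner and generator are proportional modulo [C1], and the factor stays nonzero
    after specialization. *)
Lemma modC1_upper n k : k <> KH -> modC1 (gwt (gidx n k)) (pi (dgen n k)).
Proof.
have step w a y x : C1 whom w a -> modC1 w y -> modC1 w (x *: y - pi a).
  by move=> /pi_C1 Ca my; apply: modC1_lin => //; apply/modC1_C1/lspanN.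
move=> kH; apply: (modC1_cancel (ka0 n)); rewrite -piZ; have := modC1_corner n k.
rewrite gwt_gidx; case: k kH => // _ my.
- have := step _ _ _ 1 (vpE n) my.
  rewrite scale1r piD opprD addrA subrr sub0r => /(@modC1Z _ (-1)).
  by rewrite scaleN1r opprK.
- have := step _ _ _ 1 (vmE n) my.
  by rewrite scale1r piB opprB addrC subrK.
- have := step _ _ _ 1 (vtE n) my.
  by rewrite scale1r piB opprB addrC subrK.
Qed.

(** For a bottom generator, the multiple of the preceding top is removed first, by [modC1_upper]. *)
Lemma modC1_dgen n k : modC1 (gwt (gidx n k)) (pi (dgen n k)).
Proof.
case: k; try by apply: modC1_upper.
apply: (modC1_cancel (ka0 n)); have [y Cy E] := vE n; rewrite gwt_gidx addn0.
have mr : modC1 n.+1.*2 (- ev (r n) *: pi (dgen n.-1 KL)).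
  case: n {E Cy} => [|n]; first by rewrite r0 ev0 oppr0 scale0r; apply/modC1_C1/lspan_nil.
  by apply: modC1Z; have := @modC1_upper n KL; rewrite gwt_gidx doubleS addn2; apply.
have -> : ev (ka n) *: pi (dgen n KH) =
    1 *: (- ev (r n) *: pi (dgen n.-1 KL)) + (- 1 *: pi y + pi (v n)).
  rewrite E !piD !piZ scale1r scaleN1r scaleNr.
  have alg (a b d : S) : a = - b + (- d + (a + b + d)) by rewrite [- d + _]addrC addrK addrC addrK.
  exact: alg.
apply: modC1_lin mr _; apply: modC1_lin; first exact/modC1_C1/pi_C1.
by have := modC1_corner n KH; rewrite gwt_gidx addn0.
Qed.

Definition diamondS d := pi (v d.-1).

Lemma diamondP y : diamond_set (pi Gp) (pi Gm) diamondS y <-> exists n k, y = pi (corner n k).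
Proof.
split=> [[[|n] // _ yE]|[n [k ->]]]; last first.
  exists n.+1 => //; rewrite /diamondS /= -!pi_nprod; case: k => /=.
  - by constructor 1. - by constructor 2. - by constructor 3. - by constructor 4.
exists n; move: yE; rewrite /diamondS /= -!pi_nprod; case=> ->.
- by exists KH. - by exists KP. - by exists KM. - by exists KL.
Qed.

Let natC n : (n.+1%:R : C) \is a GRing.unit.
Proof. by rewrite unitfE pnatr_eq0. Qed.

Lemma cornerS_span w y : (0 < w)%N -> homS w y -> modC1 w y.
Proof.
move=> w0 [a ha <-]; have [b [d [gb Cd ->]]] := gen_span w0 ha.
rewrite -[b]scale1r pi_lin; apply: modC1_lin; last exact/modC1_C1/pi_C1.
elim: gb => [|x _ u [i -> ->] _ IH]; first by rewrite pi0; apply/modC1_C1/lspan_nil.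
by rewrite pi_lin; apply: modC1_lin IH; have [n [k ->]] := gidx_surj i; apply: modC1_dgen.
Qed.

Lemma diamond_generates : strongly_generates (diamond_set (pi Gp) (pi Gm) diamondS).
Proof.
apply: strongly_generates_lspan natC _ => y; have [a <-] := pi_surj y.
have ha : lspan (fun u => exists w, whom w u) a.
  apply: lspan_mono (lspan_pvec (free := Winfty_free) (v := a) (P := fun _ => True) _) => //.
  by move=> u [s [_ _ ->]]; exists (pwt s); have [_ []] := pvec_eig s.
apply: pi_lspan ha => u [w hu].
have hS : homS w (pi u) by exists u.
apply: lspan_mono (word_span_gen homS_grading cornerS_hom cornerS_span hS) => _ [s [ls _ _ ->]].
exists [seq (x.1, x.2.2) | x <- s] => // x.
elim: s ls => //= z s IH [_ Cz ls]; rewrite inE => /predU1P[->|/IH]; last by apply.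
by apply/diamondP; have [n [k [_ ->]]] := Cz; exists n, k.
Qed.

Definition phiS i y := ev (gcoord i (projT1 (cid (pi_surj y)))).

(** Two preimages differ by an element of the ideal of the point times [V], which evaluation kills;
    so the form is independent of the preimage chosen. *)
Lemma phiS_pi i a : phiS i (pi a) = ev (gcoord i a).
Proof.
rewrite /phiS; case: (cid _) => b /= ba.
have /pi_ker[a1 [a2 E]] : pi (b - a) = 0 by rewrite piB ba subrr.
have -> : b = (c - phi c0) *: a1 + (1 *: ((lamR - phi l0) *: a2 + 0) + a).
  by rewrite addr0 scale1r addrA -E subrK.
have i1 : ev (c - phi c0) = 0 by apply: ev_ideal; exists 1, 0; rewrite mulr1 mulr0 addr0.
have i2 : ev (lamR - phi l0) = 0 by apply: ev_ideal; exists 0, 1; rewrite mulr1 mulr0 add0r.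
by rewrite !gcoord_lin gcoord0 addr0 mul1r !ev_lin i1 i2 !mul0r !add0r.
Qed.

Lemma phiS_lin i x y z : phiS i (x *: y + z) = x * phiS i y + phiS i z.
Proof.
have [a <-] := pi_surj y; have [b <-] := pi_surj z.
by rewrite -pi_cst -piD !phiS_pi gcoord_lin ev_lin ev_cst.
Qed.

Lemma phiS_vac i : phiS i vac = 0.
Proof. by rewrite -pi_vac phiS_pi gcoord_vac ev0. Qed.

Lemma phiS_C1 i w y : C1 homS w y -> phiS i y = 0.
Proof. by move=> /C1_lift[a Ca <-]; rewrite phiS_pi (gcoord_C1 i Ca) ev0. Qed.

Lemma gcoord_eqC1 i w x a b : C1 whom w (a - x *: b) -> gcoord i a = x * gcoord i b.
Proof.
move=> Cab; have := gcoord_C1 i Cab; rewrite -scaleNr addrC gcoord_lin mulNr addrC.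
by move/eqP; rewrite subr_eq0 => /eqP.
Qed.

Lemma gidx_eq m l n k : (gidx m l == gidx n k) = (m == n) && (l == k).
Proof.
by apply/eqP/andP => [/gidx_inj[-> ->]|[/eqP-> /eqP->]] //.
Qed.

Lemma phiS_corner m l n k : phiS (gidx m l) (pi (corner n k)) =
  if k == KH then ev (ka n) *+ ((m == n) && (l == KH)) + ev (r n) *+ ((m.+1 == n) && (l == KL))
  else (if k == KP then - ev (ka n) else ev (ka n)) *+ ((m == n) && (l == k)).
Proof.
have gE n' k' : gcoord (gidx m l) (dgen n' k') = ((m == n') && (l == k'))%:R.
  by rewrite gcoord_gen gidx_eq.
have nat_ev x b : ev (x * (b : bool)%:R) = ev x *+ b by case: b; rewrite ?mulr1 ?mulr0 ?ev0.
rewrite phiS_pi; case: k; rewrite /corner.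
- have [y Cy ->] := vE n; rewrite -addrA gcoord_lin -[y]scale1r gcoord_lin.
  rewrite -[_ *: y]addr0 gcoord_lin gcoord0 (gcoord_C1 _ Cy) mulr0 !addr0 !gE.
  rewrite ev_lin -evM !nat_ev; congr (_ + _); case: n {Cy} => [|n]; last by [].
  by rewrite r0 ev0 !mul0rn.
- have : C1 whom (n.+1.*2 + 1) (modeX KP 0 (v n) - (- ka n) *: dgen n KP).
    by rewrite scaleNr opprK.
  by move=> /(gcoord_eqC1 (gidx m l)) ->; rewrite gE nat_ev evN.
- by have /(gcoord_eqC1 (gidx m l)) -> := vmE n; rewrite gE nat_ev.
- by have /(gcoord_eqC1 (gidx m l)) -> := vtE n; rewrite gE nat_ev.
Qed.

Lemma diamond_minimal S' : (forall y, S' y -> diamond_set (pi Gp) (pi Gm) diamondS y) ->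
  strongly_generates S' -> forall y, diamond_set (pi Gp) (pi Gm) diamondS y -> S' y.
Proof.
move=> S'S gen y /diamondP[n [k yE]].
(* A form dual to the corner (n, k). For the top corner, the coordinate of the generator also sees
   the bottom of the next diamond, with coefficient [r n.+1]; the second term cancels this. *)
pose F u := if k == KL then ev (ka n.+1) * phiS (gidx n KL) u - ev (r n.+1) * phiS (gidx n.+1 KH) u
  else phiS (gidx n k) u.
have HL : (KH == KL) = false by [].
have FE m l : F (pi (corner m l)) =
    (if k == KL then ev (ka n.+1) * ev (ka n) else if k == KP then - ev (ka n) else ev (ka n))
    *+ ((m == n) && (l == k)).
  rewrite /F !phiS_corner; case: (eqVneq m n) => [->|_]; last first.
    case: l; case: k {yE F} => //=;
      rewrite ?andbF ?andbT ?addr0 ?add0r ?mulr0n ?mulr0 ?subr0 ?subrr //.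
    case: (eqVneq m n.+1) => [->|_]; rewrite ?mulr0 ?mulr0n ?subr0 // mulrC subrr //.
  rewrite !eqxx; case: l; case: k {yE F} => //=;
    rewrite ?(gtn_eqF (ltnSn n)) ?(ltn_eqF (ltnSn n)) ?HL ?andbF ?mulr1n ?mulr0n ?addr0 ?mulr0 ?subr0 //.
apply: (@generator_needed _ _ F homS (diamond_set (pi Gp) (pi Gm) diamondS)) S'S gen.
- exact: homS_grading.
- exact: natC.
- by move=> x a b; rewrite /F; case: ifP => _; rewrite !phiS_lin //; ring.
- by rewrite /F !phiS_vac; case: ifP; rewrite // !mulr0 subrr.
- by move=> w a Ca; rewrite /F !(phiS_C1 _ Ca); case: ifP; rewrite // !mulr0 subrr.
- move=> u /diamondP[m [l ->]]; exists (gwt (gidx m l)); first exact: gwt_gt0.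
  by exists (corner m l) => //; apply: corner_hom.
- move=> u /diamondP[m [l ->]] ne; rewrite FE.
  case: (eqVneq m n) => [mn|_] //; case: (eqVneq l k) => [lk|_] //.
  by case: ne; rewrite yE mn lk.
- rewrite yE FE !eqxx; case: (k) => /=; rewrite mulr1n ?oppr_eq0 ?mulf_neq0 //.
Qed.

Theorem specialized_diamond :
  primary_diamond_structure (pi H) (pi Gp) (pi Gm) (pi L).
Proof.
exists diamondS; split.
- by move=> [|d] // _; apply: pi_par; have := hom_parity hom_grading (v_hom d); rewrite odd_double.
- by rewrite /diamondS v0.
- move=> [|[|d]] // _; rewrite /diamondS /=; have [e1 e2 e3] := v_prim (ltn0Sn d).
  split.
  - by rewrite -pi_nprod e1 -pi_cst rmorph_nat.
  - by rewrite -pi_nprod e2 !scale0r pi0.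
  - by move=> m m1; have [f1 f2 f3 f4] := e3 m m1; rewrite -!pi_nprod f1 f2 f3 f4 pi0.
split; first exact: diamond_generates.
exact: diamond_minimal.
Qed.

End Specialization.

End Winfty.

Theorem corollaryA5 (K : realType) (V : vertexSuperalgebraType (coefR K))
    (omega : coefR K) (X : Winfty_fields V) :
  omega != 0 -> is_Winfty omega X ->
  for_generic (fun c0 l0 : K[i] =>
    forall (S : vertexSuperalgebraType K[i]) (pi : V -> S),
      is_specialization c0 l0 pi ->
      primary_diamond_structure (pi (fH X)) (pi (fGp X)) (pi (fGm X)) (pi (fL X))).
Proof.
move=> _ hW.
have [v /choice[f /choice[r D]]] := choice (diamond_exists hW).
(* One exceptional polynomial for each diamond: where it does not vanish, the diagonal coefficient
   of that diamond survives specialization. *)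
exists (fun n => numer (f n)); split=> [n|c0 l0 c00 c01 c03 nz S pi hpi].
  by have [f0 _ _ _] := D n; apply: numer_neq0.
have den0 : ev2 (locden K) c0 l0 != 0.
  rewrite /ev2 /locden hornerC !hornerE /= !mulf_neq0 // ?subr_eq0 //.
  by rewrite -!addrA addr_eq0.
have ka0 n : ev den0 (fe (@cst K) ccR (f n)) != 0 by apply: ev_fe_neq0.
apply: (@specialized_diamond K V omega X hW v (fun n => fe (@cst K) ccR (f n)) r
  _ _ _ _ _ _ _ _ c0 l0 S pi den0 hpi ka0).
- by have [_ /(_ erefl)[E _] _ _] := D 0%N.
- by have [_ /(_ erefl)[_ E] _ _] := D 0%N.
- by move=> n; have [_ _ E _] := D n.
- by move=> n; have [_ _ _ [E _ _ _ _]] := D n.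
- by move=> n; have [_ _ _ [_ E _ _ _]] := D n.
- by move=> n; have [_ _ _ [_ _ E _ _]] := D n.
- by move=> n; have [_ _ _ [_ _ _ E _]] := D n.
- by move=> n; have [_ _ _ [_ _ _ _ E]] := D n.
Qed.
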